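(* Let $\phi$ be an $\mathbb H^{n\times n}$-valued rational slice hyperholomorphic function, slice hyperholomorphic at infinity, with minimal realization $$\phi(p)=D+C\star(pI_N-A)^{-\star}B,$$ where $(C,A,B)\in\mathbb H^{n\times N}\times\mathbb H^{N\times N}\times\mathbb H^{N\times n}$ and $D\in\mathbb H^{n\times n}$. Then the kernel $$K_\phi(p,q)=(\phi(p)+\phi(q)^* )\star(p+\overline q)^{-\star}$$ has a finite number of negative squares in the open right half-space $\mathbb H_+$, from which is possibly removed a finite set of points, if and only if there exists a Hermitian non-singular matrix $H\in\mathbb H^{N\times N}$ such that $$\begin{pmatrix}H&0\\0&I_n\end{pmatrix}\begin{pmatrix}A&B\\C&D\end{pmatrix}+\begin{pmatrix}A&B\\C&D\end{pmatrix}^*\begin{pmatrix}H&0\\0&I_n\end{pmatrix}\ge 0.$$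
   Context: $\mathbb H$ is the skew field of quaternions, $\mathbb H_+=\{p\in\mathbb H:\operatorname{Re}p>0\}$, and $\mathbb S$ is the sphere of purely imaginary quaternions of norm $1$. A matrix-valued function $f$ on an axially symmetric open set (one containing $x+Jy$ for all $J\in\mathbb S$ whenever it contains some $x+Iy$, $I\in\mathbb S$) is (left) slice hyperholomorphic if $f(x+Iy)=\alpha(x,y)+I\beta(x,y)$ with $\alpha,\beta$ depending only on $x,y$, real differentiable, $\partial_x\alpha=\partial_y\beta$, $\partial_y\alpha=-\partial_x\beta$, $\alpha(x,-y)=\alpha(x,y)$, $\beta(x,-y)=-\beta(x,y)$. ''Slice hyperholomorphic at infinity'' means slice hyperholomorphic in a set of the form $|p|>r$. The $\star$-product of $f=\alpha+I\beta$ and $g=\gamma+I\delta$ is $f\star g=(\alpha\gamma-\beta\delta)+I(\alpha\delta+\beta\gamma)$. The function $C\star(pI_N-A)^{-\star}B$ is the slice hyperholomorphic extension of $x\mapsto C(xI_N-A)^{-1}B$, $x$ real; for $|p|$ large it equals $\sum_{t\ge0}p^{-t-1}CA^tB$. In the kernel, the $\star$-product is taken in the variable $p$, and $(p+\overline q)^{-\star}=(|q|^2+2\operatorname{Re}(q)p+p^2)^{-1}(p+q)$. The kernel is considered at points of $\mathbb H_+$ at which $\phi$ is slice hyperholomorphic (so the poles of $\phi$, including whole spheres of poles $\{x+Jy: J\in\mathbb S\}$, are excluded). The realization is minimal if $\bigcap_{t\ge0}\ker CA^t=\{0\}$ and $\bigcap_{t\ge0}\ker B^*A^{*t}=\{0\}$.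 An $\mathbb H^{n\times n}$-valued function $K(u,v)$ with $K(u,v)=K(v,u)^*$ for $u,v\in\Omega$ has $\kappa$ negative squares in $\Omega$ if for all $M\in\mathbb N$, $u_1,\dots,u_M\in\Omega$ and $\xi_1,\dots,\xi_M\in\mathbb H^n$, the $M\times M$ Hermitian matrix with $(k,j)$ entry $\xi_k^*K(u_k,u_j)\xi_j$ has at most $\kappa$ strictly negative eigenvalues, and exactly $\kappa$ for some choice of $M,u_1,\dots,u_M,\xi_1,\dots,\xi_M$. For a Hermitian quaternionic matrix $X$, $X\ge0$ means positive semidefinite. *)

(* Defs.v *)
From HB Require Import structures.
From mathcomp Require Import all_boot all_order all_algebra.
From mathcomp Require Import all_classical all_reals all_analysis.
From mathcomp Require Import ring lra.
Set Implicit Arguments.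
Unset Strict Implicit.
Unset Printing Implicit Defensive.
Import Order.TTheory GRing.Theory Num.Theory.
Import numFieldNormedType.Exports.
Local Open Scope classical_set_scope.
Local Open Scope ring_scope.

(* Quat a b c d stands for a + b i + c j + d k. *)
Record quat (R : Type) : Type := Quat { qre : R; qi : R; qj : R; qk : R }.

Section QuatChoice.
Variable R : choiceType.
Definition quat_tuple (p : quat R) := (qre p, qi p, qj p, qk p).
Definition tuple_quat (t : R * R * R * R) :=
  Quat t.1.1.1 t.1.1.2 t.1.2 t.2.
Lemma quat_tupleK : cancel quat_tuple tuple_quat.
Proof. by case. Qed.
HB.instance Definition _ := Choice.copy (quat R) (can_type quat_tupleK).
End QuatChoice.

Section QuatRing.
Variable R : rcfType.
Implicit Types p q r : quat R.

Definition qzero : quat R := Quat 0 0 0 0.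
Definition qone : quat R := Quat 1 0 0 0.
Definition qopp p := Quat (- qre p) (- qi p) (- qj p) (- qk p).
Definition qadd p q :=
  Quat (qre p + qre q) (qi p + qi q) (qj p + qj q) (qk p + qk q).
Definition qmul p q :=
  Quat (qre p * qre q - qi p * qi q - qj p * qj q - qk p * qk q)
       (qre p * qi q + qi p * qre q + qj p * qk q - qk p * qj q)
       (qre p * qj q - qi p * qk q + qj p * qre q + qk p * qi q)
       (qre p * qk q + qi p * qj q - qj p * qi q + qk p * qre q).
Definition qconj p := Quat (qre p) (- qi p) (- qj p) (- qk p).
Definition qnorm2 p := qre p ^+ 2 + qi p ^+ 2 + qj p ^+ 2 + qk p ^+ 2.
Definition qnorm p := Num.sqrt (qnorm2 p).
Definition qinv p :=
  Quat (qre p / qnorm2 p) (- qi p / qnorm2 p)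
       (- qj p / qnorm2 p) (- qk p / qnorm2 p).

Fact qaddA : associative qadd.
Proof. by move=> p q r; congr Quat; rewrite addrA. Qed.
Fact qaddC : commutative qadd.
Proof. by move=> p q; congr Quat; rewrite addrC. Qed.
Fact qadd0 : left_id qzero qadd.
Proof. by case=> *; congr Quat; rewrite add0r. Qed.
Fact qaddN : left_inverse qzero qopp qadd.
Proof. by move=> p; congr Quat; rewrite addNr. Qed.
HB.instance Definition _ :=
  GRing.isZmodule.Build (quat R) qaddA qaddC qadd0 qaddN.

Fact qmulA : associative qmul.
Proof. by move=> p q r; congr Quat => /=; ring. Qed.
Fact qmul1 : left_id qone qmul.
Proof. by case=> *; congr Quat => /=; ring. Qed.
Fact qmulr1 : right_id qone qmul.
Proof. by case=> *; congr Quat => /=; ring. Qed.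
Fact qmulDl : left_distributive qmul qadd.
Proof. by move=> p q r; congr Quat => /=; ring. Qed.
Fact qmulDr : right_distributive qmul qadd.
Proof. by move=> p q r; congr Quat => /=; ring. Qed.
Fact qone_neq0 : qone != qzero.
Proof. by apply/eqP => -[] /eqP; rewrite oner_eq0. Qed.
HB.instance Definition _ := GRing.Zmodule_isNzRing.Build (quat R)
  qmulA qmul1 qmulr1 qmulDl qmulDr qone_neq0.

Lemma qnorm2_eq0 p : (qnorm2 p == 0) = (p == 0).
Proof.
apply/idP/eqP => [|->]; last by rewrite /qnorm2 /= !expr0n /= !addr0.
case: p => a b c d; rewrite /qnorm2 /=.
rewrite !paddr_eq0 ?addr_ge0 ?sqr_ge0 // !sqrf_eq0.
by move=> /andP[/andP[/andP[/eqP-> /eqP->] /eqP->] /eqP->].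
Qed.

Fact qmulV : {in [pred p | p != 0], left_inverse 1 qinv *%R}.
Proof.
move=> p; rewrite inE -qnorm2_eq0 => p0.
congr Quat => /=; rewrite /qnorm2 in p0 *; field; exact: p0.
Qed.
Fact qmulrV : {in [pred p | p != 0], right_inverse 1 qinv *%R}.
Proof.
move=> p; rewrite inE -qnorm2_eq0 => p0.
congr Quat => /=; rewrite /qnorm2 in p0 *; field; exact: p0.
Qed.
Fact qunitP p q : q * p = 1 /\ p * q = 1 -> p \in [pred p | p != 0].
Proof.
move=> [qp _]; rewrite inE; apply/eqP => p0.
by move: qp; rewrite p0 mulr0 => /eqP; rewrite eq_sym oner_eq0.
Qed.
Fact qinv_out : {in [predC [pred p | p != 0]], qinv =1 id}.
Proof.
move=> p; rewrite !inE negbK => /eqP->.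
by congr Quat; rewrite /= ?oppr0 mul0r.
Qed.
HB.instance Definition _ := GRing.NzRing_hasMulInverse.Build (quat R)
  qmulV qmulrV qunitP qinv_out.

End QuatRing.

Notation "x %:q" := (Quat x 0 0 0) (at level 1, format "x %:q") : ring_scope.

Section Slice.
Variable R : realType.
Local Notation H := (quat R).

(* The sphere of purely imaginary quaternions of norm 1. *)
Definition imag_unit (I : H) : Prop := qre I = 0 /\ qnorm I = 1.

Definition axially_symmetric (U : set H) : Prop :=
  forall x y I J, imag_unit I -> imag_unit J ->
    U (x%:q + I * y%:q) -> U (x%:q + J * y%:q).

Definition qopen (U : set H) : Prop :=
  forall p, U p -> exists2 e : R, 0 < e & forall q, qnorm (q - p) < e -> U q.

Definition qdifferentiable (f : R * R -> H) (z : R * R) : Prop :=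
  [/\ differentiable (fun w => qre (f w) : R) z,
      differentiable (fun w => qi (f w) : R) z,
      differentiable (fun w => qj (f w) : R) z &
      differentiable (fun w => qk (f w) : R) z].

Definition qderive (v : R * R) (f : R * R -> H) (z : R * R) : H :=
  Quat ('D_v (fun w => qre (f w) : R) z) ('D_v (fun w => qi (f w) : R) z)
       ('D_v (fun w => qj (f w) : R) z) ('D_v (fun w => qk (f w) : R) z).

Definition mxdifferentiable m n (a : R * R -> 'M[H]_(m, n)) z : Prop :=
  forall i j, qdifferentiable (fun w => a w i j) z.

Definition mxderive m n v (a : R * R -> 'M[H]_(m, n)) z : 'M[H]_(m, n) :=
  \matrix_(i, j) qderive v (fun w => a w i j) z.

Definition slice_hyperholomorphic m n (U : set H) (f : H -> 'M[H]_(m, n)) :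
    Prop :=
  [/\ axially_symmetric U, qopen U &
    exists a b : R * R -> 'M[H]_(m, n),
      forall x y I, imag_unit I -> U (x%:q + I * y%:q) ->
      [/\ f (x%:q + I * y%:q) = a (x, y) + I *: b (x, y),
          mxdifferentiable a (x, y) /\ mxdifferentiable b (x, y),
          mxderive (1, 0) a (x, y) = mxderive (0, 1) b (x, y),
          mxderive (0, 1) a (x, y) = - mxderive (1, 0) b (x, y) &
          a (x, - y) = a (x, y) /\ b (x, - y) = - b (x, y)]].

Definition slice_hyperholomorphic_at_infinity m n (f : H -> 'M[H]_(m, n)) :
    Prop :=
  exists r : R, slice_hyperholomorphic [set p | r < qnorm p] f.

(* The points at which f is slice hyperholomorphic; what is left out is an
   axially symmetric set, so a pole x + Iy excludes its whole sphere. *)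
Definition regular_set m n (f : H -> 'M[H]_(m, n)) : set H :=
  [set p | exists U : set H, U p /\ slice_hyperholomorphic U f].

(* Functions are total, so a rational function has unspecified values at the
   zeros of its denominator den; den is real, hence den(p) commutes with p and
   the value den^{-*} * num at p is den(p)^{-1} (sum_k p^k num_k). *)
Definition rational_slice_hyperholomorphic m n (f : H -> 'M[H]_(m, n)) : Prop :=
  exists (den : {poly R}) (num : seq 'M[H]_(m, n)),
    let denq p := (map_poly (fun x : R => x%:q) den).[p] in
    [/\ den != 0,
        slice_hyperholomorphic [set p | denq p != 0] f &
        forall p, denq p != 0 ->
          f p = (denq p)^-1 *: \sum_(k < size num) p ^+ k *: num`_k].

Definition qi_unit : H := Quat 0 1 0 0.

(* If f (x + Iy) = alpha (x, y) + I beta (x, y) for all I, then alpha and beta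
   are recovered from the values of f at x + iy and x - iy (see sliceE). *)
Definition slice_alpha m n (f : H -> 'M[H]_(m, n)) (x y : R) : 'M[H]_(m, n) :=
  (2^-1)%:q *: (f (x%:q + qi_unit * y%:q) + f (x%:q + qi_unit * (- y)%:q)).
Definition slice_beta m n (f : H -> 'M[H]_(m, n)) (x y : R) : 'M[H]_(m, n) :=
  ((2^-1)%:q * qi_unit) *:
    (f (x%:q + qi_unit * (- y)%:q) - f (x%:q + qi_unit * y%:q)).

Definition qim (p : H) : H := Quat 0 (qi p) (qj p) (qk p).
(* p = x + Iy with x = qre p, y = qnorm (qim p) and I = qdir p. *)
Definition qdir (p : H) : H :=
  if qim p == 0 then qi_unit else qim p * (qnorm (qim p))^-1%:q.

Definition star m n l (f : H -> 'M[H]_(m, n)) (g : H -> 'M[H]_(n, l)) (p : H) :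
    'M[H]_(m, l) :=
  let x := qre p in let y := qnorm (qim p) in
  let a := slice_alpha f x y in let b := slice_beta f x y in
  let c := slice_alpha g x y in let d := slice_beta g x y in
  (a *m c - b *m d) + qdir p *: (a *m d + b *m c).

(* (p + conj q)^{-*}, as a function of p. *)
Definition star_inv_add_conj (q p : H) : H :=
  ((qnorm q ^+ 2)%:q + (2 * qre q)%:q * p + p ^+ 2)^-1 * (p + q).

Definition ctmx m n (M : 'M[H]_(m, n)) : 'M[H]_(n, m) := map_mx (@qconj R) M^T.

Definition qhermitian n (M : 'M[H]_n) : Prop := ctmx M = M.

Definition is_inverse n (M G : 'M[H]_n) : Prop :=
  M *m G = 1%:M /\ G *m M = 1%:M.

Definition nonsingular n (M : 'M[H]_n) : Prop := exists G, is_inverse M G.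

Definition positive_semidefinite n (M : 'M[H]_n) : Prop :=
  qhermitian M /\ forall xi : 'cV[H]_n, 0 <= qre ((ctmx xi *m M *m xi) 0 0).

Definition right_free m k (X : 'M[H]_(m, k)) : Prop :=
  forall c : 'cV[H]_k, X *m c = 0 -> c = 0.

(* G has at least k strictly negative (right) eigenvalues, counted with
   multiplicity: the columns of X are right linearly independent eigenvectors. *)
Definition neg_eigenvalues_ge m (G : 'M[H]_m) (k : nat) : Prop :=
  exists (X : 'M[H]_(m, k)) (lambda : 'rV[R]_k),
    [/\ right_free X, forall i, lambda 0 i < 0 &
        G *m X = X *m diag_mx (map_mx (fun x : R => x%:q) lambda)].

Definition neg_eigenvalues_le m (G : 'M[H]_m) (k : nat) : Prop :=
  forall k', neg_eigenvalues_ge G k' -> (k' <= k)%N.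

Definition gram n (K : H -> H -> 'M[H]_n) m (u : 'I_m -> H)
    (xi : 'I_m -> 'cV[H]_n) : 'M[H]_m :=
  \matrix_(k, j) (ctmx (xi k) *m K (u k) (u j) *m xi j) 0 0.

Definition has_negative_squares n (Om : set H) (K : H -> H -> 'M[H]_n)
    (kappa : nat) : Prop :=
  [/\ forall u v, Om u -> Om v -> K u v = ctmx (K v u),
      forall m (u : 'I_m -> H) (xi : 'I_m -> 'cV[H]_n), (forall k, Om (u k)) ->
        neg_eigenvalues_le (gram K u xi) kappa &
      exists m (u : 'I_m -> H) (xi : 'I_m -> 'cV[H]_n),
        [/\ forall k, Om (u k), neg_eigenvalues_le (gram K u xi) kappa &
            neg_eigenvalues_ge (gram K u xi) kappa]].

Definition right_half_space : set H := [set p | 0 < qre p].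

Definition kernel_phi n (phi : H -> 'M[H]_n) (p q : H) : 'M[H]_n :=
  star (fun p' => phi p' + ctmx (phi q))
       (fun p' => (star_inv_add_conj q p')%:M) p.

(* F is C * (pI - A)^{-*} B on U: the slice hyperholomorphic extension of
   x |-> C (xI - A)^{-1} B from the real axis. *)
Definition is_star_transfer n N (U : set H) (C : 'M[H]_(n, N)) (A : 'M[H]_N)
    (B : 'M[H]_(N, n)) (F : H -> 'M[H]_n) : Prop :=
  slice_hyperholomorphic U F /\
  forall (x : R) (G : 'M[H]_N), U x%:q -> is_inverse (x%:q%:M - A) G ->
    F x%:q = C *m G *m B.

Definition is_realization n N (phi : H -> 'M[H]_n) (D : 'M[H]_n)
    (C : 'M[H]_(n, N)) (A : 'M[H]_N) (B : 'M[H]_(N, n)) : Prop :=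
  exists F, is_star_transfer (regular_set phi) C A B F /\
    forall p, regular_set phi p -> phi p = D + F p.

Definition minimal_realization n N (C : 'M[H]_(n, N)) (A : 'M[H]_N)
    (B : 'M[H]_(N, n)) : Prop :=
  (forall x : 'cV[H]_N, (forall t, C *m A ^+ t *m x = 0) -> x = 0) /\
  (forall x : 'cV[H]_N, (forall t, ctmx B *m ctmx A ^+ t *m x = 0) -> x = 0).

Lemma qi_unitP : imag_unit qi_unit.
Proof.
by split=> //; rewrite /qnorm /qnorm2 /= !expr0n /= expr1n !(addr0, add0r) sqrtr1.
Qed.

Lemma sliceE m n (f : H -> 'M[H]_(m, n)) (a b : R -> 'M[H]_(m, n)) (x y : R) :
  f (x%:q + qi_unit * y%:q) = a y + qi_unit *: b y ->
  f (x%:q + qi_unit * (- y)%:q) = a (- y) + qi_unit *: b (- y) ->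
  a (- y) = a y -> b (- y) = - b y ->
  slice_alpha f x y = a y /\ slice_beta f x y = b y.
Proof.
rewrite /slice_alpha /slice_beta => -> -> -> ->.
have half : (2^-1)%:q + (2^-1)%:q = 1 :> H.
  by congr Quat => /=; rewrite ?addr0 //; field.
split.
  rewrite scalerN addrACA subrr addr0 scalerDr -scalerDl.
  by rewrite half scale1r.
rewrite scalerN opprD addrACA subrr add0r -opprD -scalerDr scalerN.
rewrite scalerA -mulrA -scaleNr.
have -> : - ((2^-1)%:q * (qi_unit * qi_unit)) = (2^-1)%:q :> H.
  by congr Quat => /=; ring.
by rewrite scalerDr -scalerDl half scale1r.
Qed.

Lemma qnorm_qim (x y : R) (I : H) : imag_unit I ->
  qnorm (qim (x%:q + I * y%:q)) = `|y|.
Proof.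
case: I => a b c d [/= -> I1].
have I2 : b ^+ 2 + c ^+ 2 + d ^+ 2 = 1.
  have := congr1 (fun t => t ^+ 2) I1.
  rewrite /qnorm sqr_sqrtr /qnorm2 /= ?addr_ge0 ?sqr_ge0 //.
  by rewrite expr0n /= add0r expr1n.
rewrite /qnorm -sqrtr_sqr; congr Num.sqrt; rewrite /qnorm2 /=.
by rewrite -[RHS]mul1r -I2; ring.
Qed.

(* star is the product (alpha gamma - beta delta) + I (alpha delta + beta gamma)
   for any representation of the factors. *)
Lemma starE m n l (f : H -> 'M[H]_(m, n)) (g : H -> 'M[H]_(n, l))
    (a b : R -> 'M[H]_(m, n)) (c d : R -> 'M[H]_(n, l)) (x y : R) (I : H) :
  imag_unit I ->
  (forall s, f (x%:q + qi_unit * s%:q) = a s + qi_unit *: b s) ->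
  (forall s, g (x%:q + qi_unit * s%:q) = c s + qi_unit *: d s) ->
  (forall s, a (- s) = a s /\ b (- s) = - b s) ->
  (forall s, c (- s) = c s /\ d (- s) = - d s) ->
  star f g (x%:q + I * y%:q) =
    (a y *m c y - b y *m d y) + I *: (a y *m d y + b y *m c y).
Proof.
move=> I1 fE gE ab cd; rewrite /star (qnorm_qim x y I1).
have -> : qre (x%:q + I * y%:q) = x.
  by have [/= -> _] := I1; ring.
have [ea eb] := ab `|y|; have [ec ed] := cd `|y|.
have [-> ->] := sliceE (fE _) (fE _) ea eb.
have [-> ->] := sliceE (gE _) (gE _) ec ed.
have b0 : b 0 = 0.
  apply/matrixP => i j; have [_ +] := ab 0; rewrite oppr0 => /matrixP/(_ i j).
  rewrite !mxE; case: (b 0 i j) => b0 b1 b2 b3 [] h0 h1 h2 h3.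
  by congr Quat; lra.
have d0 : d 0 = 0.
  apply/matrixP => i j; have [_ +] := cd 0; rewrite oppr0 => /matrixP/(_ i j).
  rewrite !mxE; case: (d 0 i j) => b0' b1 b2 b3 [] h0 h1 h2 h3.
  by congr Quat; lra.
have [->|y0] := eqVneq y 0.
  by rewrite normr0 b0 d0 !(mulmx0, mul0mx) addr0 !scaler0.
have dirE : qdir (x%:q + I * y%:q) = I * (y / `|y|)%:q.
  rewrite /qdir qnorm_qim // ifF; last first.
    apply/negbTE/eqP => e; have := qnorm_qim x y I1.
    rewrite e /qnorm /qnorm2 /= expr0n /= !addr0 sqrtr0 => /esym/eqP.
    by rewrite normr_eq0 (negbTE y0).
  by case: I I1 => ? ? ? ? [/= -> _]; congr Quat => /=; ring.
rewrite dirE; have [y_gt0|y_lt0|y_eq0] := ltrgt0P y.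
- by rewrite (divff y0) mulr1.
- have -> : y / - y = - 1 by rewrite invrN mulrN (divff y0).
  have [-> ->] := ab y; have [-> ->] := cd y.
  have -> : (-1)%:q = - 1 :> H.
    by rewrite -[RHS]/(qopp 1) /qopp /= oppr0.
  by rewrite mulrN1 mulmxN !mulNmx mulmxN opprK -opprD scalerN scaleNr opprK.
- by case/eqP: y0.
Qed.

End Slice.

(* Main.v *)
Require Import Defs.
From mathcomp Require Import all_boot all_order all_algebra.
From mathcomp Require Import all_classical all_reals all_analysis.
From HB Require Import structures.
From mathcomp Require Import ring lra.
From mathcomp.real_closed Require complex.
Import Order.TTheory GRing.Theory Num.Theory.
Set Implicit Arguments.
Unset Strict Implicit.
Unset Printing Implicit Defensive.
Local Open Scope classical_set_scope.
Local Open Scope ring_scope.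

(* Let P = H^-1. The matrix inequality says that
     q_P(z, e) = Re ((z A + e C) P z^* + (z B + e D) e^* ) >= 0
   for all quaternionic rows z, e. The kernel is determined by the Sylvester equation
   p K(p, r) + K(p, r) r^* = phi(p) + phi(r)^*, and phi(p) = D + Z_p B where
   p Z_p - Z_p A = C.

   If q_P >= 0, then X(p, r) = K(p, r) + Z_p P Z_r^* solves a Sylvester equation whose
   right-hand side is nonnegative, so X is a positive kernel (Lyapunov) and K has at
   most N negative squares.

   Conversely, finitely many negative squares force Re ((z B + e D) e^* ) >= 0 whenever
   a z - z A = e C with Re a = 0: otherwise many points near a, at distance epsilon
   from the imaginary axis, have a Gram matrix with a very negative diagonal and
   bounded other entries. Every positive matrix W^* W orthogonal to all
   (A; C) P (I, 0) + adjoint is a sum of rank one matrices w^* w with w = (z, e) of this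
   kind, so P exists by duality (a Farkas lemma), and it is nonsingular by
   controllability. *)

(** * Quaternionic matrices *)

(** Three obstacles shape the argument. Quaternionic scalars do not commute with matrices, so maps
    such as X -> aX - XA are linear over the reals only: determinants are replaced by real dimension
    counts, and genericity of a point is nonvanishing of one real polynomial, [den * chi] with [chi]
    annihilating [A], whose zero set is a union of spheres. The star product has no convenient
    pointwise algebra, so after [kernel_equation] the kernel is handled only through its Sylvester
    equation. Its solution is unique when both points have positive real part, and this uniqueness
    gives the symmetry and the compressions of the kernel; the norm estimate behind it gives
    continuity. Finally, [A] may have eigenvalues on the imaginary axis, and zeros of [den * chi]
    may be regular points. Rows (z, e) are therefore kept as solutions of a linear relation, without
    inverting a - A, and the count of negative squares is made at generic points and carried over by
    small real translations. The Farkas lemma needs no closed cone: the constraint values form a set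
    symmetric about 0. *)

(* What the proof uses of the quaternions: conjugation cj, real part re, embedding rq
   of the reals, real coordinates. With an abstract carrier, matrix products are not
   expanded into real components by unification. Below, cjmx, neg_squares, psd, ...
   repeat ctmx, has_negative_squares, positive_semidefinite, ... for this structure and
   become convertible to them at quat_alg. *)
Record qalg (R : realType) := QAlg {
  qcar :> unitRingType;
  cj : qcar -> qcar;
  re : qcar -> R;
  rq : R -> qcar;
  qcoord : qcar -> 'rV[R]_4;
  qdecoord : 'rV[R]_4 -> qcar;
  qunit : forall p : qcar, p != 0 -> p \is a GRing.unit;
  cjK : involutive cj;
  cjD : {morph cj : p q / p + q};
  cjM : forall p q, cj (p * q) = cj q * cj p;
  reD : {morph re : p q / p + q};
  reC : forall p q, re (p * q) = re (q * p);
  rqD : {morph rq : x y / x + y};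
  rqM : {morph rq : x y / x * y};
  rq1 : rq 1 = 1;
  re_rq : cancel rq re;
  rqC : forall x p, p * rq x = rq x * p;
  re_rqM : forall x p, re (rq x * p) = x * re p;
  addq_cj : forall p, p + cj p = rq (2 * re p);
  mulq_cj : forall p, p * cj p = rq (re (p * cj p));
  n2_gt0 : forall p, p != 0 -> 0 < re (p * cj p);
  qcoordD : {morph qcoord : p q / p + q};
  qcoordZ : forall x p, qcoord (rq x * p) = x *: qcoord p;
  qcoordK : cancel qcoord qdecoord;
  qdecoordK : cancel qdecoord qcoord;
  qcoord_le : forall p i, qcoord p 0 i ^+ 2 <= re (p * cj p);
  imag_polar : forall p, re p = 0 ->
    exists I x, [/\ re I = 0, I * I = - 1, 0 <= x & p = I * rq x] }.

Arguments cj {R} {_} _.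
Arguments re {R} {_} _.
Arguments rq {R} {_} _.
Arguments qcoord {R} {_} _.
Arguments qdecoord {R} {_} _.

Section QuatTheory.
Variables (R : realType) (H : qalg R).
Implicit Types (p q r : H) (x y : R).

Lemma re0 : re (0 : H) = 0.
Proof. by apply: (addrI (re (0 : H))); rewrite -reD !addr0. Qed.
Lemma reN p : re (- p) = - re p.
Proof. by apply: (addrI (re p)); rewrite -reD !subrr re0. Qed.
Lemma reB p q : re (p - q) = re p - re q.
Proof. by rewrite reD reN. Qed.
Lemma re_sum I (s : seq I) (P : pred I) (F : I -> H) :
  re (\sum_(i <- s | P i) F i) = \sum_(i <- s | P i) re (F i).
Proof. by rewrite (big_morph re (@reD _ _) re0). Qed.

Lemma rq0 : rq 0 = 0 :> H.
Proof. by apply: (addrI (rq 0 : H)); rewrite -rqD !addr0. Qed.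
Lemma rqN x : rq (- x) = - rq x :> H.
Proof. by apply: (addrI (rq x : H)); rewrite -rqD !subrr rq0. Qed.
Lemma rqB x y : rq (x - y) = rq x - rq y :> H.
Proof. by rewrite rqD rqN. Qed.
Lemma rq_sum I (s : seq I) (P : pred I) (F : I -> R) :
  rq (\sum_(i <- s | P i) F i) = \sum_(i <- s | P i) rq (F i) :> H.
Proof. by rewrite (big_morph rq (@rqD _ _) rq0). Qed.
Lemma rqX x n : rq (x ^+ n) = rq x ^+ n :> H.
Proof. by elim: n => [|n IH]; rewrite ?rq1 // !exprS rqM IH. Qed.
Lemma rq_inj : injective (rq : R -> H).
Proof. exact: can_inj (@re_rq _ _). Qed.
Lemma rq_eq0 x : (rq x == 0 :> H) = (x == 0).
Proof. by rewrite -(inj_eq rq_inj) rq0. Qed.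
Lemma qmulVq p : p != 0 -> p^-1 * p = 1.
Proof. by move=> p0; rewrite mulVr ?qunit. Qed.
Lemma qmulqV p : p != 0 -> p * p^-1 = 1.
Proof. by move=> p0; rewrite divrr ?qunit. Qed.
Lemma qmulf_eq0 p q : (p * q == 0) = (p == 0) || (q == 0).
Proof.
have [->|p0] := eqVneq p 0; first by rewrite mul0r eqxx.
by rewrite -[0 in LHS](mulr0 p) (inj_eq (mulrI (qunit p0))).
Qed.
Lemma re_conjg p q : p != 0 -> re (p^-1 * q * p) = re q.
Proof. by move=> p0; rewrite reC mulrA qmulqV // mul1r. Qed.

Lemma cj0 : cj 0 = 0 :> H.
Proof. by apply: (addrI (cj (0 : H))); rewrite -cjD !addr0. Qed.
Lemma cjN p : cj (- p) = - cj p.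
Proof. by apply: (addrI (cj p)); rewrite -cjD !subrr cj0. Qed.
Lemma cjE p : cj p = rq (2 * re p) - p.
Proof. by rewrite -addq_cj addrAC subrr add0r. Qed.
Lemma cj_rq x : cj (rq x) = rq x :> H.
Proof. by rewrite cjE re_rq -rqB; congr rq; ring. Qed.
Lemma cj1 : cj 1 = 1 :> H.
Proof. by rewrite -(rq1 H) cj_rq. Qed.
Lemma cj_sum I (s : seq I) (P : pred I) (F : I -> H) :
  cj (\sum_(i <- s | P i) F i) = \sum_(i <- s | P i) cj (F i).
Proof. by rewrite (big_morph cj (@cjD _ _) cj0). Qed.
Lemma re_cj p : re (cj p) = re p.
Proof. by rewrite cjE reB re_rq; ring. Qed.

Definition n2 p := re (p * cj p).
Definition nq p := Num.sqrt (n2 p).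

Lemma mulcj p : p * cj p = rq (n2 p). Proof. exact: mulq_cj. Qed.
Lemma cjmul p : cj p * p = rq (n2 p).
Proof. by rewrite -{2}(cjK p) mulcj /n2 cjK reC. Qed.
Lemma n2_ge0 p : 0 <= n2 p.
Proof.
have [->|/n2_gt0/ltW//] := eqVneq p 0.
by rewrite /n2 mul0r re0.
Qed.
Lemma n2_eq0 p : (n2 p == 0) = (p == 0).
Proof.
have [->|/n2_gt0] := eqVneq p 0; first by rewrite /n2 mul0r re0 eqxx.
by rewrite lt_def => /andP[/negbTE-> _].
Qed.
Lemma n2M p q : n2 (p * q) = n2 p * n2 q.
Proof. by rewrite {1}/n2 cjM mulrA -(mulrA p) mulcj rqC -mulrA re_rqM mulrC. Qed.
Lemma n2_cj p : n2 (cj p) = n2 p.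
Proof. by rewrite /n2 cjK reC. Qed.
Lemma n2_rq x : n2 (rq x : H) = x ^+ 2.
Proof. by rewrite /n2 cj_rq -rqM re_rq. Qed.
Lemma n2N p : n2 (- p) = n2 p.
Proof. by rewrite /n2 cjN mulrNN. Qed.

Lemma nq_ge0 p : 0 <= nq p. Proof. exact: sqrtr_ge0. Qed.
Lemma sqr_nq p : nq p ^+ 2 = n2 p.
Proof. by rewrite sqr_sqrtr ?n2_ge0. Qed.
Lemma nqM p q : nq (p * q) = nq p * nq q.
Proof. by rewrite /nq n2M sqrtrM ?n2_ge0. Qed.
Lemma nqN p : nq (- p) = nq p.
Proof. by rewrite /nq n2N. Qed.
Lemma nq_cj p : nq (cj p) = nq p.
Proof. by rewrite /nq n2_cj. Qed.
Lemma nq_rq x : nq (rq x : H) = `|x|.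
Proof. by rewrite /nq n2_rq sqrtr_sqr. Qed.
Lemma nq_eq0 p : (nq p == 0) = (p == 0).
Proof. by rewrite -sqrf_eq0 sqr_nq n2_eq0. Qed.
Lemma nq0 : nq 0 = 0.
Proof. by apply/eqP; rewrite nq_eq0. Qed.
Lemma nq_gt0 p : (0 < nq p) = (p != 0).
Proof. by rewrite lt_def nq_eq0 nq_ge0 andbT. Qed.

End QuatTheory.

Lemma mulmx_scalarE (T : pzRingType) m n (M : 'M[T]_(m, n)) b i j :
  (M *m b%:M) i j = M i j * b.
Proof.
rewrite mxE (bigD1 j) //= mxE eqxx mulr1n big1 ?addr0 // => k kj.
by rewrite mxE (negbTE kj) mulr0n mulr0.
Qed.

Section ConjugateTranspose.
Variables (R : realType) (H : qalg R).

Definition cjmx m n (M : 'M[H]_(m, n)) : 'M[H]_(n, m) := map_mx cj M^T.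

Lemma cjmxE m n (M : 'M[H]_(m, n)) i j : cjmx M i j = cj (M j i).
Proof. by rewrite !mxE. Qed.
Lemma cjmxK m n (M : 'M[H]_(m, n)) : cjmx (cjmx M) = M.
Proof. by apply/matrixP => i j; rewrite !cjmxE cjK. Qed.
Lemma cjmxD m n (M L : 'M[H]_(m, n)) : cjmx (M + L) = cjmx M + cjmx L.
Proof. by apply/matrixP => i j; rewrite !mxE cjD. Qed.
Lemma cjmxN m n (M : 'M[H]_(m, n)) : cjmx (- M) = - cjmx M.
Proof. by apply/matrixP => i j; rewrite !mxE cjN. Qed.
Lemma cjmxB m n (M L : 'M[H]_(m, n)) : cjmx (M - L) = cjmx M - cjmx L.
Proof. by rewrite cjmxD cjmxN. Qed.
Lemma cjmx0 m n : cjmx (0 : 'M[H]_(m, n)) = 0.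
Proof. by apply/matrixP => i j; rewrite !mxE cj0. Qed.
Lemma cjmx_scalar m (a : H) : cjmx (a%:M : 'M[H]_m) = (cj a)%:M.
Proof.
apply/matrixP => i j; rewrite !mxE eq_sym.
by case: eqP => _; rewrite ?mulr1n ?mulr0n ?cj0.
Qed.
Lemma cjmx1 m : cjmx (1%:M : 'M[H]_m) = 1%:M.
Proof. by rewrite cjmx_scalar cj1. Qed.
Lemma cjmxM m n l (M : 'M[H]_(m, n)) (L : 'M[H]_(n, l)) :
  cjmx (M *m L) = cjmx L *m cjmx M.
Proof.
apply/matrixP => i j; rewrite !mxE cj_sum; apply: eq_bigr => k _.
by rewrite !mxE cjM.
Qed.
Lemma cjmx_col_mx m n l (M : 'M[H]_(n, m)) (L : 'M[H]_(l, m)) :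
  cjmx (col_mx M L) = row_mx (cjmx M) (cjmx L).
Proof. by rewrite /cjmx tr_col_mx map_row_mx. Qed.
Lemma cjmx_block m n k l (M11 : 'M[H]_(m, k)) (M12 : 'M[H]_(m, l))
    (M21 : 'M[H]_(n, k)) M22 :
  cjmx (block_mx M11 M12 M21 M22) =
  block_mx (cjmx M11) (cjmx M21) (cjmx M12) (cjmx M22).
Proof. by rewrite /cjmx tr_block_mx map_block_mx. Qed.
Lemma cjmx_inj m n : injective (@cjmx m n).
Proof. exact: can_inj (@cjmxK m n). Qed.
Lemma cjmx_eq0 m n (M : 'M[H]_(m, n)) : (cjmx M == 0) = (M == 0).
Proof. by rewrite -(cjmx0 m n) (inj_eq (@cjmx_inj m n)). Qed.

Lemma scale_realC m n l (x : R) (M : 'M[H]_(m, n)) (L : 'M[H]_(n, l)) :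
  M *m (rq x *: L) = rq x *: (M *m L).
Proof.
apply/matrixP => i j; rewrite !mxE mulr_sumr; apply: eq_bigr => k _.
by rewrite !mxE !mulrA rqC.
Qed.
Lemma cjmxZ_real m n (x : R) (M : 'M[H]_(m, n)) :
  cjmx (rq x *: M) = rq x *: cjmx M.
Proof. by apply/matrixP => i j; rewrite !mxE cjM cj_rq rqC. Qed.
(** Conjugation turns a left scalar into a right one. Matrices carry only the left scaling, so right
    multiplication by a quaternion is written as a product with a scalar matrix. *)
Lemma cjmxZ m n (a : H) (M : 'M[H]_(m, n)) :
  cjmx (a *: M) = cjmx M *m (cj a)%:M.
Proof. by rewrite -mul_scalar_mx cjmxM cjmx_scalar. Qed.

Lemma mul_mx_real m n (x : R) (M : 'M[H]_(m, n)) : M *m (rq x)%:M = rq x *: M.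
Proof. by rewrite -[rq x in LHS]mulr1 -scale_scalar_mx scale_realC mulmx1. Qed.

Lemma cjmx_exp m (M : 'M[H]_m) k : cjmx (M ^+ k) = cjmx M ^+ k.
Proof.
elim: k => [|k IH]; first by rewrite !expr0 -[1]/(1%:M) cjmx1.
by rewrite exprS exprSr -!mulmxE cjmxM IH.
Qed.

End ConjugateTranspose.

Section RealTrace.
Variables (R : realType) (H : qalg R).

(** The quaternionic trace is not cyclic, but its real part is ([rtrC]). It gives the real inner
    product behind [sqn] and [mnorm]. *)
Definition rtr m (M : 'M[H]_m) : R := re (\tr M).
Definition sqn m n (M : 'M[H]_(m, n)) : R := rtr (M *m cjmx M).
Definition mnorm m n (M : 'M[H]_(m, n)) : R := Num.sqrt (sqn M).

Lemma rtrD m (M L : 'M[H]_m) : rtr (M + L) = rtr M + rtr L.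
Proof. by rewrite /rtr mxtraceD reD. Qed.
Lemma rtrN m (M : 'M[H]_m) : rtr (- M) = - rtr M.
Proof. by rewrite /rtr raddfN reN. Qed.
Lemma rtrB m (M L : 'M[H]_m) : rtr (M - L) = rtr M - rtr L.
Proof. by rewrite rtrD rtrN. Qed.
Lemma rtr0 m : rtr (0 : 'M[H]_m) = 0.
Proof. by rewrite /rtr raddf0 re0. Qed.
Lemma rtrZ m (x : R) (M : 'M[H]_m) : rtr (rq x *: M) = x * rtr M.
Proof. by rewrite /rtr mxtraceZ re_rqM. Qed.
Lemma rtrC m n (M : 'M[H]_(m, n)) (L : 'M[H]_(n, m)) :
  rtr (M *m L) = rtr (L *m M).
Proof.
rewrite /rtr /mxtrace !re_sum.
under eq_bigr do rewrite mxE re_sum.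
under [RHS]eq_bigr do rewrite mxE re_sum.
rewrite exchange_big; apply: eq_bigr => i _; apply: eq_bigr => j _.
exact: reC.
Qed.
Lemma rtr_cjmx m (M : 'M[H]_m) : rtr (cjmx M) = rtr M.
Proof.
rewrite /rtr /mxtrace !re_sum; apply: eq_bigr => i _.
by rewrite cjmxE re_cj.
Qed.
Lemma rtr11 (M : 'M[H]_1) : rtr M = re (M 0 0).
Proof. by rewrite /rtr trace_mx11. Qed.

Lemma sqnE m n (M : 'M[H]_(m, n)) : sqn M = \sum_i \sum_j n2 (M i j).
Proof.
rewrite /sqn /rtr /mxtrace re_sum; apply: eq_bigr => i _.
by rewrite mxE re_sum; apply: eq_bigr => j _; rewrite cjmxE.
Qed.
Lemma sqn_ge0 m n (M : 'M[H]_(m, n)) : 0 <= sqn M.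
Proof. by rewrite sqnE !sumr_ge0 // => i _; rewrite sumr_ge0 // => *; exact: n2_ge0. Qed.
Lemma sqn_eq0 m n (M : 'M[H]_(m, n)) : (sqn M == 0) = (M == 0).
Proof.
apply/idP/eqP => [|->]; last by rewrite /sqn mul0mx rtr0.
rewrite sqnE psumr_eq0 => [/allP M0|i _]; last first.
  by rewrite sumr_ge0 // => *; exact: n2_ge0.
apply/matrixP => i j; move/(_ i (mem_index_enum _)): M0.
rewrite psumr_eq0 => [/allP/(_ j (mem_index_enum _))|*]; last exact: n2_ge0.
by rewrite /= n2_eq0 mxE => /eqP.
Qed.
Lemma sqn_gt0 m n (M : 'M[H]_(m, n)) : (0 < sqn M) = (M != 0).
Proof. by rewrite lt_def sqn_eq0 sqn_ge0 andbT. Qed.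
Lemma sqn_cjmx m n (M : 'M[H]_(m, n)) : sqn (cjmx M) = sqn M.
Proof. by rewrite /sqn cjmxK rtrC. Qed.

Lemma mnorm_ge0 m n (M : 'M[H]_(m, n)) : 0 <= mnorm M.
Proof. exact: sqrtr_ge0. Qed.
Lemma sqr_mnorm m n (M : 'M[H]_(m, n)) : mnorm M ^+ 2 = sqn M.
Proof. by rewrite sqr_sqrtr ?sqn_ge0. Qed.
Lemma mnorm_eq0 m n (M : 'M[H]_(m, n)) : (mnorm M == 0) = (M == 0).
Proof. by rewrite -sqrf_eq0 sqr_mnorm sqn_eq0. Qed.
Lemma mnorm_gt0 m n (M : 'M[H]_(m, n)) : (0 < mnorm M) = (M != 0).
Proof. by rewrite lt_def mnorm_eq0 mnorm_ge0 andbT. Qed.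
Lemma mnorm0 m n : mnorm (0 : 'M[H]_(m, n)) = 0.
Proof. by apply/eqP; rewrite mnorm_eq0. Qed.
Lemma mnorm_cjmx m n (M : 'M[H]_(m, n)) : mnorm (cjmx M) = mnorm M.
Proof. by rewrite /mnorm sqn_cjmx. Qed.
Lemma mnormZ m n (a : H) (M : 'M[H]_(m, n)) :
  mnorm (a *: M) = nq a * mnorm M.
Proof.
rewrite /mnorm /nq -sqrtrM ?n2_ge0 // !sqnE mulr_sumr.
congr Num.sqrt; apply: eq_bigr => i _; rewrite mulr_sumr.
by apply: eq_bigr => j _; rewrite mxE n2M.
Qed.
Lemma mnormN m n (M : 'M[H]_(m, n)) : mnorm (- M) = mnorm M.
Proof. by rewrite /mnorm /sqn cjmxN mulNmx mulmxN opprK. Qed.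
Lemma mnorm11 (M : 'M[H]_1) : mnorm M = nq (M 0 0).
Proof. by rewrite /mnorm sqnE !big_ord1. Qed.

Lemma rtr_cjmxC m n (M L : 'M[H]_(m, n)) :
  rtr (M *m cjmx L) = rtr (L *m cjmx M).
Proof. by rewrite -rtr_cjmx cjmxM cjmxK. Qed.

Lemma CauchySchwarz_rtr m n (M L : 'M[H]_(m, n)) :
  rtr (M *m cjmx L) <= mnorm M * mnorm L.
Proof.
have [->|L0] := eqVneq L 0.
  by rewrite cjmx0 mulmx0 rtr0 mnorm0 mulr0.
have [->|M0] := eqVneq M 0.
  by rewrite mul0mx rtr0 mnorm0 mul0r.
set s := mnorm L; set t := mnorm M.
have := sqn_ge0 (rq s *: M - rq t *: L).
rewrite /sqn cjmxB !cjmxZ_real mulmxBl !mulmxBr !rtrB -!scalemxAl !scale_realC.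
rewrite !rtrZ (rtr_cjmxC L M) -!/(sqn _) -!sqr_mnorm -/s -/t.
set b := rtr _ => h.
have st : 0 < s * t by rewrite mulr_gt0 // mnorm_gt0.
have: 0 <= 2 * (s * t) * (t * s - b)
    by apply: le_trans h _; rewrite le_eqVlt; apply/orP; left; apply/eqP; ring.
have st2 : 0 < 2 * (s * t) by rewrite mulr_gt0.
by rewrite (pmulr_rge0 _ st2) subr_ge0.
Qed.

Lemma mnormD m n (M L : 'M[H]_(m, n)) : mnorm (M + L) <= mnorm M + mnorm L.
Proof.
rewrite -(ler_pXn2r (n := 2)) ?nnegrE ?addr_ge0 ?mnorm_ge0 //.
rewrite sqr_mnorm /sqn cjmxD mulmxDl !mulmxDr !rtrD (rtr_cjmxC L M).
rewrite -[rtr (M *m cjmx M)]/(sqn M) -[rtr (L *m cjmx L)]/(sqn L) -!sqr_mnorm.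
have := CauchySchwarz_rtr M L; set b := rtr _ => h.
rewrite sqrrD mulr2n; lra.
Qed.
Lemma mnormB m n (M L : 'M[H]_(m, n)) : mnorm (M - L) <= mnorm M + mnorm L.
Proof. by rewrite -[leRHS](_ : mnorm M + mnorm (- L) = _) ?mnormD ?mnormN. Qed.
Lemma mnorm_triB m n (M L : 'M[H]_(m, n)) : mnorm M - mnorm L <= mnorm (M - L).
Proof. by rewrite lerBlDr; apply: le_trans (mnormD _ _); rewrite subrK. Qed.

Lemma abs_rtr m n (M : 'M[H]_(m, n)) (L : 'M[H]_(n, m)) :
  `|rtr (M *m L)| <= mnorm M * mnorm L.
Proof.
have h (K : 'M[H]_(m, n)) : rtr (K *m L) <= mnorm K * mnorm L.
  by rewrite -{1}(cjmxK L) -(mnorm_cjmx L) CauchySchwarz_rtr.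
by rewrite ler_norml h andbT lerNl -rtrN -mulNmx -(mnormN M) h.
Qed.

Lemma mnormM_row n (v : 'rV[H]_n) (w : 'cV[H]_n) :
  nq ((v *m w) 0 0) <= mnorm v * mnorm w.
Proof.
set q := (v *m w) 0 0; have [->|q0] := eqVneq q 0.
  by rewrite nq0 mulr_ge0 ?mnorm_ge0.
rewrite -(ler_pM2l (x := nq q)) ?nq_gt0 //.
(* Scaling v by cj q turns the value q into the real number n2 q, so a bound on real parts controls
   the modulus. *)
have := abs_rtr (cj q *: v) w; rewrite mnormZ nq_cj -scalemxAl rtr11 mxE.
rewrite -/q cjmul re_rq ger0_norm ?n2_ge0 // -sqr_nq expr2.
by rewrite mulrA.
Qed.

Lemma sqn_rows m n (M : 'M[H]_(m, n)) : sqn M = \sum_i sqn (row i M).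
Proof.
rewrite sqnE; apply: eq_bigr => i _; rewrite sqnE big_ord1.
by apply: eq_bigr => j _; rewrite mxE.
Qed.
Lemma sqn_cols m n (M : 'M[H]_(m, n)) : sqn M = \sum_i sqn (col i M).
Proof.
rewrite sqnE exchange_big; apply: eq_bigr => i _; rewrite sqnE.
by apply: eq_bigr => j _; rewrite big_ord1 mxE.
Qed.

Lemma mnormM m n l (M : 'M[H]_(m, n)) (L : 'M[H]_(n, l)) :
  mnorm (M *m L) <= mnorm M * mnorm L.
Proof.
rewrite -(ler_pXn2r (n := 2)) ?nnegrE ?mulr_ge0 ?mnorm_ge0 //.
rewrite exprMn !sqr_mnorm (sqn_rows M) (sqn_cols L) mulr_suml sqnE.
apply: ler_sum => i _; rewrite mulr_sumr; apply: ler_sum => j _.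
rewrite -sqr_nq -!sqr_mnorm -exprMn.
rewrite ler_pXn2r ?nnegrE ?nq_ge0 ?mulr_ge0 ?mnorm_ge0 //.
apply: le_trans (mnormM_row _ _); rewrite le_eqVlt; apply/orP; left; apply/eqP.
by congr nq; rewrite !mxE; apply: eq_bigr => k _; rewrite !mxE.
Qed.

Lemma nqD (p q : H) : nq (p + q) <= nq p + nq q.
Proof.
have := mnormD (p%:M : 'M[H]_1) q%:M.
by rewrite !mnorm11 !mxE eqxx !mulr1n.
Qed.
Lemma nqB (p q : H) : nq (p - q) <= nq p + nq q.
Proof. by rewrite -(nqN q) nqD. Qed.

Lemma mnorm_entry m n (M : 'M[H]_(m, n)) i j : nq (M i j) <= mnorm M.
Proof.
rewrite ler_sqrt ?sqn_ge0 // sqnE (bigD1 i) //= (bigD1 j) //= -addrA lerDl.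
by rewrite addr_ge0 ?sumr_ge0 // => *; rewrite ?sumr_ge0 // => *; exact: n2_ge0.
Qed.

End RealTrace.

(** * Real dimension counts *)

Section RealDimension.
Variables (R : realType) (H : qalg R).

Definition mxcoord m n (M : 'M[H]_(m, n)) : 'rV[R]_(m * n * 4) :=
  mxvec (\matrix_(i < m * n, j < 4) qcoord (mxvec M 0 i) 0 j).
Definition mxdecoord m n (v : 'rV[R]_(m * n * 4)) : 'M[H]_(m, n) :=
  vec_mx (\row_i qdecoord (row i (vec_mx v))).

Arguments mxdecoord : clear implicits.

Lemma mxcoordK m n : cancel (@mxcoord m n) (mxdecoord m n).
Proof.
move=> M; rewrite /mxdecoord /mxcoord mxvecK -[RHS]mxvecK; congr vec_mx.
apply/rowP => i; rewrite mxE -[RHS]qcoordK; congr qdecoord.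
by apply/rowP => j; rewrite !mxE.
Qed.
Lemma mxdecoordK m n : cancel (mxdecoord m n) (@mxcoord m n).
Proof.
move=> v; rewrite /mxdecoord /mxcoord vec_mxK -[RHS]vec_mxK; congr mxvec.
by apply/matrixP => i j; rewrite !mxE qdecoordK !mxE.
Qed.
Lemma mxcoord_lin m n x (M L : 'M[H]_(m, n)) :
  mxcoord (rq x *: M + L) = x *: mxcoord M + mxcoord L.
Proof.
rewrite /mxcoord -linearP /=; congr mxvec; apply/matrixP => i j.
by case/mxvec_indexP: i => k l; rewrite !mxE !mxvecE !mxE qcoordD qcoordZ !mxE.
Qed.
Lemma mxdecoord_lin m n x (v w : 'rV[R]_(m * n * 4)) :
  mxdecoord m n (x *: v + w) = rq x *: mxdecoord m n v + mxdecoord m n w.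
Proof. by apply: (can_inj (@mxcoordK m n)); rewrite mxcoord_lin !mxdecoordK. Qed.
Lemma mxcoord0 m n : mxcoord (0 : 'M[H]_(m, n)) = 0.
Proof. by have := mxcoord_lin (-1) (0 : 'M[H]_(m, n)) 0; rewrite scaler0 addr0 scaleN1r addNr. Qed.
Lemma mxdecoord0 m n : mxdecoord m n 0 = 0.
Proof. by rewrite -mxcoord0 mxcoordK. Qed.
Lemma mxcoord_le m n (M : 'M[H]_(m, n)) i : `|mxcoord M 0 i| <= mnorm M.
Proof.
rewrite -sqrtr_sqr; apply: ler_wsqrtr.
case/mxvec_indexP: i => i j; rewrite mxvecE mxE.
case/mxvec_indexP: i => i k; rewrite mxvecE.
apply: le_trans (qcoord_le _ _) _; rewrite -/(n2 _) -sqr_nq -sqr_mnorm.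
by rewrite ler_pXn2r ?nnegrE ?nq_ge0 ?mnorm_ge0 ?mnorm_entry.
Qed.

(** Only real scalars are required to pass through: X -> aX - XA is in general linear over the
    quaternions on neither side. *)
Definition real_linear m n k l (f : 'M[H]_(m, n) -> 'M[H]_(k, l)) :=
  forall x X Y, f (rq x *: X + Y) = rq x *: f X + f Y.

Section Matrix.
Variables (m n k l : nat) (f : 'M[H]_(m, n) -> 'M[H]_(k, l)).
Hypothesis fl : real_linear f.

Definition real_mx : 'M[R]_(m * n * 4, k * l * 4) :=
  lin1_mx (fun v => mxcoord (f (mxdecoord m n v))).

Lemma real_mxE X : mxcoord (f X) = mxcoord X *m real_mx.
Proof.
pose g v := mxcoord (f (mxdecoord m n v)).
have gl : linear g by move=> x v w; rewrite /g mxdecoord_lin fl mxcoord_lin.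
pose gL := HB.pack_for {linear 'rV[R]_(m * n * 4) -> 'rV[R]_(k * l * 4)} g
  (GRing.isLinear.Build _ _ _ _ g gl).
by rewrite (mul_rV_lin1 gL) /= /g mxcoordK.
Qed.

Lemma real_kernel : (k * l < m * n)%N -> exists2 X, X != 0 & f X = 0.
Proof.
move=> lt; have : kermx real_mx != 0.
  rewrite -mxrank_eq0 mxrank_ker subn_eq0 -ltnNge.
  by apply: leq_ltn_trans (rank_leq_col _) _; rewrite ltn_pmul2r.
case/rowV0Pn => v /sub_kermxP vM v0; exists (mxdecoord m n v).
  by apply: contraNneq v0 => e; rewrite -(mxdecoordK v) e mxcoord0.
by apply: (can_inj (@mxcoordK k l)); rewrite real_mxE mxdecoordK vM mxcoord0.
Qed.

Hypothesis f_inj : forall X, f X = 0 -> X = 0.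

Lemma real_mx_free : row_free real_mx.
Proof.
apply: inj_row_free => v vM; rewrite -(mxdecoordK v).
rewrite (f_inj (_ : f (mxdecoord m n v) = 0)) ?mxcoord0 //.
by apply: (can_inj (@mxcoordK k l)); rewrite real_mxE mxdecoordK vM mxcoord0.
Qed.

Lemma real_surj : (m * n = k * l)%N -> forall Y, exists X, f X = Y.
Proof.
move=> e Y; have fM := real_mx_free.
have : row_full real_mx by rewrite /row_full (eqP fM) e.
move/(submx_full (mxcoord Y))/submxP => [v vE].
exists (mxdecoord m n v); apply: (can_inj (@mxcoordK k l)).
by rewrite real_mxE mxdecoordK -vE.
Qed.

Lemma real_bounded_below :
  exists2 c, 0 < c & forall X, c * mnorm X <= mnorm (f X).
Proof.
pose G := pinvmx real_mx; pose b i := mxdecoord m n (delta_mx 0 i).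
(* [C] bounds the map that inverts f on its image, column by column of [G]. The constant sought is
   the inverse of [C + 1], since [C] is 0 when the source has dimension 0. *)
pose C := \sum_i (\sum_j `|G j i|) * mnorm (b i).
have C0 : 0 <= C by rewrite sumr_ge0 // => i _; rewrite mulr_ge0 ?mnorm_ge0 ?sumr_ge0.
have C1 : 0 < C + 1 by rewrite ltr_wpDl.
exists (C + 1)^-1; first by rewrite invr_gt0.
move=> X; rewrite ler_pdivrMl //.
suff : mnorm X <= C * mnorm (f X).
  by move/le_trans; apply; rewrite ler_wpM2r ?mnorm_ge0 // lerDl.
have XE : X = mxdecoord m n (mxcoord (f X) *m G).
  by rewrite real_mxE -mulmxA mulmxVp ?real_mx_free // mulmx1 mxcoordK.
have dE v : mxdecoord m n v = \sum_i rq (v 0 i) *: b i.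
  rewrite {1}(row_sum_delta v).
  elim/big_rec2: _ => [|i w u _ <-]; first by rewrite mxdecoord0.
  by rewrite mxdecoord_lin.
rewrite [X in mnorm X <= _]XE dE /C mulr_suml.
apply: le_trans (_ : \sum_i mnorm (rq ((mxcoord (f X) *m G) 0 i) *: b i) <= _).
  elim/big_rec2: _ => [|i w u _ h]; first by rewrite mnorm0.
  by apply: le_trans (mnormD _ _) _; rewrite lerD2l.
apply: ler_sum => i _; rewrite mnormZ nq_rq mulrAC ler_wpM2r ?mnorm_ge0 //.
rewrite mxE mulr_suml; apply: le_trans (ler_norm_sum _ _ _) _.
apply: ler_sum => j _; rewrite normrM mulrC ler_wpM2l //.
exact: mxcoord_le.
Qed.

End Matrix.

Lemma mulmxr_real_linear m n k (L : 'M[H]_(n, k)) :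
  real_linear (fun X : 'M[H]_(m, n) => X *m L).
Proof. by move=> x X Y; rewrite mulmxDl scalemxAl. Qed.
Lemma mulmxl_real_linear m n k (L : 'M[H]_(k, m)) :
  real_linear (fun X : 'M[H]_(m, n) => L *m X).
Proof. by move=> x X Y; rewrite mulmxDr scale_realC. Qed.

Lemma ker_row m n (M : 'M[H]_(m, n)) : (n < m)%N ->
  exists2 v : 'rV[H]_m, v != 0 & v *m M = 0.
Proof. by move=> lt; apply: real_kernel (@mulmxr_real_linear 1 _ _ M) _; rewrite !mul1n. Qed.

(** The Hermitian square G of M is injective, hence onto by dimension, hence has a right inverse X;
    as G is Hermitian, the adjoint of X is a left inverse of G. *)
Lemma mx_left_inverse m n (M : 'M[H]_(m, n)) :
  (forall v : 'cV[H]_n, M *m v = 0 -> v = 0) -> exists L, L *m M = 1%:M.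
Proof.
move=> M_inj; pose G := cjmx M *m M.
have G_inj (v : 'cV[H]_n) : G *m v = 0 -> v = 0.
  move=> Gv; apply: M_inj; apply/eqP; rewrite -sqn_eq0 /sqn rtrC cjmxM -mulmxA.
  by rewrite (mulmxA (cjmx M)) Gv mulmx0 rtr0.
have Ginj (X : 'M[H]_n) : G *m X = 0 -> X = 0.
  move=> GX; apply/matrixP => i j; have := G_inj (col j X).
  by rewrite colE mulmxA GX mul0mx -colE => /(_ erefl) /matrixP/(_ i 0); rewrite !mxE.
have [X XE] := real_surj (@mulmxl_real_linear n n n G) Ginj erefl 1%:M.
have XhG : cjmx X *m G = 1%:M.
  by rewrite -[G]cjmxK cjmxM cjmxK -cjmxM XE cjmx1.
by exists (cjmx X *m cjmx M); rewrite -mulmxA.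
Qed.

Lemma mx_right_inverse m n (M : 'M[H]_(m, n)) :
  (forall v : 'rV[H]_m, v *m M = 0 -> v = 0) -> exists L, M *m L = 1%:M.
Proof.
move=> M_inj; have [v Mv|L LM] := @mx_left_inverse _ _ (cjmx M).
  by apply/eqP; rewrite -cjmx_eq0 (M_inj (cjmx v)) // -[M]cjmxK -cjmxM Mv cjmx0.
by exists (cjmx L); rewrite -(cjmxK M) -cjmxM LM cjmx1.
Qed.

Lemma sq_left_right n (M L : 'M[H]_n) : L *m M = 1%:M -> M *m L = 1%:M.
Proof.
move=> LM; have [X MX|X MX] := real_surj (@mulmxl_real_linear n n n M) _ erefl 1%:M.
  by rewrite -[X]mul1mx -LM -mulmxA MX mulmx0.
by rewrite -[L]mulmx1 -MX (mulmxA L) LM mul1mx.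
Qed.

End RealDimension.

Arguments mxdecoord {R H} m n v.

(** * Left eigenvectors of quaternionic matrices *)

Section Eigenvector.
Import complex.
Variables (R : realType) (H : qalg R).

Lemma real_dependent d m n (F : 'I_d -> 'M[H]_(m, n)) : (m * n * 4 < d)%N ->
  exists2 v : 'rV[R]_d, v != 0 & \sum_k rq (v 0 k) *: F k = 0.
Proof.
move=> lt; pose M := \matrix_k mxcoord (F k).
have : kermx M != 0.
  rewrite -mxrank_eq0 mxrank_ker subn_eq0 -ltnNge.
  exact: leq_ltn_trans (rank_leq_col _) lt.
case/rowV0Pn => v /sub_kermxP vM v0; exists v => //.
have <- : mxdecoord m n (v *m M) = \sum_k rq (v 0 k) *: F k.
  rewrite mulmx_sum_row.
  elim/big_rec2: _ => [|i w u _ <-]; first by rewrite mxdecoord0.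
  by rewrite mxdecoord_lin rowK mxcoordK.
by rewrite vM mxdecoord0.
Qed.

Definition hornermx (p : {poly R}) N (A : 'M[H]_N) : 'M[H]_N :=
  \sum_(k < size p) rq p`_k *: A ^+ k.

(** Substitute for the characteristic polynomial, from a real dependence among 4N^2 + 1 powers of A.
    Real coefficients matter because they are central. *)
Lemma annihilating_poly N (A : 'M[H]_N) :
  exists2 p : {poly R}, p != 0 & hornermx p A = 0.
Proof.
have [v v0 vA] := real_dependent (fun k : 'I_(N * N * 4).+1 => A ^+ k) (ltnSn _).
exists (rVpoly v).
  by apply: contraNneq v0 => e; rewrite -(rVpolyK v) e linear0.
rewrite -[RHS]vA /hornermx.
rewrite (big_ord_widen _ (fun k => rq (rVpoly v)`_k *: A ^+ k) (size_poly _ _)).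
rewrite big_mkcond; apply: eq_bigr => k _.
rewrite coef_rVpoly_ord; case: ltnP => // /(nth_default 0) e.
by rewrite -coef_rVpoly_ord e rq0 scale0r.
Qed.

Section Embedding.
Variable I : H.
Hypothesis I2 : I * I = -1.

(** The embedding of the complex numbers sending i to I. Through it rows form a left complex vector
    space on which [S], acting on the right, is complex linear. *)
Definition hC (z : complex.complex R) : H := rq (complex.Re z) + I * rq (complex.Im z).

Lemma hCD (z w : complex.complex R) : hC (z + w) = hC z + hC w.
Proof.
by case: z w => a b [c d]; rewrite /hC /= !rqD mulrDr addrACA.
Qed.
Lemma hCM (z w : complex.complex R) : hC (z * w) = hC z * hC w.
Proof.
case: z w => a b [c d]; rewrite /hC /= rqB !rqD !rqM mulrDl !mulrDr.
rewrite -(mulrA I (rq b) (I * _)) (mulrA (rq b)) -(rqC b I) !mulrA I2 !mulN1r.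
rewrite -(rqC a I) -!mulrA -(rqC b (rq c)) -!addrA; congr (_ + _).
by rewrite addrC -!addrA; congr (_ + _); rewrite mulNr addrC.
Qed.
Lemma hC_real x : hC (complex.real_complex R x) = rq x.
Proof. by rewrite /hC /= rq0 mulr0 addr0. Qed.
Lemma hC_eq0 (z : complex.complex R) : hC z = 0 -> z = 0.
Proof.
have [//|z0 hz] := eqVneq z 0.
have := hCM z z^-1; rewrite hz mul0r mulfV // (hC_real 1) rq1.
by move/eqP; rewrite oner_eq0.
Qed.
Lemma hC0 : hC 0 = 0.
Proof. by rewrite (hC_real 0) rq0. Qed.
Lemma hCN (z : complex.complex R) : hC (- z) = - hC z.
Proof. by apply: (addrI (hC z)); rewrite -hCD !subrr hC0. Qed.

Lemma complex_eigenvector m (S : 'M[H]_m) n (p : {poly complex.complex R}) (c : 'rV[H]_m) :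
  (size p <= n)%N -> p != 0 -> c != 0 ->
  \sum_(k < n) hC p`_k *: (c *m S ^+ k) = 0 ->
  exists (c' : 'rV[H]_m) z, c' != 0 /\ c' *m S = hC z *: c'.
Proof.
elim: n p c => [|n IH] p c sp p0 c0.
  by move: sp; rewrite leqn0 size_poly_eq0 (negbTE p0).
have [s1|s1] := boolP (size p == 1).
  have /size_poly1P[a a0 ->] : size p == 1 := s1.
  rewrite big_ord_recl big1 => [|i _]; last by rewrite coefC /= hC0 scale0r.
  rewrite coefC eqxx addr0 expr0 -[1]/(1%:M) mulmx1 => /matrixP ac.
  case/eqP: c0; apply/matrixP => i j; have := ac i j; rewrite !mxE => /eqP.
  by rewrite qmulf_eq0 => /orP[/eqP/hC_eq0/eqP|/eqP//]; rewrite (negbTE a0).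
have /closed_rootP[z /factor_theorem[q pE]] := s1.
have q0 : q != 0 by apply: contraNneq p0 => q0; rewrite pE q0 mul0r.
have sq : (size q <= n)%N.
  by move: sp; rewrite pE size_Mmonic ?monicXsubC // size_XsubC addn2.
(* With p = q (X - z), either c is already an eigenvector for z, or cS - zc is nonzero and
   annihilated by q. Coefficients act on the left and S on the right, so factoring is legitimate. *)
have [cz|cz] := eqVneq (c *m S) (hC z *: c); first by exists c, z.
have d0 : c *m S - hC z *: c != 0 by rewrite subr_eq0.
move=> pc; apply: (IH q _ sq q0 d0); rewrite -[RHS]pc.
have coefp k : p`_k = (if k == 0 then 0 else q`_k.-1) - q`_k * z.
  by rewrite pE mulrBr coefB coefMX coefMC.
under [RHS]eq_bigr do rewrite coefp hCD hCN scalerDl scaleNr.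
rewrite sumrB big_ord_recl /= hC0 scale0r add0r.
rewrite [X in _ = _ - X]big_ord_recr /= (nth_default 0 sq) mul0r hC0 scale0r addr0.
rewrite -sumrB; apply: eq_bigr => k _; rewrite mulmxBl scalerBr; congr (_ - _).
  by rewrite exprS -mulmxE mulmxA.
by rewrite -scalemxAl scalerA -!hCM.
Qed.

End Embedding.

Lemma exists_imag : exists I : H, I * I = -1.
Proof. by have [I [x [_ I2 _ _]]] := imag_polar (re0 H); exists I. Qed.

(** The 4m + 1 rows c S^k are dependent over the reals; the resulting real polynomial splits over
    the complex numbers, where [complex_eigenvector] applies. *)
Lemma left_eigenvector m (S : 'M[H]_m) : (0 < m)%N ->
  exists (c : 'rV[H]_m) (a : H), c != 0 /\ c *m S = a *: c.
Proof.
case: m S => // m S _; have [I I2] := exists_imag.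
pose c : 'rV[H]_m.+1 := delta_mx 0 0.
have c0 : c != 0.
  by apply/eqP => /matrixP/(_ 0 0); rewrite !mxE /= => /eqP; rewrite oner_eq0.
have [v v0 vS] := real_dependent (fun k : 'I_(1 * m.+1 * 4).+1 => c *m S ^+ k) (ltnSn _).
pose p := map_poly (complex.real_complex R) (rVpoly v).
have [|||c' [z [c'0 cS]]] := complex_eigenvector I2 (S := S) (p := p) _ _ c0 (n := (1 * m.+1 * 4).+1).
- by rewrite size_map_poly size_poly.
- rewrite map_poly_eq0.
  by apply: contraNneq v0 => e; rewrite -(rVpolyK v) e linear0.
- rewrite -[RHS]vS; apply: eq_bigr => k _.
  by rewrite coef_map hC_real coef_rVpoly_ord.
by exists c', (hC I z).
Qed.

End Eigenvector.

(** * Spectral theory *)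

Section Spectral.
Variables (R : realType) (H : qalg R).

Lemma mul_row_cjmx m (c : 'rV[H]_m) : c *m cjmx c = (rq (sqn c))%:M.
Proof.
apply/matrixP => i j; rewrite !ord1 [RHS]mxE eqxx mulr1n /sqn rtr11 [LHS]mxE [in RHS]mxE.
by rewrite re_sum rq_sum; apply: eq_bigr => k _; rewrite cjmxE; exact: mulcj.
Qed.

Lemma normalize_row m (c : 'rV[H]_m) : c != 0 ->
  exists2 t : R, t != 0 & (rq t *: c) *m cjmx (rq t *: c) = 1%:M.
Proof.
move=> c0; have n0 : mnorm c != 0 by rewrite mnorm_eq0.
exists (mnorm c)^-1; first by rewrite invr_eq0.
rewrite cjmxZ_real -scalemxAl scale_realC mul_row_cjmx -sqr_mnorm.
by rewrite !scale_scalar_mx -!rqM mulrA -expr2 -exprMn mulVf // expr1n rq1.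
Qed.

Lemma orthonormal_completion m (c : 'rV[H]_m.+1) : c *m cjmx c = 1%:M ->
  exists Q : 'M[H]_(m, m.+1),
    [/\ Q *m cjmx Q = 1%:M, c *m cjmx Q = 0 & cjmx c *m c + cjmx Q *m Q = 1%:M].
Proof.
move=> c1.
have [Q [Q1 cQ]] : exists Q : 'M[H]_(m, m.+1), Q *m cjmx Q = 1%:M /\ c *m cjmx Q = 0.
  suff : forall k, (k <= m)%N -> exists Q : 'M[H]_(k, m.+1),
      Q *m cjmx Q = 1%:M /\ c *m cjmx Q = 0 by move/(_ m (leqnn m)).
  elim=> [|k IH] km; first by exists 0; rewrite !flatmx0 thinmx0.
  have [Q [Q1 cQ]] := IH (ltnW km).
  (* Orthogonality to the k + 1 rows already chosen leaves a nonzero solution because k + 1 < m +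
     1. *)
  have [v v0 vU] := ker_row (cjmx (col_mx c Q)) (km : 1 + k < m.+1)%N.
  have [vc vQ] : v *m cjmx c = 0 /\ v *m cjmx Q = 0.
    by apply: eq_row_mx; rewrite -mul_mx_row -cjmx_col_mx vU row_mx0.
  have [t t0 w1] := normalize_row v0; set w := rq t *: v in w1.
  have wc : w *m cjmx c = 0 by rewrite -scalemxAl vc scaler0.
  have wQ : w *m cjmx Q = 0 by rewrite -scalemxAl vQ scaler0.
  pose W : 'M[H]_(1 + k, m.+1) := col_mx w Q.
  suff hW : W *m cjmx W = 1%:M /\ c *m cjmx W = 0 by exists W.
  rewrite /W cjmx_col_mx mul_col_row mul_mx_row cQ.
  rewrite -[c *m _]cjmxK cjmxM cjmxK wc cjmx0 row_mx0 w1 wQ Q1.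
  rewrite -[Q *m _]cjmxK cjmxM cjmxK wQ cjmx0; split=> //.
  by rewrite -scalar_mx_block.
exists Q; split=> //.
have UU : (col_mx c Q : 'M[H]_(1 + m)) *m cjmx (col_mx c Q : 'M[H]_(1 + m)) = 1%:M.
  rewrite cjmx_col_mx mul_col_row c1 cQ Q1.
  by rewrite -[Q *m _]cjmxK cjmxM cjmxK cQ cjmx0 -scalar_mx_block.
by have := sq_left_right UU; rewrite cjmx_col_mx mul_row_col.
Qed.

Theorem hermitian_spectral m (G : 'M[H]_m) : cjmx G = G ->
  exists (U : 'M[H]_m) (l : 'rV[R]_m),
    [/\ U *m cjmx U = 1%:M, cjmx U *m U = 1%:M &
        U *m G = diag_mx (map_mx rq l) *m U].
Proof.
elim: m G => [|m IH] G Gh.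
  by exists 1%:M, 0; split; rewrite [LHS]flatmx0 [RHS]flatmx0.
have [c0 [a [c0n0 c0G]]] := left_eigenvector G (ltn0Sn m).
have [t t0 c1] := normalize_row c0n0; set c := rq t *: c0 in c1.
have cG : c *m G = a *: c.
  by rewrite -scalemxAl c0G /c !scalerA rqC.
have aE : a%:M = c *m G *m cjmx c :> 'M[H]_1.
  by rewrite cG -scalemxAl c1 scalemx1.
(* The eigenvalue is the value of the Hermitian form at a unit row, hence equal to its conjugate,
   hence real. *)
have ar : a = rq (re a).
  have : cj a = a.
    have := congr1 (@cjmx _ _ _ _) aE; rewrite !cjmxM cjmxK Gh mulmxA -aE.
    by rewrite cjmx_scalar => /matrixP/(_ 0 0); rewrite !mxE eqxx !mulr1n.
  move=> ca; apply: (mulrI (qunit (_ : rq 2 != 0))); first by rewrite rq_eq0 pnatr_eq0.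
  by rewrite -rqM -addq_cj ca rqD rq1 mulrDl mul1r.
have [Q [Q1 cQ cQ1]] := orthonormal_completion c1.
have Qc : Q *m cjmx c = 0 by rewrite -[Q]cjmxK -cjmxM cQ cjmx0.
have [|U [l [U1 U2 UG]]] := IH (Q *m G *m cjmx Q).
  by rewrite !cjmxM cjmxK Gh mulmxA.
(* G preserves the orthogonal complement of c: the component of QG along c is Q times G c^*, a right
   multiple of Q c^* = 0. *)
have QG : Q *m G = Q *m G *m cjmx Q *m Q.
  rewrite -[LHS]mulmx1 -cQ1 mulmxDr -!mulmxA [X in X + _](_ : _ = 0) ?add0r //.
  rewrite (mulmxA G) -[G *m _]cjmxK cjmxM cjmxK Gh cG cjmxZ mulmxA.
  by rewrite -!mulmxA (mulmxA Q) Qc mul0mx.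
pose V : 'M[H]_(1 + m) := col_mx c (U *m Q).
have V1 : V *m cjmx V = 1%:M.
  rewrite /V cjmx_col_mx mul_col_row c1 cjmxM mulmxA cQ mul0mx.
  by rewrite -!mulmxA Qc mulmx0 (mulmxA Q) Q1 mul1mx U1 -scalar_mx_block.
pose L : 'rV[R]_(1 + m) := row_mx (re a)%:M l.
suff VG : V *m (G : 'M[H]_(1 + m)) = diag_mx (map_mx rq L) *m V.
  by exists V, L; split=> //; exact: sq_left_right V1.
rewrite /L map_row_mx diag_mx_row /V mul_block_col !mul0mx addr0 add0r.
rewrite mul_col_mx cG -(mulmxA U) QG (mulmxA U) UG -(mulmxA _ U); congr col_mx.
rewrite -mul_scalar_mx; congr (_ *m _); apply/matrixP => i j.
by rewrite !ord1 !mxE eqxx !mulr1n.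
Qed.

Lemma rtr_diag m (w : 'rV[H]_m) (p : 'rV[H]_m) :
  rtr (w *m diag_mx p *m cjmx w) = \sum_i n2 (w 0 i) * re (p 0 i).
Proof.
rewrite rtr11 mxE re_sum; apply: eq_bigr => i _.
by rewrite cjmxE mul_mx_diag mxE reC mulrA cjmul re_rqM.
Qed.

Lemma rtr_spectral m (G U : 'M[H]_m) (l : 'rV[R]_m) (c : 'rV[H]_m) :
  cjmx U *m U = 1%:M -> U *m G = diag_mx (map_mx rq l) *m U ->
  rtr (c *m G *m cjmx c) = \sum_i n2 ((c *m cjmx U) 0 i) * l 0 i.
Proof.
move=> U1 UG.
have -> : c *m G *m cjmx c =
    (c *m cjmx U) *m diag_mx (map_mx rq l) *m cjmx (c *m cjmx U).
  by rewrite cjmxM cjmxK -!mulmxA (mulmxA _ U) -UG !mulmxA -(mulmxA c (cjmx U) U) U1 mulmx1.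
by rewrite rtr_diag; apply: eq_bigr => i _; rewrite [map_mx _ _ 0 i]mxE re_rq.
Qed.

Definition right_injective m k (X : 'M[H]_(m, k)) : Prop :=
  forall c : 'cV[H]_k, X *m c = 0 -> c = 0.

Definition neg_ge m (G : 'M[H]_m) (k : nat) : Prop :=
  exists (X : 'M[H]_(m, k)) (lambda : 'rV[R]_k),
    [/\ right_injective X, forall i, lambda 0 i < 0 &
        G *m X = X *m diag_mx (map_mx rq lambda)].

Definition neg_le m (G : 'M[H]_m) (k : nat) : Prop :=
  forall k', neg_ge G k' -> (k' <= k)%N.

(** If fewer than r eigenvalues were negative, some nonzero c would make cY orthogonal to all their
    eigenrows, and the form would be nonnegative at cY. *)
Lemma neg_count_lower m r (G : 'M[H]_m) (Y : 'M[H]_(r, m)) :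
  cjmx G = G ->
  (forall c : 'rV[H]_r, c != 0 -> rtr (c *m (Y *m G *m cjmx Y) *m cjmx c) < 0) ->
  exists2 k, (r <= k)%N & neg_ge G k.
Proof.
move=> Gh Gneg; have [U [l [U1 U2 UG]]] := hermitian_spectral Gh.
pose S := [set i | l 0 i < 0]%SET.
pose f (i : 'I_#|S|) := enum_val i.
(* [E] selects the coordinates of the negative eigenvalues, so the columns of [cjmx U *m E] are
   their eigenvectors. *)
pose E : 'M[H]_(m, #|S|) := \matrix_(i, j) (i == f j)%:R.
exists #|S|; last first.
  exists (cjmx U *m E), (\row_j l 0 (f j)); split.
  - move=> c Xc; have Ec : E *m c = 0.
      by rewrite -[E]mul1mx -U1 -!mulmxA (mulmxA (cjmx U)) Xc mulmx0.
    apply/matrixP => i j; have := congr1 (fun M : 'M[H]_(_, _) => M (f i) j) Ec.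
    rewrite mxE (bigD1 i) //= mxE eqxx mul1r big1 ?addr0 ?mxE // => k ki.
    by rewrite mxE (inj_eq enum_val_inj) eq_sym (negbTE ki) mul0r.
  - by move=> i; rewrite mxE; have := enum_valP i; rewrite inE.
  - have -> : G *m (cjmx U *m E) = cjmx U *m (diag_mx (map_mx rq l) *m E).
      by rewrite mulmxA -[G *m _]mul1mx -U2 !mulmxA -(mulmxA _ U) UG -!mulmxA (mulmxA U) U1 mul1mx.
    rewrite -mulmxA; congr (_ *m _); apply/matrixP => i j.
    rewrite mul_diag_mx mul_mx_diag !mxE.
    by case: eqP => [->|_]; rewrite ?mulr1 ?mul1r ?mulr0 ?mul0r.
rewrite leqNgt; apply/negP => lt.
have [c c0 cY] := ker_row (Y *m cjmx U *m E) lt.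
have := Gneg c c0; apply/negP; rewrite -leNgt.
have -> : c *m (Y *m G *m cjmx Y) *m cjmx c = (c *m Y) *m G *m cjmx (c *m Y).
  by rewrite cjmxM !mulmxA.
rewrite (rtr_spectral _ U2 UG); apply: sumr_ge0 => i _.
have [li|li] := leP 0 (l 0 i); first by rewrite mulr_ge0 ?n2_ge0.
have iS : i \in S by rewrite inE.
rewrite (_ : (c *m Y *m cjmx U) 0 i = 0) ?/n2 ?mul0r ?re0 ?mul0r //.
have := congr1 (fun M : 'M[H]_(_, _) => M 0 (enum_rank_in iS i)) cY.
rewrite !mulmxA mxE (bigD1 i) //= [E i _]mxE /f enum_rankK_in // eqxx mulr1.
rewrite big1 ?addr0 ?[in RHS]mxE // => k ki.
by rewrite [E k _]mxE /f enum_rankK_in // (negbTE ki) mulr0.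
Qed.

Lemma mul_mx_rdiagE m n (A : 'M[H]_(m, n)) (l : 'rV[R]_n) i j :
  (A *m diag_mx (map_mx rq l)) i j = A i j * rq (l 0 j).
Proof. by rewrite mul_mx_diag mxE [map_mx _ _ _ _]mxE. Qed.
Lemma mul_rdiag_mxE m n (A : 'M[H]_(m, n)) (l : 'rV[R]_m) i j :
  (diag_mx (map_mx rq l) *m A) i j = rq (l 0 i) * A i j.
Proof. by rewrite mul_diag_mx mxE [map_mx _ _ _ _]mxE. Qed.
Lemma cjmx_rdiag m (l : 'rV[R]_m) :
  cjmx (diag_mx (map_mx rq l)) = diag_mx (map_mx rq l) :> 'M[H]_m.
Proof.
apply/matrixP => i j; rewrite cjmxE !mxE eq_sym.
by case: eqP => [->|_]; rewrite ?mulr1n ?mulr0n ?cj0 ?cj_rq.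
Qed.

(* G itself need not be nonnegative on a subspace of codimension r: the approximations
   G' come from points avoiding the spectrum of A, which regular points may not do. *)
Lemma neg_count_upper m r (G : 'M[H]_m) : cjmx G = G ->
  (forall eta : R, 0 < eta -> exists (G' : 'M[H]_m) (Z : 'M[H]_(m, r)),
     mnorm (G' - G) < eta /\
     forall c : 'rV[H]_m, c *m Z = 0 -> 0 <= rtr (c *m G' *m cjmx c)) ->
  neg_le G r.
Proof.
move=> Gh approx k [X [l [Xfree l0 GX]]]; rewrite leqNgt; apply/negP => lt.
pose D := diag_mx (map_mx rq (\row_i Num.sqrt (- l 0 i))) : 'M[H]_k.
pose S := cjmx X *m X.
have Sh : cjmx S = S by rewrite cjmxM cjmxK.
have SL : S *m diag_mx (map_mx rq l) = diag_mx (map_mx rq l) *m S.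
  have e : cjmx X *m G *m X = S *m diag_mx (map_mx rq l).
    by rewrite -!mulmxA GX.
  by rewrite -{2}(cjmx_rdiag l) -{2}Sh -cjmxM -e !cjmxM cjmxK Gh mulmxA.
(* Eigenvectors of different eigenvalues are orthogonal, so S i j vanishes unless l_i = l_j. The
   diagonal factor can thus be shared between both sides as square roots of -l. *)
have SD : S *m diag_mx (map_mx rq l) = - (D *m S *m D).
  apply/matrixP => i j; rewrite mul_mx_rdiagE [RHS]mxE mul_mx_rdiagE mul_rdiag_mxE.
  have := congr1 (fun M : 'M[H]_(_, _) => M i j) SL.
  rewrite mul_mx_rdiagE mul_rdiag_mxE rqC => e; rewrite rqC.
  have lij : S i j = 0 \/ l 0 i = l 0 j.
    move/eqP: e; rewrite -subr_eq0 -mulrBl -rqB qmulf_eq0 rq_eq0 subr_eq0.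
    by case/orP=> /eqP; [right|left].
  case: lij => [->|lij]; first by rewrite !(mulr0, mul0r) oppr0.
  rewrite [(\row_i _) 0 i]mxE [(\row_i _) 0 j]mxE lij mulrA -rqM -expr2.
  by rewrite sqr_sqrtr ?oppr_ge0 1?ltW // rqN mulNr opprK.
pose f (d : 'rV[H]_k) := d *m (D *m cjmx X).
have f_inj d : f d = 0 -> d = 0.
  rewrite /f mulmxA => /(congr1 (@cjmx _ _ _ _)); rewrite cjmxM cjmxK cjmx0.
  move/Xfree/(congr1 (@cjmx _ _ _ _)); rewrite cjmxK cjmx0 => dD.
  apply/matrixP => i j; have := congr1 (fun M : 'M[H]_(_, _) => M i j) dD.
  rewrite mul_mx_rdiagE !mxE => /eqP; rewrite qmulf_eq0 rq_eq0 => /orP[/eqP//|].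
  by rewrite sqrtr_eq0 oppr_le0 leNgt l0.
have [a a0 fa] := real_bounded_below (@mulmxr_real_linear _ _ 1 _ _ _) f_inj.
(* At d X^* the form of [G] is at most -a^2 |d|^2, while replacing [G] by [G'] changes it by less
   than eta (|X|^2 + 1) |d|^2. This eta balances the two. *)
pose eta := a ^+ 2 / (sqn X + 1).
have X1 : 0 < sqn X + 1 by rewrite ltr_wpDl ?sqn_ge0.
have eta0 : 0 < eta by rewrite divr_gt0 ?exprn_gt0.
have [G' [Z [G'G Zc]]] := approx eta eta0.
have [d d0 dZ] := ker_row (cjmx X *m Z) lt.
pose c := d *m cjmx X.
have cZ : c *m Z = 0 by rewrite -mulmxA.
have := Zc c cZ; apply/negP; rewrite -ltNge.
have -> : G' = G + (G' - G) by rewrite addrC subrK.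
rewrite mulmxDr mulmxDl rtrD.
have cGc : rtr (c *m G *m cjmx c) = - sqn (f d).
  rewrite /c cjmxM cjmxK -!mulmxA (mulmxA G) GX (mulmxA (cjmx X)) (mulmxA (cjmx X)).
  rewrite -/S SD /f /sqn -rtrN; congr rtr; rewrite !cjmxM cjmxK.
  by rewrite cjmx_rdiag !mulNmx !mulmxN /S !mulmxA.
rewrite cGc addrC subr_lt0.
apply: le_lt_trans (ler_norm _) _.
apply: le_lt_trans (abs_rtr _ _) _; rewrite mnorm_cjmx.
have n0 : 0 < mnorm d by rewrite mnorm_gt0.
have h1 : mnorm c <= mnorm d * mnorm X by rewrite -(mnorm_cjmx X) mnormM.
have h2 : mnorm (c *m (G' - G)) <= mnorm c * eta.
  by apply: le_trans (mnormM _ _) _; rewrite ler_wpM2l ?mnorm_ge0 // ltW.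
apply: le_lt_trans (_ : (mnorm d ^+ 2 * sqn X) * eta < _).
  apply: le_trans (ler_wpM2r (mnorm_ge0 _) h2) _.
  rewrite mulrAC -expr2 -sqr_mnorm -exprMn ler_wpM2r ?(ltW eta0) //.
  by rewrite ler_pXn2r ?nnegrE ?mulr_ge0 ?mnorm_ge0.
apply: lt_le_trans (_ : mnorm d ^+ 2 * (sqn X + 1) * eta <= _).
  by rewrite ltr_pM2r // ltr_pM2l ?exprn_gt0 // ltrDl.
rewrite -mulrA (mulrC (_ + 1)) /eta divfK ?gt_eqF // -exprMn -sqr_mnorm.
by rewrite ler_pXn2r ?nnegrE ?mulr_ge0 ?mnorm_ge0 ?(ltW a0) // mulrC fa.
Qed.

(** Tested on an eigenrow u of X with eigenvalue l, the equation says that u L u^* has real part 2l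
    times that of u diag(p) u^*, which is positive. Hence l >= 0. *)
Lemma lyapunov m (p : 'rV[H]_m) (X L : 'M[H]_m) :
  (forall i, 0 < re (p 0 i)) -> cjmx X = X ->
  diag_mx p *m X + X *m cjmx (diag_mx p) = L ->
  (forall c : 'rV[H]_m, 0 <= rtr (c *m L *m cjmx c)) ->
  forall c : 'rV[H]_m, 0 <= rtr (c *m X *m cjmx c).
Proof.
move=> p0 Xh <- L0 c; have [U [l [U1 U2 UX]]] := hermitian_spectral Xh.
rewrite (rtr_spectral _ U2 UX); apply: sumr_ge0 => i _.
rewrite mulr_ge0 ?n2_ge0 //.
pose u := row i U.
have uX : u *m X = rq (l 0 i) *: u.
  by rewrite -row_mul UX; apply/rowP => j; rewrite mxE mul_rdiag_mxE [RHS]mxE [row _ _ _ _]mxE.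
have Xu : X *m cjmx u = rq (l 0 i) *: cjmx u.
  by rewrite -cjmxZ_real -uX cjmxM Xh.
have := L0 u; rewrite mulmxDr mulmxDl rtrD mulmxA.
rewrite -(mulmxA _ X) Xu scale_realC (mulmxA u X) uX -!scalemxAl !rtrZ.
have -> : rtr (u *m cjmx (diag_mx p) *m cjmx u) = rtr (u *m diag_mx p *m cjmx u).
  by rewrite -rtr_cjmx !cjmxM !cjmxK mulmxA.
rewrite -mulrDr pmulr_lge0 //.
have: 0 < rtr (u *m diag_mx p *m cjmx u); last by move=> h; rewrite addr_gt0.
rewrite rtr_diag lt_def sumr_ge0 ?andbT => [|j _]; last first.
  by rewrite mulr_ge0 ?n2_ge0 // ltW.
rewrite psumr_neq0 => [|j _]; last by rewrite mulr_ge0 ?n2_ge0 // ltW.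
have u0 : u != 0.
  apply/eqP => u0; have := congr1 (fun M : 'M[H]_(_, _) => row i M *m cjmx u) U1.
  rewrite row_mul -/u u0 !mul0mx row1 => /esym.
  have := congr1 (fun M : 'M[H]_(_, _) => M i i) U1.
  rewrite [RHS]mxE eqxx mxE big1 => [/esym/eqP|k _]; first by rewrite oner_eq0.
  by have := congr1 (fun M : 'M[H]_(_, _) => M 0 k) u0; rewrite !mxE => ->; rewrite mul0r.
have /rV0Pn[j uj] := u0.
apply/hasP; exists j; rewrite ?mem_index_enum //= mulr_gt0 //.
by rewrite lt_def n2_eq0 uj n2_ge0.
Qed.

End Spectral.

(** * Rational functions and realizations *)

Section RationalFunctions.
Variables (R : realType) (H : qalg R).

Definition evalq (q : {poly R}) (p : H) : H := (map_poly rq q).[p].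

Lemma evalqE (q : {poly R}) p n : (size q <= n)%N -> evalq q p = \sum_(k < n) rq q`_k * p ^+ k.
Proof.
move=> sq; rewrite /evalq /map_poly horner_poly.
rewrite (big_ord_widen n (fun k => rq q`_k * p ^+ k) sq) big_mkcond.
apply: eq_bigr => k _; case: ltnP => // /(nth_default 0)->.
by rewrite rq0 mul0r.
Qed.

HB.instance Definition _ :=
  GRing.isZmodMorphism.Build R H (@rq R H) (@rqB R H).
HB.instance Definition _ :=
  GRing.isMonoidMorphism.Build R H (@rq R H) (rq1 H, @rqM R H).

Lemma evalq_rq q x : evalq q (rq x) = rq q.[x].
Proof.
rewrite (evalqE _ (leqnn _)) horner_coef rq_sum; apply: eq_bigr => k _.
by rewrite rqM rqX.
Qed.

Lemma evalqM_comm q p r : p * r = r * p -> evalq q p * r = r * evalq q p.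
Proof.
move=> pr; have c k : p ^+ k * r = r * p ^+ k by exact/commr_sym/commrX/commr_sym.
rewrite (evalqE _ (leqnn _)) mulr_suml mulr_sumr; apply: eq_bigr => k _.
by rewrite mulrA rqC -!mulrA c.
Qed.

Lemma evalqC q r p : evalq q p * evalq r p = evalq r p * evalq q p.
Proof. by apply: evalqM_comm; apply/esym/evalqM_comm. Qed.

Lemma evalqM q r p : evalq (q * r) p = evalq q p * evalq r p.
Proof.
rewrite /evalq rmorphM hornerM_comm //; exact: (esym (@evalqM_comm r p p erefl)).
Qed.

(** Real coefficients are central, so conjugation passes through evaluation. Nonvanishing of a real
    polynomial therefore depends only on the sphere of the point. *)
Lemma evalq_conjg q (a p : H) : a != 0 ->
  evalq q (a^-1 * p * a) = a^-1 * evalq q p * a.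
Proof.
move=> a0; rewrite !(evalqE _ (leqnn _)) mulr_sumr mulr_suml.
apply: eq_bigr => k _; rewrite mulrA rqC -!mulrA; congr (_ * _).
elim: (k : nat) => [|n IH]; first by rewrite !expr0 mul1r qmulVq.
by rewrite !exprS IH -!mulrA (mulrA a) qmulqV // mul1r.
Qed.

Lemma evalq_intertwine q N (A : 'M[H]_N) (z : 'rV[H]_N) (a : H) :
  a *: z = z *m A -> evalq q a *: z = z *m hornermx q A.
Proof.
move=> az; rewrite (evalqE _ (leqnn _)) scaler_suml mulmx_sumr.
apply: eq_bigr => k _; rewrite scale_realC -scalerA; congr (_ *: _).
elim: (k : nat) => [|n IH]; first by rewrite !expr0 scale1r -[1]/(1%:M) mulmx1.
by rewrite exprSr -scalerA az exprSr -mulmxE mulmxA -IH scalemxAl.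
Qed.

Lemma map_rq_poly_neq0 (q : {poly R}) : q != 0 -> map_poly rq q != 0 :> {poly H}.
Proof.
by move=> q0; rewrite map_poly_eq0_id0 // rq_eq0 lead_coef_eq0.
Qed.

(** Over a noncommutative ring the degree bounds the number of roots only for commuting roots with
    invertible differences. Real translates of one point have both properties. *)
Lemma uniq_roots_shift (u : H) (xs : seq R) : uniq xs ->
  uniq_roots [seq u + rq x | x <- xs].
Proof.
elim: xs => //= x xs IH /andP[xxs /IH->]; rewrite andbT.
apply/allP => _ /mapP[y yxs ->]; apply/andP; split.
  apply/eqP/commrD; last exact: rqC.
  by apply/commr_sym/commrD; [exact: commr_refl|exact: rqC].
rewrite opprD addrACA subrr add0r -rqB; apply: qunit.
by rewrite rq_eq0 subr_eq0; apply: contraNneq xxs => <-.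
Qed.

Lemma evalq_neq0_near (q : {poly R}) (u : H) : q != 0 ->
  exists2 d : R, 0 < d & forall e, 0 < e -> e < d -> evalq q (u + rq e) != 0.
Proof.
move=> q0; apply: contrapT => nex.
have bad d : 0 < d -> exists e, [/\ 0 < e, e < d & evalq q (u + rq e) = 0].
  move=> d0; apply: contrapT => ne; apply: nex; exists d => // e e0 ed.
  by apply/eqP => qe; apply: ne; exists e.
(* Zeros are chosen ever closer to u, each offset below a positive lower bound of the earlier ones,
   until there are [size q] of them, one more than the degree. *)
have [xs [sz _ uxs rxs]] : exists xs : seq R, [/\ size xs = size q,
    (exists2 d : R, 0 < d & forall x, x \in xs -> d <= x), uniq xs &
    all (root (map_poly rq q)) [seq u + rq x | x <- xs]].
  elim: (size q) => [|n [xs [sz [d d0 dxs] uxs rxs]]].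
    by exists [::]; split=> //; exists 1.
  have [e [e0 ed qe]] := bad d d0; exists (e :: xs); split=> /=.
  - by rewrite sz.
  - exists e => // x; rewrite inE => /orP[/eqP->//|/dxs].
    exact/le_trans/ltW.
  - by rewrite uxs andbT; apply/negP => /dxs; rewrite leNgt ed.
  - by rewrite rxs andbT rootE -[X in X == 0]/(evalq q _) qe.
have := max_ring_poly_roots (map_rq_poly_neq0 q0) rxs (uniq_roots_shift u uxs).
by rewrite size_map sz size_map_poly_id0 ?ltnn // rq_eq0 lead_coef_eq0.
Qed.

Lemma evalq_neq0_near_fin (q : {poly R}) m (u : 'I_m -> H) : q != 0 ->
  exists2 d : R, 0 < d &
    forall e, 0 < e -> e < d -> forall i, evalq q (u i + rq e) != 0.
Proof.
move=> q0; elim: m u => [|m IH] u; first by exists 1 => // e _ _ [].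
have [d d0 hd] := IH (fun i => u (lift ord0 i)).
have [d' d'0 hd'] := evalq_neq0_near (u ord0) q0.
exists (Num.min d d'); first by rewrite lt_min d0.
move=> e e0; rewrite lt_min => /andP[ed ed'] i.
by case: (unliftP ord0 i) => [j ->|->]; [exact: hd|exact: hd'].
Qed.

Lemma poly_eq0_on_reals (P : {poly H}) : (forall x, P.[rq x] = 0) -> P = 0.
Proof.
move=> P0; apply/eqP; apply: contraT => nz.
pose xs := [seq k%:R : R | k <- iota 0 (size P)].
have uxs : uniq xs.
  by rewrite map_inj_in_uniq ?iota_uniq // => i j _ _ /eqP; rewrite eqr_nat => /eqP.
have := max_ring_poly_roots nz (rs := [seq 0 + rq x | x <- xs]) _ (uniq_roots_shift 0 uxs).
rewrite !size_map size_iota ltnn; apply.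
by apply/allP => _ /mapP[x _ ->]; rewrite add0r rootE P0.
Qed.

(** Powers of p stand on the left and coefficients on the right, as in slice hyperholomorphic power
    series. This is what makes values at real points determine the function ([lpoly_eq0]). *)
Definition lpoly m n (f : H -> 'M[H]_(m, n)) : Prop :=
  exists d (a : nat -> 'M[H]_(m, n)), forall p, f p = \sum_(k < d) p ^+ k *: a k.

Lemma lpoly_widen m n (f : H -> 'M[H]_(m, n)) : lpoly f ->
  exists d0, forall d, (d0 <= d)%N ->
    exists a : nat -> 'M[H]_(m, n), forall p, f p = \sum_(k < d) p ^+ k *: a k.
Proof.
case=> d0 [a fE]; exists d0 => d le.
exists (fun k => if (k < d0)%N then a k else 0) => p.
rewrite fE (big_ord_widen d (fun k => p ^+ k *: a k) le) big_mkcond.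
by apply: eq_bigr => k _; case: ifP; rewrite ?scaler0.
Qed.

Lemma lpolyD m n (f g : H -> 'M[H]_(m, n)) :
  lpoly f -> lpoly g -> lpoly (fun p => f p + g p).
Proof.
move=> /lpoly_widen[df hf] /lpoly_widen[dg hg].
have [a fE] := hf _ (leq_maxl df dg); have [b gE] := hg _ (leq_maxr df dg).
exists (maxn df dg), (fun k => a k + b k) => p; rewrite fE gE -big_split.
by apply: eq_bigr => k _; rewrite scalerDr.
Qed.

Lemma lpoly_cst m n (a : 'M[H]_(m, n)) : lpoly (fun _ => a).
Proof. by exists 1%N, (fun _ => a) => p; rewrite big_ord1 expr0 scale1r. Qed.

Lemma lpolyX m n (f : H -> 'M[H]_(m, n)) k :
  lpoly f -> lpoly (fun p => p ^+ k *: f p).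
Proof.
move=> [d [a fE]]; exists (k + d)%N, (fun i => if (i < k)%N then 0 else a (i - k)%N) => p.
rewrite big_split_ord /= big1 ?add0r => [|i _]; last by rewrite ltn_ord scaler0.
rewrite fE scaler_sumr; apply: eq_bigr => i _.
by rewrite ltnNge leq_addr /= addKn scalerA exprD.
Qed.

Lemma lpolyZ m n (f : H -> 'M[H]_(m, n)) x :
  lpoly f -> lpoly (fun p => rq x *: f p).
Proof.
move=> [d [a fE]]; exists d, (fun k => rq x *: a k) => p.
by rewrite fE scaler_sumr; apply: eq_bigr => k _; rewrite !scalerA rqC.
Qed.

Lemma lpolyMr m n l (f : H -> 'M[H]_(m, n)) (B : 'M[H]_(n, l)) :
  lpoly f -> lpoly (fun p => f p *m B).
Proof.
move=> [d [a fE]]; exists d, (fun k => a k *m B) => p.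
by rewrite fE mulmx_suml; apply: eq_bigr => k _; rewrite scalemxAl.
Qed.

Lemma lpoly_sum m n d (f : 'I_d -> H -> 'M[H]_(m, n)) :
  (forall k, lpoly (f k)) -> lpoly (fun p => \sum_k f k p).
Proof.
elim: d f => [|d IH] f fl.
  by exists 0%N, (fun=> 0) => p; rewrite !big_ord0.
have [e [a E]] := lpolyD (fl ord0) (IH _ (fun k => fl (lift ord0 k))).
by exists e, a => p; rewrite big_ord_recl E.
Qed.

Lemma lpoly_evalq m n q (f : H -> 'M[H]_(m, n)) :
  lpoly f -> lpoly (fun p => evalq q p *: f p).
Proof.
move=> fl; have [|e [a E]] := @lpoly_sum m n (size q) (fun k p => rq q`_k *: (p ^+ k *: f p)).
  by move=> k; apply/lpolyZ/lpolyX.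
exists e, a => p; rewrite -E (evalqE _ (leqnn _)) scaler_suml.
by apply: eq_bigr => k _; rewrite scalerA.
Qed.

(** At real points each entry is an ordinary polynomial over the quaternions. Its product with r
    vanishes on all reals, hence is 0, and the nonzero real leading coefficient of r can be
    cancelled. *)
Lemma lpoly_eq0 m n (f : H -> 'M[H]_(m, n)) (r : {poly R}) :
  lpoly f -> r != 0 -> (forall x, r.[x] != 0 -> f (rq x) = 0) ->
  forall p, f p = 0.
Proof.
move=> [d [a fE]] r0 f0 p; rewrite fE big1 // => k _.
suff -> : a k = 0 by rewrite scaler0.
apply/matrixP => i j; rewrite mxE.
pose P : {poly H} := \poly_(k < d) a k i j.
have PE x : P.[rq x] = f (rq x) i j.
  rewrite horner_poly fE summxE; apply: eq_bigr => l _.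
  by rewrite mxE -rqX rqC.
have Pr0 : P * map_poly rq r = 0.
  apply: poly_eq0_on_reals => x; rewrite hornerM_comm; last first.
    by rewrite /comm_poly -[_.[_]]/(evalq r _) evalq_rq -!rqM mulrC.
  rewrite -[X in _ * X]/(evalq r _) evalq_rq PE.
  have [->|rx] := eqVneq r.[x] 0; first by rewrite rq0 mulr0.
  by rewrite f0 // mxE mul0r.
have P0 : P = 0.
  apply: (rreg_lead (p := map_poly rq r)); last by rewrite Pr0 mul0r.
  rewrite lead_coef_map_id0 ?rq0 //; last by rewrite rq_eq0 lead_coef_eq0.
  by apply/mulIr/qunit; rewrite rq_eq0 lead_coef_eq0.
by have := congr1 (fun P : {poly H} => P`_k) P0; rewrite coef_poly ltn_ord coef0.
Qed.

(** The divided difference of q at p and A, with powers of p on the left of C and powers of A on its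
    right. When q(A) = 0 it is q(p) times the solution Z of pZ - ZA = C, wherever q(p) is
    nonzero. *)
Definition resolvent_num m N (q : {poly R}) (C : 'M[H]_(m, N)) (A : 'M[H]_N) (p : H) :=
  \sum_(k < size q) rq q`_k *: \sum_(i < k) p ^+ i *: (C *m A ^+ (k.-1 - i)).

Lemma resolvent_num_lpoly m N q (C : 'M[H]_(m, N)) A : lpoly (resolvent_num q C A).
Proof.
apply: lpoly_sum => k; apply: lpolyZ; apply: lpoly_sum => i; apply: lpolyX.
exact: lpoly_cst.
Qed.

Lemma resolvent_numE m N q (C : 'M[H]_(m, N)) A p :
  p *: resolvent_num q C A p - resolvent_num q C A p *m A =
  evalq q p *: C - C *m hornermx q A.
Proof.
rewrite /resolvent_num (evalqE _ (leqnn _)) scaler_sumr mulmx_suml scaler_suml.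
rewrite mulmx_sumr -!sumrB; apply: eq_bigr => k _.
rewrite scale_realC -!scalemxAl -[in RHS]scalerA -scalerBr.
rewrite [p *: (rq _ *: _)]scalerA rqC -scalerA -scalerBr; congr (_ *: _).
have A0 : A ^+ 0 = 1%:M by [].
case: (k : nat) => [|n] /=.
  by rewrite !big_ord0 scaler0 mul0mx expr0 scale1r A0 mulmx1 !subrr.
rewrite scaler_sumr mulmx_suml.
rewrite big_ord_recr [X in _ - X]big_ord_recl /= subnn subn0 A0 expr0 scale1r.
rewrite mulmx1 scalerA -exprS -mulmxA mulmxE -exprSr.
rewrite [X in X - _]addrC opprD addrACA -[RHS]addr0; congr (_ + _).
rewrite -sumrB big1 // => i _; rewrite scalerA -exprS /bump /= add1n.
rewrite -scalemxAl -mulmxA mulmxE -exprSr -subSn ?subSS ?subrr //.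
Qed.

(** The realization is prescribed at real points only. After clearing [den] and [chi] both sides are
    polynomials in p with right coefficients, so the identity extends to quaternionic p. *)
Lemma transfer_function n N (phi : H -> 'M[H]_n) (C : 'M[H]_(n, N))
    (A : 'M[H]_N) (B : 'M[H]_(N, n)) (D : 'M[H]_n)
    (den chi : {poly R}) (num : seq 'M[H]_n) :
  den != 0 -> chi != 0 -> hornermx chi A = 0 ->
  (forall p, evalq den p != 0 ->
     phi p = (evalq den p)^-1 *: \sum_(k < size num) p ^+ k *: num`_k) ->
  (forall x G, evalq den (rq x) != 0 -> ((rq x)%:M - A) *m G = 1%:M ->
     G *m ((rq x)%:M - A) = 1%:M -> phi (rq x) = D + C *m G *m B) ->
  forall p, evalq (den * chi) p != 0 ->
    exists Z : 'M[H]_(n, N), p *: Z - Z *m A = C /\ phi p = D + Z *m B.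
Proof.
move=> den0 chi0 chiA phiE phireal p; rewrite evalqM qmulf_eq0 negb_or => /andP[dp cp].
pose S := resolvent_num chi C A.
have SE q : q *: S q - S q *m A = evalq chi q *: C.
  by rewrite resolvent_numE chiA mulmx0 subr0.
pose f q := evalq chi q *: (\sum_(k < size num) q ^+ k *: num`_k) -
  evalq den q *: (evalq chi q *: D + S q *m B).
have fl : lpoly f.
  apply: lpolyD; first by apply: lpoly_evalq; exists (size num), (fun k => num`_k).
  have fN g : lpoly g -> lpoly (fun q => - g q : 'M[H]_n).
    by move=> /(lpolyZ (-1))[d [a E]]; exists d, a => q; rewrite -E rqN rq1 scaleN1r.
  apply: fN; apply: lpoly_evalq; apply: lpolyD; last exact/lpolyMr/resolvent_num_lpoly.
  by apply: lpoly_evalq; exact: lpoly_cst.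
have f0 : f p = 0.
  apply: (lpoly_eq0 fl (mulf_neq0 den0 chi0)) => x.
  rewrite hornerM mulf_eq0 negb_or => /andP[dx cx].
  have dx' : evalq den (rq x) != 0 by rewrite evalq_rq rq_eq0.
  have cx' : evalq chi (rq x) != 0 by rewrite evalq_rq rq_eq0.
  have SxE m (L : 'M[H]_(m, N)) : resolvent_num chi L A (rq x) *m ((rq x)%:M - A) = evalq chi (rq x) *: L.
    by rewrite mulmxBr mul_mx_real resolvent_numE chiA mulmx0 subr0.
  pose G := (evalq chi (rq x))^-1 *: resolvent_num chi 1%:M A (rq x).
  have Gx : G *m ((rq x)%:M - A) = 1%:M.
    by rewrite -scalemxAl SxE scalerA qmulVq // scale1r.
  have xG := sq_left_right Gx.
  have := phireal x G dx' xG Gx; rewrite phiE // => /(congr1 (fun M => evalq den (rq x) *: M)).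
  rewrite scalerA qmulqV // scale1r => E; rewrite /f E.
  have -> : S (rq x) = evalq chi (rq x) *: (C *m G).
    by rewrite scalemxAl -SxE -mulmxA xG mulmx1.
  by rewrite -scalemxAl -scalerDr !scalerA evalqC subrr.
exists ((evalq chi p)^-1 *: S p); split.
  have cV : p * (evalq chi p)^-1 = (evalq chi p)^-1 * p.
    by apply/commrV/esym/evalqM_comm.
  by rewrite scalerA cV -scalerA -scalemxAl -scalerBr SE scalerA qmulVq // scale1r.
rewrite phiE // -scalemxAl; move/eqP: f0; rewrite /f subr_eq0 => /eqP.
move/(congr1 (fun M => ((evalq den p)^-1 * (evalq chi p)^-1) *: M)).
rewrite scalerA -(mulrA _ _ (evalq chi p)) qmulVq // mulr1 => ->.
have -> : (evalq den p)^-1 * (evalq chi p)^-1 = (evalq chi p)^-1 * (evalq den p)^-1.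
  by apply/commrV/commr_sym/commrV/commr_sym/evalqC.
by rewrite scalerA -mulrA qmulVq // mulr1 scalerDr scalerA qmulVq // scale1r.
Qed.

End RationalFunctions.

(** * Positivity on the imaginary axis *)

Section FrequencyCondition.
Variables (R : realType) (H : qalg R) (n N : nat).
Variables (C : 'M[H]_(n, N)) (A : 'M[H]_N) (B : 'M[H]_(N, n)) (D : 'M[H]_n).

(** A nonzero solution would make a equal to minus a conjugate of [cj b] by x, so re a = - re b. *)
Lemma sylvester_inj (a b x : H) : 0 < re a -> 0 < re b ->
  a * x + x * cj b = 0 -> x = 0.
Proof.
move=> a0 b0 /eqP; have [//|x0] := eqVneq x 0.
rewrite addr_eq0 => /eqP e; have : a = - (x * cj b * x^-1).
  by rewrite -mulNr -e -mulrA qmulqV // mulr1.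
move/(congr1 re); rewrite reN reC mulrA qmulVq // mul1r re_cj.
by move=> ab; have := addr_gt0 a0 b0; rewrite ab addNr ltxx.
Qed.

Lemma sylvester_solve (a b g : H) : 0 < re a -> 0 < re b ->
  exists x, a * x + x * cj b = g.
Proof.
move=> a0 b0; pose f (X : 'M[H]_1) := a *: X + X *m (cj b)%:M.
have fE X : f X 0 0 = a * X 0 0 + X 0 0 * cj b.
  by rewrite !mxE big_ord1 !mxE eqxx mulr1n.
have fl : real_linear f.
  move=> x X Y; rewrite /f !scalerDr mulmxDl -scalemxAl !scalerA rqC.
  by rewrite addrACA.
have [X /matrixP/(_ 0 0)|X XE] := real_surj fl _ erefl g%:M.
  rewrite fE mxE => /(sylvester_inj a0 b0) X0.
  by apply/matrixP => i j; rewrite !ord1 X0 mxE.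
by exists (X 0 0); rewrite -fE XE mxE eqxx mulr1n.
Qed.

(** Formally z = e C (a - A)^-1 with a acting on the left of the whole row. Stated as a relation, it
    keeps a meaning when a is an eigenvalue of A. *)
Definition on_row (a : H) (z : 'rV[H]_N) (e : 'rV[H]_n) :=
  a *: z - z *m A = e *m C.

Lemma row_map_real_linear (a : H) : real_linear (fun z : 'rV[H]_N => a *: z - z *m A).
Proof.
move=> x X Y; rewrite scalerDr mulmxDl -scalemxAl scalerA rqC -scalerA.
by rewrite scalerBr opprD addrACA.
Qed.

Lemma row_solution (a : H) (e : 'rV[H]_n) : mnorm A < nq a ->
  exists2 z, on_row a z e & mnorm z <= mnorm e * mnorm C / (nq a - mnorm A).
Proof.
move=> Aa; have d0 : 0 < nq a - mnorm A by rewrite subr_gt0.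
have low (z : 'rV[H]_N) : (nq a - mnorm A) * mnorm z <= mnorm (a *: z - z *m A).
  apply: le_trans (mnorm_triB _ _); rewrite mnormZ mulrBl lerB //.
  by rewrite mulrC mnormM.
have [z /eqP|z zE] := real_surj (@row_map_real_linear a) _ erefl (e *m C).
  rewrite -mnorm_eq0 => /eqP e0; apply/eqP; rewrite -mnorm_eq0.
  have := low z; rewrite e0 pmulr_rle0 // => h.
  by apply/eqP/le_anti; rewrite h mnorm_ge0.
exists z => //; rewrite ler_pdivlMr // mulrC.
by apply: le_trans (low z) _; rewrite zE mnormM.
Qed.

(** The point is I (|A| + s) for an imaginary unit I. As s grows z tends to 0 with e fixed, which
    isolates the terms in e. *)
Lemma row_at_infinity (e : 'rV[H]_n) (s : R) : 0 < s ->
  exists a z, [/\ re a = 0, on_row a z e & mnorm z <= mnorm e * mnorm C / s].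
Proof.
move=> s0; have [I [x [reI I2 _ _]]] := imag_polar (re0 H).
have nIw : nq (I * rq (mnorm A + s)) = mnorm A + s.
  have cjI : cj I = - I by rewrite cjE reI mulr0 rq0 sub0r.
  have nI : nq I = 1 by rewrite /nq /n2 cjI mulrN I2 opprK -(rq1 H) re_rq sqrtr1.
  by rewrite nqM nI mul1r nq_rq ger0_norm // addr_ge0 ?mnorm_ge0 // ltW.
have [|z hz zb] := @row_solution (I * rq (mnorm A + s)) e; first by rewrite nIw ltrDl.
exists (I * rq (mnorm A + s)), z; split=> //; first by rewrite reC re_rqM reI mulr0.
by move: zb; rewrite nIw addrAC subrr add0r.
Qed.

Hypothesis obs : forall x : 'cV[H]_N, (forall t, C *m A ^+ t *m x = 0) -> x = 0.

(* The map (z, e) |-> a0 z - z A - e C is onto by observability (Hautus test), so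
   its solutions can be followed when a0 is moved to a nearby point, even if a0 is
   an eigenvalue of A. *)
Lemma row_perturbation (a0 : H) z0 e0 : on_row a0 z0 e0 ->
  exists d c, [/\ 0 < d, 0 <= c & forall a, nq (a - a0) < d ->
    exists z e, [/\ on_row a z e, mnorm (z - z0) <= c * nq (a - a0) &
      mnorm (e - e0) <= c * nq (a - a0)]].
Proof.
move=> h0; pose y (w : 'rV[H]_N) := cj a0 *: w - w *m cjmx A.
pose g (a : H) (w : 'rV[H]_N) := a *: y w - y w *m A + w *m cjmx C *m C.
have yl x X Y : y (rq x *: X + Y) = rq x *: y X + y Y.
  rewrite /y scalerDr mulmxDl -scalemxAl scalerA rqC -scalerA.
  by rewrite scalerBr opprD addrACA.
have gl a : real_linear (g a).
  move=> x X Y; rewrite /g yl; move: (y X) (y Y) => yX yY.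
  rewrite scalerDr !mulmxDl -!scalemxAl scalerA rqC -scalerA.
  by rewrite opprD [X in X + _ = _]addrACA -scalerBr [in RHS]scalerDr addrACA.
have g_inj w : g a0 w = 0 -> w = 0.
  move=> gw; have : rtr (g a0 w *m cjmx w) = sqn (y w) + sqn (w *m cjmx C).
    rewrite /g mulmxDl mulmxBl rtrD -mulmxA -[C *m cjmx w]cjmxK cjmxM cjmxK.
    (* The pairing of [g a0 w] with w is |y w|^2 + |w C^*|^2. If it vanishes, w^* generates an
       A-invariant space killed by C, against observability. *)
    congr (_ + _); rewrite {3}/y -mul_scalar_mx -mulmxA rtrB rtrC -mulmxA.
    rewrite -rtrB -mulmxA -mulmxBr /sqn; congr (rtr (_ *m _)).
    by rewrite /y cjmxB cjmxM cjmxK cjmxZ cjK.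
  rewrite gw mul0mx rtr0 => /esym/eqP.
  rewrite paddr_eq0 ?sqn_ge0 // !sqn_eq0 subr_eq0 => /andP[/eqP yw /eqP wC].
  apply/eqP; rewrite -cjmx_eq0; apply/eqP/obs => t.
  have Aw : A *m cjmx w = cjmx w *m a0%:M.
    by rewrite -[A]cjmxK -cjmxM -yw cjmxZ cjK.
  have -> : C *m A ^+ t *m cjmx w = C *m cjmx w *m (a0 ^+ t)%:M.
    elim: t => [|t IH]; first by rewrite !expr0 -[1 in LHS]/(1%:M) !mulmx1.
    rewrite exprSr -mulmxE -!mulmxA Aw !mulmxA IH -!mulmxA; congr (_ *m (_ *m _)).
    by rewrite -scalar_mxM -exprSr.
  by rewrite -[C *m _]cjmxK cjmxM cjmxK wC cjmx0 mul0mx.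
have [b b0 gb] := real_bounded_below (gl a0) g_inj.
pose c1 := nq a0 + mnorm A + mnorm C + 1.
have c10 : 0 < c1 by rewrite ltr_wpDl // !addr_ge0 ?nq_ge0 ?mnorm_ge0.
have yb w : mnorm (y w) <= c1 * mnorm w.
  apply: le_trans (mnormB _ _) _; rewrite mnormZ nq_cj.
  apply: le_trans (lerD (lexx _) (mnormM _ _)) _.
  rewrite mnorm_cjmx (mulrC (mnorm w)) -mulrDl ler_wpM2r ?mnorm_ge0 //.
  by rewrite /c1 -addrA lerDl addr_ge0 ?mnorm_ge0.
have Cb (w : 'rV[H]_N) : mnorm (w *m cjmx C) <= c1 * mnorm w.
  apply: le_trans (mnormM _ _) _; rewrite mnorm_cjmx mulrC.
  rewrite ler_wpM2r ?mnorm_ge0 // /c1.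
  by have := nq_ge0 a0; have := mnorm_ge0 A; lra.
(* Within this distance [g a] differs from [g a0] by at most b/2 in norm, so it is still bounded
   below, by b/2. *)
exists (b / (2 * c1)), (c1 * (mnorm z0 / (b / 2))); split.
- by rewrite divr_gt0 ?mulr_gt0.
- by rewrite mulr_ge0 ?divr_ge0 ?mnorm_ge0 // ltW // divr_gt0.
move=> a da.
have gE w : g a w = g a0 w + (a - a0) *: y w.
  by rewrite /g scalerBl [RHS]addrC -!addrA addKr.
have low w : b / 2 * mnorm w <= mnorm (g a w).
  rewrite gE; have := mnormD (g a0 w + (a - a0) *: y w) (- ((a - a0) *: y w)).
  rewrite addrK mnormN mnormZ => h1.
  have h2 : nq (a - a0) * mnorm (y w) <= b / 2 * mnorm w.
    apply: le_trans (ler_wpM2l (nq_ge0 _) (yb w)) _.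
    rewrite mulrA ler_wpM2r ?mnorm_ge0 //; apply: le_trans (ler_wpM2r (ltW c10) (ltW da)) _.
    by rewrite invfM mulrA divfK ?gt_eqF.
  have := gb w; lra.
have [w /eqP|w wE] := real_surj (gl a) _ erefl (- ((a - a0) *: z0)).
  rewrite -mnorm_eq0 => /eqP e1; have := low w; rewrite e1 pmulr_rle0 ?divr_gt0 // => h.
  by apply/eqP; rewrite -mnorm_eq0; apply/eqP/le_anti; rewrite h mnorm_ge0.
have wb : mnorm w <= mnorm z0 / (b / 2) * nq (a - a0).
  rewrite mulrAC ler_pdivlMr ?divr_gt0 // mulrC; apply: le_trans (low w) _.
  by rewrite wE mnormN mnormZ mulrC.
exists (z0 + y w), (e0 - w *m cjmx C); split.
- move: wE; rewrite /g; move: (y w) => v wE.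
  rewrite /on_row scalerDr !mulmxDl mulNmx -h0; apply: (addIr (w *m cjmx C *m C)).
  rewrite subrK opprD !addrA [LHS](ACl ((1 * (2 * 4 * 5)) * 3)) /=.
  by rewrite wE scalerBl opprB addrCA subrr addr0.
- by rewrite addrAC subrr add0r (le_trans (yb w)) // -mulrA ler_wpM2l ?(ltW c10).
- by rewrite addrAC subrr add0r mnormN (le_trans (Cb w)) // -mulrA ler_wpM2l ?(ltW c10).
Qed.

Definition out_row (z : 'rV[H]_N) (e : 'rV[H]_n) := e *m D + z *m B.

Lemma out_row_perturbation z0 e0 d c z e : 0 <= d -> 0 <= c ->
  mnorm (z - z0) <= c * d -> mnorm (e - e0) <= c * d ->
  mnorm (out_row z e - out_row z0 e0) <= c * (mnorm D + mnorm B) * d.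
Proof.
move=> d0 c0 hz he.
have -> : out_row z e - out_row z0 e0 = (e - e0) *m D + (z - z0) *m B.
  by rewrite /out_row opprD addrACA -!mulmxBl.
apply: le_trans (mnormD _ _) _; apply: le_trans (lerD (mnormM _ _) (mnormM _ _)) _.
have := ler_wpM2r (mnorm_ge0 D) he; have := ler_wpM2r (mnorm_ge0 B) hz.
nra.
Qed.

Definition kernel_rhs (z : 'rV[H]_N) (e : 'rV[H]_n) z' e' : H :=
  (out_row z e *m cjmx e' + e *m cjmx (out_row z' e')) 0 0.

Lemma kernel_rhs_le z e z' e' M : mnorm (out_row z e) <= M -> mnorm e <= M ->
  mnorm (out_row z' e') <= M -> mnorm e' <= M -> nq (kernel_rhs z e z' e') <= 2 * M ^+ 2.
Proof.
move=> h1 h2 h3 h4; rewrite /kernel_rhs -mnorm11.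
apply: le_trans (mnormD _ _) _; apply: le_trans (lerD (mnormM _ _) (mnormM _ _)) _.
rewrite !mnorm_cjmx mulr2n mulrDl mul1r expr2.
by apply: lerD; apply: ler_pM; rewrite ?mnorm_ge0.
Qed.

Lemma kernel_rhs_diag z e :
  kernel_rhs z e z e = rq (2 * rtr (out_row z e *m cjmx e)).
Proof.
rewrite /kernel_rhs -[e *m _]cjmxK cjmxM cjmxK.
by rewrite mxE [X in _ + X]cjmxE addq_cj rtr11.
Qed.

Lemma mnorm_le_entries m (K : 'M[H]_m) (b : R) : 0 <= b ->
  (forall i j, nq (K i j) <= b) -> mnorm K <= m%:R * b.
Proof.
move=> b0 Kb; rewrite -(ler_pXn2r (n := 2)) ?nnegrE ?mnorm_ge0 ?mulr_ge0 //.
rewrite sqr_mnorm sqnE exprMn.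
apply: le_trans (_ : \sum_(i < m) \sum_(j < m) b ^+ 2 <= _).
  apply: ler_sum => i _; apply: ler_sum => j _; rewrite -sqr_nq.
  by rewrite ler_pXn2r ?nnegrE ?nq_ge0.
by rewrite !sumr_const card_ord (expr2 m%:R) -mulrA !mulr_natl.
Qed.

(** Comparing the moduli of ax and x b* gives an estimate that survives when the real parts tend to
    0, unlike [mx_sylvester_le]. With squared moduli a common real part cancels on the left. *)
Lemma sylvester_le (a b x g : H) : a * x + x * cj b = g ->
  `|n2 a - n2 b| * nq x <= nq g * (nq a + nq b).
Proof.
move=> h; rewrite -!sqr_nq subr_sqr normrM.
have ab0 : 0 <= nq a + nq b by rewrite addr_ge0 ?nq_ge0.
rewrite (ger0_norm ab0) mulrAC ler_wpM2r //.
have h1 : nq (a * x) <= nq g + nq (x * cj b).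
  by rewrite -h -[X in nq X <= _](addrK (x * cj b)) nqB.
have h2 : nq (x * cj b) <= nq g + nq (a * x).
  by rewrite -h -[X in nq X <= _](addrK (a * x)) [X in nq (X - _)]addrC nqB.
move: h1 h2; rewrite !nqM nq_cj => h1 h2.
by rewrite -{1}(ger0_norm (nq_ge0 x)) -normrM mulrBl ler_norml; apply/andP; split; lra.
Qed.

Variables (q : {poly R}) (kappa : nat).
Hypothesis q0 : q != 0.
(** The only consequence of finitely many negative squares that is used: no compressed Gram matrix
    of size kappa + 1 is negative definite. *)
Hypothesis few_neg : forall (a : 'I_kappa.+1 -> H) z e (K : 'M[H]_kappa.+1),
  (forall j, 0 < re (a j)) -> (forall j, evalq q (a j) != 0) ->
  (forall j, on_row (a j) (z j) (e j)) ->
  (forall j l, a j * K j l + K j l * cj (a l) = kernel_rhs (z j) (e j) (z l) (e l)) ->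
  exists2 c : 'rV[H]_kappa.+1, c != 0 & 0 <= rtr (c *m K *m cjmx c).

(* If the inequality fails, kappa + 1 points a0 + i w_j + eps with distinct w_j have
   a Gram matrix whose diagonal tends to -oo as eps -> 0+ while the rest of it stays
   bounded. *)
Lemma frequency_condition a0 z0 e0 : re a0 = 0 -> on_row a0 z0 e0 ->
  0 <= rtr (out_row z0 e0 *m cjmx e0).
Proof.
move=> a00 h0; rewrite leNgt; apply/negP; set g0 := rtr _ => g0_lt0.
have [d0 [c [d00 c0 pert]]] := row_perturbation h0.
have [I [w0 [reI I2 w00 a0E]]] := imag_polar a00.
have cjI : cj I = - I by rewrite cjE reI mulr0 rq0 sub0r.
have nI : nq I = 1.
  by rewrite /nq /n2 cjI mulrN I2 opprK -(rq1 H) re_rq sqrtr1.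
pose DB := c * (mnorm D + mnorm B).
have DB0 : 0 <= DB by rewrite mulr_ge0 ?addr_ge0 ?mnorm_ge0.
pose v0 := out_row z0 e0.
pose M := mnorm v0 + DB + mnorm e0 + c.
have M0 : 0 <= M by rewrite !addr_ge0 ?mnorm_ge0.
pose K1 := DB * (mnorm e0 + c) + mnorm v0 * c.
have K10 : 0 <= K1 by rewrite addr_ge0 ?mulr_ge0 ?addr_ge0 ?mnorm_ge0.
(* Within d1 the perturbation applies, distances are below 1 so that [M] is a uniform bound, and the
   form moves by at most -g0/2, hence stays below g0/2. *)
pose d1 := Num.min (Num.min d0 1) (- g0 / (2 * (K1 + 1))).
have K11 : 0 < K1 + 1 by rewrite ltr_wpDl.
have d10 : 0 < d1.
  by rewrite !lt_min d00 ltr01 divr_gt0 ?oppr_gt0 // mulr_gt0.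
have near_row a : nq (a - a0) < d1 -> exists z e, [/\ on_row a z e,
    mnorm (out_row z e) <= M, mnorm e <= M & rtr (out_row z e *m cjmx e) <= g0 / 2].
  rewrite !lt_min -andbA => /and3P[ad0 ad1 adg].
  have [z [e [aze hz he]]] := pert a ad0.
  set d := nq _ in ad0 ad1 adg hz he; have dge0 : 0 <= d by exact: nq_ge0.
  have hv := out_row_perturbation dge0 c0 hz he; rewrite -/DB -/v0 in hv.
  have cd : c * d <= c by rewrite ler_piMr // ltW.
  have DBd : DB * d <= DB by rewrite ler_piMr // ltW.
  have he1 : mnorm e <= mnorm e0 + c.
    by have := mnormD (e - e0) e0; rewrite subrK; lra.
  have hv1 : mnorm (out_row z e) <= mnorm v0 + DB.
    by have := mnormD (out_row z e - v0) v0; rewrite subrK; lra.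
  exists z, e; split=> //.
  - by apply: le_trans hv1 _; rewrite /M -addrA lerDl addr_ge0 ?mnorm_ge0.
  - by apply: le_trans he1 _; rewrite /M -addrA lerDr addr_ge0 ?mnorm_ge0.
  have -> : out_row z e *m cjmx e =
      v0 *m cjmx e0 + ((out_row z e - v0) *m cjmx e + v0 *m cjmx (e - e0)).
    by rewrite mulmxBl cjmxB mulmxBr subrKA addrCA subrr addr0.
  rewrite !rtrD -/g0.
  have t1 : rtr ((out_row z e - v0) *m cjmx e) <= DB * (mnorm e0 + c) * d.
    apply: le_trans (CauchySchwarz_rtr _ _) _; rewrite mulrAC.
    by apply: ler_pM; rewrite ?mnorm_ge0.
  have t2 : rtr (v0 *m cjmx (e - e0)) <= mnorm v0 * c * d.
    apply: le_trans (CauchySchwarz_rtr _ _) _; rewrite -mulrA.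
    by apply: ler_pM; rewrite ?mnorm_ge0.
  have t3 : (K1 + 1) * d <= - g0 / 2.
    rewrite mulrC -ler_pdivlMr // -mulrA -invfM; exact: ltW.
  have := mulr_ge0 K10 dge0; rewrite mulrDl mul1r in t3; rewrite /K1 in t3 *.
  move: t1 t2 t3; rewrite !mulrDl; lra.
pose k1 : R := kappa.+1%:R.
have k10 : 0 < k1 by rewrite ltr0n.
pose eta := d1 / (4 * k1).
have eta0 : 0 < eta by rewrite divr_gt0 ?mulr_gt0.
(* The frequencies are eta apart, at least eta, and within d1/4 of w0, as eta (kappa + 1) = d1/4. *)
pose w (j : 'I_kappa.+1) := w0 + eta * (j.+1)%:R.
have w_gt0 j : eta <= w j.
  by rewrite /w ler_wpDl // ler_pMr // ler1n.
pose u j : H := I * rq (w j).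
have [d2 d20 hq] := evalq_neq0_near_fin u q0.
pose L := w0 + d1.
(* Off the diagonal |w_j^2 - w_l^2| >= eta^2, the right-hand side is at most 2M^2 and |a_j| + |a_l|
   at most 2L. The bound is independent of eps. *)
pose Ko := (2 * M ^+ 2 * (2 * L)) / eta ^+ 2.
have L0 : 0 <= L by rewrite addr_ge0 // ltW.
have Ko0 : 0 <= Ko.
  by rewrite divr_ge0 ?exprn_ge0 ?(ltW eta0) // !mulr_ge0 ?exprn_ge0.
pose T := k1 * Ko + 1.
have T0 : 0 < T.
  by have := mulr_ge0 (ltW k10) Ko0; rewrite /T; lra.
(* The three bounds avoid the zeros of [q], keep the points near a0, and let the diagonal, at most
   g0/(2 eps), outweigh the rest; the 1 in [T] makes this strict. *)
pose eps := Num.min (Num.min (d2 / 2) (d1 / 4)) (- g0 / (2 * T)).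
have eps0 : 0 < eps.
  rewrite !lt_min !divr_gt0 //=; last by rewrite mulr_gt0.
  by rewrite oppr_gt0.
have eps_d2 : eps < d2.
  by apply: le_lt_trans (_ : d2 / 2 < d2); rewrite ?ge_min ?lexx //; lra.
have eps_d1 : eps <= d1 / 4 by rewrite !ge_min lexx orbT.
have eps_T : eps <= - g0 / (2 * T) by rewrite ge_min lexx orbT.
pose a j := u j + rq eps.
have rea j : re (a j) = eps.
  by rewrite reD re_rq /u reC re_rqM reI mulr0 add0r.
have aa0 j : nq (a j - a0) < d1.
  have -> : a j - a0 = I * rq (eta * j.+1%:R) + rq eps.
    by rewrite /a /u /w a0E rqD mulrDr -[X in X - _]addrA [X in X - _]addrC addrK.
  apply: le_lt_trans (nqD _ _) _; rewrite nqM nI mul1r !nq_rq.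
  rewrite (ger0_norm (mulr_ge0 (ltW eta0) (ler0n _ _))) (ger0_norm (ltW eps0)).
  have jk : eta * j.+1%:R <= eta * k1 by rewrite ler_pM2l // ler_nat.
  have : eta * k1 = d1 / 4 by rewrite /eta invfM mulrA divfK ?gt_eqF.
  lra.
have nqa j : nq (a j) <= L.
  have := nqD (a j - a0) a0; rewrite subrK.
  have -> : nq a0 = w0 by rewrite a0E nqM nI mul1r nq_rq ger0_norm.
  by have := aa0 j; rewrite /L; lra.
have n2a j : n2 (a j) = eps ^+ 2 + w j ^+ 2.
  have uu : u j * u j = - rq (w j ^+ 2).
    by rewrite /u mulrA -(mulrA I) -rqC mulrA I2 mulN1r mulNr -rqM -expr2.
  have cju : cj (u j) = - u j by rewrite /u cjM cj_rq cjI mulrN -rqC.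
  rewrite /n2 /a cjD cju cj_rq mulrDl !mulrDr !mulrN uu opprK -rqM rqC.
  by rewrite addrA addrK -rqD re_rq -expr2 addrC.
have /choice[ze hze] : forall j, exists ze : 'rV[H]_N * 'rV[H]_n,
    [/\ on_row (a j) ze.1 ze.2, mnorm (out_row ze.1 ze.2) <= M, mnorm ze.2 <= M &
      rtr (out_row ze.1 ze.2 *m cjmx ze.2) <= g0 / 2].
  by move=> j; have [z [e hz]] := near_row _ (aa0 j); exists (z, e).
pose z j := (ze j).1; pose e j := (ze j).2.
have /choice[Kf hK] : forall jl : 'I_kappa.+1 * 'I_kappa.+1, exists x,
    a jl.1 * x + x * cj (a jl.2) = kernel_rhs (z jl.1) (e jl.1) (z jl.2) (e jl.2).
  by move=> jl; apply: sylvester_solve; rewrite rea.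
pose K := \matrix_(j, l) Kf (j, l).
have KE j l : a j * K j l + K j l * cj (a l) = kernel_rhs (z j) (e j) (z l) (e l).
  by rewrite mxE (hK (j, l)).
have [||j|v vn0] := few_neg (a := a) (z := z) (e := e) _ _ _ KE.
- by move=> j; rewrite rea.
- by move=> j; exact: hq.
- by have [] := hze j.
apply/negP; rewrite -ltNge.
pose G j := rtr (out_row (z j) (e j) *m cjmx (e j)).
have KjjE j : K j j = rq (G j / eps).
  apply/eqP; rewrite -subr_eq0; apply/eqP.
  apply: (@sylvester_inj (a j) (a j)); rewrite ?rea //.
  rewrite mulrBr mulrBl addrACA KE kernel_rhs_diag rqC -opprD -mulrDr addq_cj rea.
  by rewrite -rqM [2 * eps]mulrC mulrA divfK ?gt_eqF // mulrC subrr.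
pose dg := \row_j (G j / eps).
pose Kd : 'M[H]_kappa.+1 := diag_mx (map_mx rq dg).
have Koff : mnorm (K - Kd) <= k1 * Ko.
  apply: mnorm_le_entries => // j l; rewrite mxE [X in nq (_ + X)]mxE.
  rewrite [Kd j l]mxE [map_mx _ _ _ _]mxE [dg _ _]mxE.
  have [->|jl] := eqVneq j l; first by rewrite mulr1n KjjE subrr nq0.
  rewrite mulr0n subr0 /Ko ler_pdivlMr ?exprn_gt0 // mulrC.
  apply: le_trans (_ : `|n2 (a j) - n2 (a l)| * nq (K j l) <= _).
    have subDD (x y t : R) : x + y - (x + t) = y - t by ring.
    rewrite ler_wpM2r ?nq_ge0 // !n2a subDD subr_sqr normrM expr2.
    apply: ler_pM; rewrite ?(ltW eta0) //.
      rewrite /w subDD -mulrBr normrM (gtr0_norm eta0) ler_pMr //.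
      have : (j.+1%:R - l.+1%:R : R) = (j.+1%:Z - l.+1%:Z)%:~R by rewrite rmorphB.
      move=> ->; rewrite -intr_norm ler1z -gtz0_ge1 normr_gt0 subr_eq0.
      by rewrite eqz_nat eqSS.
    by apply: le_trans (ler_norm _); move: (w_gt0 j) (w_gt0 l) eta0; lra.
  apply: le_trans (sylvester_le (KE j l)) _.
  apply: ler_pM; rewrite ?nq_ge0 ?addr_ge0 ?nq_ge0 //.
    have [_ h1 h2 _] := hze j; have [_ h3 h4 _] := hze l.
    exact: kernel_rhs_le.
  by have := nqa j; have := nqa l; lra.
have -> : K = Kd + (K - Kd) by rewrite addrC subrK.
rewrite mulmxDr mulmxDl rtrD rtr_diag.
have v_gt0 : 0 < sqn v by rewrite sqn_gt0.
have t1 : \sum_i n2 (v 0 i) * re (map_mx rq dg 0 i : H) <= sqn v * (g0 / 2 / eps).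
  rewrite sqnE big_ord1 mulr_suml; apply: ler_sum => j _.
  rewrite ler_wpM2l ?n2_ge0 // mxE re_rq mxE ler_pM2r ?invr_gt0 //.
  by have [] := hze j.
have t2 : rtr (v *m (K - Kd) *m cjmx v) <= sqn v * (k1 * Ko).
  apply: le_trans (CauchySchwarz_rtr _ _) _.
  apply: le_trans (ler_wpM2r (mnorm_ge0 _) (mnormM _ _)) _.
  by rewrite mulrAC -expr2 sqr_mnorm ler_wpM2l // ltW.
apply: le_lt_trans (lerD t1 t2) _; rewrite -mulrDr pmulr_rlt0 //.
have : T * eps <= - g0 / 2.
  by rewrite mulrC -ler_pdivlMr // -mulrA -invfM.
rewrite -ler_pdivlMr // /T mulNr mulNr; lra.
Qed.

Lemma frequency_condition_oo (e : 'rV[H]_n) : 0 <= rtr (e *m D *m cjmx e).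
Proof.
rewrite leNgt; apply/negP => g_lt0; set g := rtr _ in g_lt0.
pose b := mnorm e * mnorm C * mnorm B * mnorm e.
have b0 : 0 <= b by rewrite !mulr_ge0 ?mnorm_ge0.
(* The term z B e^* contributes at most b/s, and s (-g) = b - g > b, so it cannot compensate g. *)
pose s := 1 + b / - g.
have s0 : 0 < s by rewrite ltr_wpDr // divr_ge0 // oppr_ge0 ltW.
have [a [z [ra hz zb]]] := row_at_infinity e s0.
have := frequency_condition ra hz.
apply/negP; rewrite -ltNge /out_row mulmxDl rtrD -/g.
have : rtr (z *m B *m cjmx e) <= b / s.
  apply: le_trans (CauchySchwarz_rtr _ _) _.
  apply: le_trans (ler_wpM2r (mnorm_ge0 _) (mnormM _ _)) _.
  have -> : b / s = mnorm e * mnorm C / s * (mnorm B * mnorm e) by rewrite /b; ring.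
  by rewrite -(mulrA (mnorm z)) ler_wpM2r ?mulr_ge0 ?mnorm_ge0.
have : b / s < - g.
  rewrite ltr_pdivrMr // /s mulrDr mulr1 [_ * (b / _)]mulrC.
  by rewrite divfK ?gt_eqF ?oppr_gt0 // ltrDr oppr_gt0.
lra.
Qed.

End FrequencyCondition.

(** * Rank one decomposition along rows at imaginary points *)

Section DissipationInequality.
Variables (R : realType) (H : qalg R) (n N : nat).
Variables (C : 'M[H]_(n, N)) (A : 'M[H]_N) (B : 'M[H]_(N, n)) (D : 'M[H]_n).
Hypothesis fc : forall a z e, re a = 0 -> on_row C A a z e ->
  0 <= rtr (out_row B D z e *m cjmx e).
Hypothesis fc_oo : forall e : 'rV[H]_n, 0 <= rtr (e *m D *m cjmx e).

Lemma peeling r (Z : 'M[H]_(r, N)) (E : 'M[H]_(r, n)) :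
  let F := Z *m A + E *m C in cjmx Z *m F + cjmx F *m Z = 0 ->
  0 <= rtr ((E *m D + Z *m B) *m cjmx E).
Proof.
elim: r Z E => [|r IH] Z E F ZF.
  by rewrite [_ *m _](_ : _ = 0) ?rtr0 //; apply/matrixP => -[].
(* If Z has independent rows then F = S Z with S skew-Hermitian, and a left
   eigenvector c of S satisfies c F = a (c Z) with a imaginary; otherwise c Z = 0 for
   some c. The row c is then split off. *)
have [c c1 [cpos cZF]] : exists2 c : 'rV[H]_r.+1, c *m cjmx c = 1%:M &
    0 <= rtr (out_row B D (c *m Z) (c *m E) *m cjmx (c *m E)) /\
    cjmx (c *m Z) *m (c *m F) + cjmx (c *m F) *m (c *m Z) = 0.
  have [[c0 [c0n0 cZ0]]|noker] := pselect (exists c : 'rV[H]_r.+1, c != 0 /\ c *m Z = 0).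
    have [t t0 c1] := normalize_row c0n0; exists (rq t *: c0) => //.
    have -> : rq t *: c0 *m Z = 0 by rewrite -scalemxAl cZ0 scaler0.
    rewrite cjmx0 mul0mx mulmx0 addr0; split=> //.
    by rewrite /out_row mul0mx addr0; exact: fc_oo.
  have [v vZ|L ZL] := mx_right_inverse (M := Z).
    by apply/eqP/negPn/negP => v0; apply: noker; exists v.
  pose S := F *m L.
  have FE : F = - cjmx S *m Z.
    move: ZF => /(congr1 (mulmx (cjmx L))); rewrite mulmxDr !mulmxA -cjmxM ZL.
    by rewrite cjmx1 mul1mx mulmx0 -cjmxM mulNmx => /eqP; rewrite addr_eq0 => /eqP.
  have SE : S = - cjmx S by rewrite {1}/S FE -mulmxA ZL mulmx1.
  clearbody S.
  have [c0 [a [c0n0 c0S]]] := left_eigenvector S (ltn0Sn r).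
  have [t t0 c1] := normalize_row c0n0; set c := rq t *: c0 in c1.
  have cS : c *m S = a *: c by rewrite -scalemxAl c0S /c !scalerA rqC.
  have cF : c *m F = a *: (c *m Z) by rewrite FE -SE mulmxA cS scalemxAl.
  have aE : c *m S *m cjmx c = a%:M by rewrite cS -scalemxAl c1 scalemx1.
  have ca : cj a = - a.
    have := congr1 (@cjmx _ _ _ _) aE.
    rewrite !cjmxM cjmxK cjmx_scalar -[cjmx S]opprK -SE mulNmx mulmxN mulmxA aE.
    by move=> /matrixP/(_ 0 0); rewrite !mxE eqxx !mulr1n => <-.
  have ra : re a = 0.
    by have := re_cj a; rewrite ca reN; lra.
  exists c => //; split.
    apply: (fc ra); rewrite /on_row -cF /F mulmxDr !mulmxA.
    by rewrite addrAC subrr add0r.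
  rewrite cF; move: (c *m Z) => X.
  by rewrite cjmxZ ca -mulmxA mul_scalar_mx scaleNr mulmxN subrr.
have [Q [Q1 cQ cQ1]] := orthonormal_completion c1.
(* Since c^* c + Q^* Q = 1, both the constraint and the objective are sums of a part from c and a
   part from Q, and the latter has one row less. *)
have split_rtr k l (X : 'M[H]_(r.+1, k)) (Y : 'M[H]_(r.+1, l)) :
    cjmx X *m Y = cjmx (c *m X) *m (c *m Y) + cjmx (Q *m X) *m (Q *m Y).
  rewrite !cjmxM -!mulmxA -mulmxDr; congr (_ *m _).
  by rewrite !mulmxA -mulmxDl cQ1 mul1mx.
have := IH (Q *m Z) (Q *m E); rewrite -!mulmxA -!mulmxDr -/F => IHQ.
rewrite rtrC split_rtr rtrD addr_ge0 //.
  by move: cpos; rewrite /out_row -!mulmxA -mulmxDr rtrC.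
rewrite rtrC; apply: IHQ.
by move: ZF; rewrite (split_rtr _ _ Z F) (split_rtr _ _ F Z) addrACA cZF add0r.
Qed.

Hypothesis obs : forall x : 'cV[H]_N, (forall t, C *m A ^+ t *m x = 0) -> x = 0.

(** If (a, b) annihilates all these rows, points at infinity give b = 0; then zA + eC = pz shows
    that (Aa, Ca) annihilates them too. Iterating, C A^t a = 0 for all t. *)
Lemma rows_separate (a : 'cV[H]_N) (b : 'cV[H]_n) :
  (forall p z e, re p = 0 -> on_row C A p z e -> z *m a + e *m b = 0) -> a = 0 /\ b = 0.
Proof.
pose V (a : 'cV[H]_N) (b : 'cV[H]_n) :=
  forall p z e, re p = 0 -> on_row C A p z e -> z *m a + e *m b = 0.
have V0 x y : V x y -> y = 0.
  move=> Vxy; apply/eqP; rewrite -cjmx_eq0; set e := cjmx y.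
  have ey (s : R) : 0 < s -> mnorm (e *m y) * s <= mnorm e * mnorm C * mnorm x.
    move=> s0; have [p [z [rp hz zb]]] := row_at_infinity C A e s0.
    have /eqP := Vxy p z e rp hz; rewrite addrC addr_eq0 => /eqP->; rewrite mnormN.
    rewrite mulrC -ler_pdivlMl // mulrC.
    apply: le_trans (mnormM _ _) _; rewrite mulrAC ler_wpM2r ?mnorm_ge0 //.
  have e0 : e *m y = 0.
    apply/eqP; rewrite -mnorm_eq0 eq_le mnorm_ge0 andbT leNgt; apply/negP => m0.
    set k := mnorm e * mnorm C * mnorm x in ey.
    have k0 : 0 <= k by rewrite !mulr_ge0 ?mnorm_ge0.
    have := ey ((k + 1) / mnorm (e *m y)).
    rewrite divr_gt0 ?ltr_wpDl // mulrC divfK ?gt_eqF // => /(_ isT).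
    by rewrite gerDl ler10.
  by rewrite -sqn_eq0 /sqn cjmxK e0 rtr0.
have VA x y : V x y -> V (A *m x) (C *m x).
  move=> Vxy p z e rp hz; rewrite !mulmxA -mulmxDl.
  have -> : z *m A + e *m C = p *: z by rewrite -hz addrC subrK.
  have := Vxy p z e rp hz; rewrite (V0 _ _ Vxy) mulmx0 addr0 => zx.
  by rewrite -scalemxAl zx scaler0.
move=> Vab; split; last exact: V0 Vab.
apply: obs => t.
have [y Vy] : exists y, V (A ^+ t *m a) y.
  elim: t => [|t [y Vy]]; first by exists b; rewrite expr0 mul1mx.
  by exists (C *m (A ^+ t *m a)); rewrite exprS -mulmxE -mulmxA; exact: VA Vy.
by rewrite -mulmxA; exact: V0 (VA _ _ Vy).
Qed.

(** A maximal left independent family works: a nonzero column killed by it is not killed by some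
    further row, by [rows_separate], and that row could be added. *)
Lemma spanning_rows : exists k (Z : 'M[H]_(k, N)) (E : 'M[H]_(k, n)) (p : 'rV[H]_k),
  [/\ forall i, re (p 0 i) = 0, diag_mx p *m Z = Z *m A + E *m C &
      exists T, T *m row_mx Z E = 1%:M].
Proof.
pose P k := exists (Z : 'M[H]_(k, N)) (E : 'M[H]_(k, n)) (p : 'rV[H]_k),
  [/\ forall i, re (p 0 i) = 0, diag_mx p *m Z = Z *m A + E *m C &
      forall c : 'rV[H]_k, c *m row_mx Z E = 0 -> c = 0].
have P0 : exists k, `[< P k >].
  exists 0%N; apply/asboolP; exists 0, 0, 0; split=> [[]//||c _].
    by rewrite !mul0mx mulmx0 addr0.
  exact: thinmx0.
have Pub k : `[< P k >] -> (k <= N + n)%N.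
  move=> /asboolP[Z [E [p [_ _ ind]]]]; rewrite leqNgt; apply/negP => lt.
  by have [c c0 /ind cE] := ker_row (row_mx Z E) lt; rewrite cE eqxx in c0.
case: (ex_maxnP P0 Pub) => k /asboolP[Z [E [p [rp ZE ind]]]] kmax.
exists k, Z, E, p; split=> //; apply: mx_left_inverse => v Wv.
have [->|v0] := eqVneq v 0; first by [].
exfalso; rewrite -(vsubmxK v) mul_row_col in Wv.
have [q [z [e [rq_ hz zv]]]] : exists q z e, [/\ re q = 0, on_row C A q z e &
    z *m usubmx v + e *m dsubmx v != 0].
  apply: contrapT => nex; case/eqP: v0; rewrite -(vsubmxK v).
  have [|-> ->] := @rows_separate (usubmx v) (dsubmx v); last by rewrite col_mx0.
  move=> q z e rq_ hz; apply/eqP/negPn/negP => ne.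
  by apply: nex; exists q, z, e.
have : `[< P (1 + k)%N >].
  apply/asboolP; exists (col_mx z Z), (col_mx e E), (row_mx q%:M p); split.
  - move=> i; case: (split_ordP i) => j ->; rewrite ?row_mxEl ?row_mxEr //.
    by rewrite ord1 mxE eqxx mulr1n.
  - rewrite diag_mx_row mul_block_col !mul0mx addr0 add0r ZE !mul_col_mx add_col_mx.
    congr col_mx; have -> : z *m A + e *m C = q *: z by rewrite -hz addrC subrK.
    rewrite -mul_scalar_mx; congr (_ *m _); apply/matrixP => i j.
    by rewrite !ord1 !mxE eqxx !mulr1n.
  move=> c; rewrite -[c]hsubmxK; move: (lsubmx c) (rsubmx c) => l m cW.
  have [h1 h2] : l *m z + m *m Z = 0 /\ l *m e + m *m E = 0.
    by apply: eq_row_mx; rewrite row_mx0 -!mul_row_col -mul_mx_row.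
  move: zv; set s := _ + _ => s0.
  have ls : l *m s = 0.
    have -> : l *m s = (l *m z + m *m Z) *m usubmx v + (l *m e + m *m E) *m dsubmx v.
      rewrite !mulmxDl addrACA -!mulmxA -!mulmxDr.
      by rewrite [X in _ + m *m X](_ : _ = 0) ?mulmx0 ?addr0.
    by rewrite h1 h2 !mul0mx addr0.
  clearbody s.
  have l0 : l = 0.
    apply/matrixP => i j; rewrite !ord1 mxE; move/matrixP: ls => /(_ 0 0).
    rewrite mxE big_ord1 mxE => /eqP; rewrite qmulf_eq0 => /orP[/eqP//|s00].
    by case/eqP: s0; apply/matrixP => i' j'; rewrite !ord1 (eqP s00) mxE.
  rewrite l0 (_ : m = 0) ?row_mx0 //; apply: ind.
  by rewrite mul_mx_row; move: h1 h2; rewrite l0 !mul0mx !add0r => -> ->; rewrite row_mx0.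
by move=> /kmax; rewrite ltnn.
Qed.

End DissipationInequality.

(** * Duality *)

Section Farkas.
Variable R : realType.

(** One coordinate of psi is chosen at a time. The last hypothesis replaces closedness of the cone:
    it bounds the candidates for that coordinate from both sides. *)
Lemma farkas d (K : R -> 'rV[R]_d -> Prop) :
  (forall a b v w, K a v -> K b w -> K (a + b) (v + w)) ->
  (forall t a v, 0 < t -> K a v -> K (t * a) (t *: v)) ->
  (forall a, K a 0 -> 0 <= a) ->
  (forall a v, K a v -> exists b, K b (- v)) ->
  exists psi : 'cV[R]_d, forall a v, K a v -> 0 <= a + (v *m psi) 0 0.
Proof.
elim: d K => [|d IH] K' KD' KZ' K0' Ksym'.
  exists 0 => a v; rewrite (thinmx0 v) mul0mx mxE addr0; exact: K0'.
pose K a (v : 'rV[R]_(1 + d)) := K' a v.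
have KD a b (v w : 'rV[R]_(1 + d)) : K a v -> K b w -> K (a + b) (v + w) by exact: KD'.
have KZ t a (v : 'rV[R]_(1 + d)) : 0 < t -> K a v -> K (t * a) (t *: v) by exact: KZ'.
have K0 a : K a 0 -> 0 <= a by exact: K0'.
have Ksym a (v : 'rV[R]_(1 + d)) : K a v -> exists b, K b (- v) by exact: Ksym'.
suff [psi hpsi] : exists psi : 'cV[R]_(1 + d), forall a v, K a v -> 0 <= a + (v *m psi) 0 0.
  by exists psi.
clearbody K; move=> {K' KD' KZ' K0' Ksym'}.
(* The first coordinate alpha of psi must be at least every x in [S], and at most a whenever K a
   (-1, 0). If [S] is empty, K meets the first axis only at 0 and alpha = 0 works. *)
pose S : set R := [set x | K (- x) (row_mx 1%:M 0)].
have minus_one a : K a (row_mx (-1)%:M 0) -> ubound S a.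
  move=> Ka x Sx; have := KD _ _ _ _ Ka Sx.
  rewrite add_row_mx addr0 -raddfD addNr raddf0 row_mx0 => /K0.
  by rewrite subr_ge0.
have Sub x : S x -> has_ubound S.
  move=> Sx; have [b] := Ksym _ _ Sx; rewrite opp_row_mx oppr0 -raddfN => Kb.
  by exists b; exact: minus_one.
have [alpha ha] : exists alpha, forall a t,
    K a (row_mx t%:M 0) -> 0 <= a + alpha * t.
  have norm a t : t != 0 -> K a (row_mx t%:M 0) ->
      K (`|t|^-1 * a) (row_mx (`|t|^-1 * t)%:M 0 : 'rV[R]_(1 + d)).
    move=> t0 Kt; have := KZ `|t|^-1 _ _ _ Kt.
    rewrite invr_gt0 normr_gt0 scale_row_mx scaler0 scale_scalar_mx; exact.
  have [[x Sx]|noS] := pselect (exists x, S x); last first.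
    exists 0 => a t Kt; rewrite mul0r addr0.
    have [t0|t0|t0] := ltgtP t 0; last first.
    - by apply: K0; move: Kt; rewrite t0 raddf0 row_mx0.
    - case: noS; exists (- (`|t|^-1 * a)); rewrite /S /= opprK.
      by have := norm _ _ (lt0r_neq0 t0) Kt; rewrite (gtr0_norm t0) mulVf ?lt0r_neq0.
    - have [b] := Ksym _ _ (norm _ _ (ltr0_neq0 t0) Kt).
      rewrite opp_row_mx oppr0 -raddfN -mulrN (ltr0_norm t0) mulVf ?oppr_eq0 ?ltr0_neq0 // => Kb.
      by case: noS; exists (- b); rewrite /S /= opprK.
  have hS : has_sup S by split; [exists x|exact: Sub Sx].
  exists (sup S) => a t Kt; have [t0|t0|t0] := ltgtP t 0; last first.
  - by rewrite t0 mulr0 addr0; apply: K0; move: Kt; rewrite t0 raddf0 row_mx0.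
  - have Sa : S (- (t^-1 * a)).
      rewrite /S /= opprK; have := norm _ _ (lt0r_neq0 t0) Kt.
      by rewrite (gtr0_norm t0) mulVf ?lt0r_neq0.
    have := sup_upper_bound hS Sa; rewrite -(ler_pM2r t0) mulNr mulrAC mulVf ?lt0r_neq0 //.
    by rewrite mul1r; lra.
  - have ub : ubound S ((- t)^-1 * a).
      apply: minus_one; have := norm _ _ (ltr0_neq0 t0) Kt.
      have -> : `|t|^-1 * t = -1 by rewrite (ltr0_norm t0) invrN mulNr mulVf ?ltr0_neq0.
      by rewrite (ltr0_norm t0).
    have := ge_sup (ex_intro _ x Sx) ub; have nt0 : 0 < - t by rewrite oppr_gt0.
    rewrite -(ler_pM2r nt0) mulrAC mulVf ?gt_eqF // mul1r.
    by lra.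
(* Absorbing alpha t into the value gives a cone in one dimension less with the same four
   properties; the third is the choice of alpha. *)
pose K1 b (w : 'rV[R]_d) :=
  exists a t, K a (row_mx t%:M w) /\ b = a + alpha * t.
have [||b [a [t [Kt ->]]]|b w [a [t [Kt _]]]|psi hpsi] := IH K1.
- move=> _ _ v w [a [t [Ka ->]]] [b [s [Kb ->]]]; exists (a + b), (t + s); split.
    by have := KD _ _ _ _ Ka Kb; rewrite add_row_mx -raddfD.
  by rewrite mulrDr addrACA.
- move=> s _ v s0 [a [t [Ka ->]]]; exists (s * a), (s * t); split.
    by have := KZ _ _ _ s0 Ka; rewrite scale_row_mx scale_scalar_mx.
  by rewrite mulrDr mulrCA.
- exact: ha Kt.
- have [c] := Ksym _ _ Kt; rewrite opp_row_mx -raddfN => Kc.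
  by exists (c + alpha * - t), c, (- t).
exists (col_mx alpha%:M psi) => a v Kv.
rewrite -[v]hsubmxK mul_row_col mxE addrA.
have lE : lsubmx v = (lsubmx v 0 0)%:M.
  by apply/matrixP => i j; rewrite !ord1 [RHS]mxE eqxx mulr1n.
rewrite lE -scalar_mxM [X in _ + X + _]mxE eqxx mulr1n mulrC.
apply: hpsi; exists a, (lsubmx v 0 0); split=> //.
by rewrite -lE hsubmxK.
Qed.

End Farkas.

(** * The multiplier P obtained by duality *)

Section Multiplier.
Variables (R : realType) (H : qalg R).

Lemma psd_factor m (G : 'M[H]_m) : cjmx G = G ->
  (forall c : 'rV[H]_m, 0 <= rtr (c *m G *m cjmx c)) ->
  exists L : 'M[H]_m, cjmx L *m L = G.
Proof.
move=> Gh G0; have [U [l [U1 U2 UG]]] := hermitian_spectral Gh.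
have l0 i : 0 <= l 0 i.
  have := G0 (row i U); rewrite -row_mul UG.
  have -> : row i (diag_mx (map_mx rq l) *m U) = rq (l 0 i) *: row i U.
    by apply/rowP => j; rewrite mxE mul_rdiag_mxE [RHS]mxE [row _ _ _ _]mxE.
  rewrite -scalemxAl rtrZ.
  have -> : row i U *m cjmx (row i U) = 1%:M.
    have := congr1 (fun M : 'M[H]_m => M i i) U1; rewrite [RHS]mxE eqxx mulr1n => Uii.
    apply/matrixP => a b; rewrite !ord1 [RHS]mxE eqxx mulr1n -[RHS]Uii.
    by rewrite [LHS]mxE [RHS]mxE; apply: eq_bigr => k _; rewrite !cjmxE !mxE.
  by rewrite rtr11 mxE eqxx mulr1n -(rq1 H) re_rq mulr1.
exists (diag_mx (map_mx rq (\row_i Num.sqrt (l 0 i))) *m U).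
rewrite cjmxM cjmx_rdiag -mulmxA (mulmxA (diag_mx _)).
have -> : diag_mx (map_mx rq (\row_i Num.sqrt (l 0 i))) *m
    diag_mx (map_mx rq (\row_i Num.sqrt (l 0 i))) = diag_mx (map_mx rq l) :> 'M[H]_m.
  apply/matrixP => i j; rewrite mul_rdiag_mxE !mxE.
  case: eqP => [->|_]; last by rewrite !mulr0n mulr0.
  by rewrite !mulr1n -rqM -expr2 sqr_sqrtr.
by rewrite -UG mulmxA U2 mul1mx.
Qed.

(** The pairing (P, X) -> [rtr (P *m X)] is nondegenerate, as P pairs with its adjoint to [sqn P];
    equal dimensions then give every functional. *)
Lemma real_functional m n (psi : 'cV[R]_(m * n * 4)) :
  exists P : 'M[H]_(n, m), forall X : 'M[H]_(m, n),
    (mxcoord X *m psi) 0 0 = rtr (P *m X).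
Proof.
pose b i : 'M[H]_(m, n) := mxdecoord m n (delta_mx 0 i).
pose f (P : 'M[H]_(n, m)) : 'M[H]_(m, n) := mxdecoord m n (\row_i rtr (P *m b i)).
have bE (X : 'M[H]_(m, n)) : X = \sum_i rq (mxcoord X 0 i) *: b i.
  rewrite -{1}(mxcoordK X) {1}(row_sum_delta (mxcoord X)).
  elim/big_rec2: _ => [|i w u _ <-]; first by rewrite mxdecoord0.
  by rewrite mxdecoord_lin.
have rtrE P X : rtr (P *m X) = \sum_i mxcoord X 0 i * rtr (P *m b i).
  rewrite {1}(bE X) mulmx_sumr.
  elim/big_rec2: _ => [|i w u _ <-]; first by rewrite rtr0.
  by rewrite rtrD scale_realC rtrZ.
have fl : real_linear f.
  move=> x X Y; rewrite /f -mxdecoord_lin; congr mxdecoord.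
  by apply/rowP => i; rewrite !mxE mulmxDl -scalemxAl rtrD rtrZ.
have f_inj P : f P = 0 -> P = 0.
  move/(congr1 (@mxcoord _ _ _ _)); rewrite mxdecoordK mxcoord0 => /rowP fP.
  apply/eqP; rewrite -sqn_eq0 /sqn rtrE big1 // => i _.
  by have := fP i; rewrite !mxE => ->; rewrite mulr0.
have [P PE] := real_surj fl f_inj (mulnC n m) (mxdecoord m n psi^T).
exists P => X; rewrite rtrE mxE; apply: eq_bigr => i _.
have := congr1 (@mxcoord _ _ _ _) PE; rewrite !mxdecoordK => /rowP/(_ i).
by rewrite !mxE => ->.
Qed.

Variables (n N : nat).
Variables (C : 'M[H]_(n, N)) (A : 'M[H]_N) (B : 'M[H]_(N, n)) (D : 'M[H]_n).

Definition dissipation (P : 'M[H]_N) (z : 'rV[H]_N) (e : 'rV[H]_n) : R :=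
  rtr ((z *m A + e *m C) *m P *m cjmx z) + rtr ((e *m D + z *m B) *m cjmx e).

Hypothesis obs : forall x : 'cV[H]_N, (forall t, C *m A ^+ t *m x = 0) -> x = 0.
Hypothesis ctr : forall x : 'cV[H]_N,
  (forall t, cjmx B *m cjmx A ^+ t *m x = 0) -> x = 0.
Hypothesis fc : forall a z e, re a = 0 -> on_row C A a z e ->
  0 <= rtr (out_row B D z e *m cjmx e).
Hypothesis fc_oo : forall e : 'rV[H]_n, 0 <= rtr (e *m D *m cjmx e).

(* P is the Farkas multiplier of the constraint tau (Z, E) = 0. The symmetry condition
   holds because W = c W0 for a spanning family of rows W0 with tau W0 = 0, so that
   tau W is the opposite of tau at a square root of (|c|^2 - c^* c), times W0. *)
Lemma dissipation_exists :
  exists2 P : 'M[H]_N, cjmx P = P & forall z e, 0 <= dissipation P z e.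
Proof.
pose F r (Z : 'M[H]_(r, N)) (E : 'M[H]_(r, n)) := Z *m A + E *m C.
pose tau r (Z : 'M[H]_(r, N)) (E : 'M[H]_(r, n)) :=
  cjmx Z *m F r Z E + cjmx (F r Z E) *m Z.
pose mu r (Z : 'M[H]_(r, N)) (E : 'M[H]_(r, n)) :=
  2 * rtr ((E *m D + Z *m B) *m cjmx E).
(* The number of rows r is free, so stacking two families realizes the sum of their values and this
   set is a convex cone. *)
pose K a (v : 'rV[R]_(N * N * 4)) := exists r (Z : 'M[H]_(r, N)) (E : 'M[H]_(r, n)),
  a = mu r Z E /\ v = mxcoord (tau r Z E).
have FM r s (L : 'M[H]_(s, r)) Z E : F s (L *m Z) (L *m E) = L *m F r Z E.
  by rewrite /F mulmxDr !mulmxA.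
have tauM r s (L : 'M[H]_(s, r)) Z E :
    tau s (L *m Z) (L *m E) = cjmx Z *m (cjmx L *m L) *m F r Z E +
      cjmx (F r Z E) *m (cjmx L *m L) *m Z.
  by rewrite /tau FM !cjmxM !mulmxA.
have [||a [r [Z [E [-> v0]]]]
    |a _ [r [Z [E [_ ->]]]]|psi hpsi] := @farkas R _ K.
- move=> _ _ _ _ [r [Z [E [-> ->]]]] [r' [Z' [E' [-> ->]]]].
  exists (r + r')%N, (col_mx Z Z'), (col_mx E E'); split.
    rewrite /mu !mul_col_mx add_col_mx cjmx_col_mx mul_col_row -mulrDr; congr (_ * _).
    by rewrite /rtr mxtrace_block reD.
  have := mxcoord_lin 1 (tau r Z E) (tau r' Z' E').
  rewrite rq1 !scale1r => <-; congr mxcoord.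
  have FE : F _ (col_mx Z Z') (col_mx E E') = col_mx (F r Z E) (F r' Z' E').
    by rewrite /F !mul_col_mx add_col_mx.
  by rewrite [RHS]/tau FE !cjmx_col_mx !mul_row_col /tau addrACA.
- move=> t _ _ t0 [r [Z [E [-> ->]]]].
  pose L : 'M[H]_r := (rq (Num.sqrt t))%:M.
  have L2 : cjmx L *m L = (rq t)%:M.
    by rewrite cjmx_scalar cj_rq -scalar_mxM -rqM -expr2 sqr_sqrtr ?ltW.
  exists r, (L *m Z), (L *m E); split.
    rewrite /mu -!mulmxA -mulmxDr [in RHS]rtrC cjmxM -mulmxA (mulmxA (cjmx L)) L2.
    by rewrite mul_scalar_mx scale_realC rtrZ [in LHS]rtrC mulrCA.
  have := mxcoord_lin t (tau r Z E) 0; rewrite mxcoord0 !addr0 => <-.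
  by congr mxcoord; rewrite tauM L2 !mul_mx_real -!scalemxAl -scalerDr.
- have ZF : tau r Z E = 0 by rewrite -[LHS]mxcoordK -v0 mxdecoord0.
  rewrite mulr_ge0 //.
  exact: (peeling fc fc_oo).
- have [k [Z0 [E0 [p [rp pZ [T TW]]]]]] := spanning_rows obs.
  pose c := row_mx Z E *m T.
  have [cZ cE] : Z = c *m Z0 /\ E = c *m E0.
    by apply: eq_row_mx; rewrite -mul_mx_row -mulmxA TW mulmx1.
  have tau0 : tau k Z0 E0 = 0.
    rewrite /tau /F -pZ cjmxM -!mulmxA -mulmxDr -mulmxDl.
    have -> : diag_mx p + cjmx (diag_mx p) = 0.
      apply/matrixP => i j; rewrite mxE cjmxE !mxE eq_sym.
      case: eqP => [->|_]; last by rewrite !mulr0n cj0 addr0.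
      by rewrite !mulr1n addq_cj rp mulr0 rq0.
    by rewrite mul0mx mulmx0.
  pose t := sqn c.
  have [||L LE] := @psd_factor k ((rq t)%:M - cjmx c *m c).
  + by rewrite cjmxB cjmx_scalar cj_rq cjmxM cjmxK.
  + move=> v; rewrite mulmxBr mulmxBl rtrB mul_mx_real -scalemxAl rtrZ subr_ge0.
    have -> : v *m (cjmx c *m c) *m cjmx v = (v *m cjmx c) *m cjmx (v *m cjmx c).
      by rewrite cjmxM cjmxK !mulmxA.
    rewrite -/(sqn _) -/(sqn v) /t.
    rewrite -!sqr_mnorm -exprMn ler_pXn2r ?nnegrE ?mulr_ge0 ?mnorm_ge0 //.
    by rewrite mulrC -(mnorm_cjmx c) mnormM.
  exists (mu k (L *m Z0) (L *m E0)), k, (L *m Z0), (L *m E0); split=> //.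
  rewrite tauM LE.
  have -> : cjmx Z0 *m ((rq t)%:M - cjmx c *m c) *m F k Z0 E0 +
     cjmx (F k Z0 E0) *m ((rq t)%:M - cjmx c *m c) *m Z0 =
     rq t *: tau k Z0 E0 - tau r Z E.
    rewrite cZ cE tauM !mulmxBr !mulmxBl !mul_mx_real -!scalemxAl scalerDr.
    by rewrite opprD addrACA.
  rewrite tau0 scaler0 sub0r.
  have := mxcoord_lin (-1) (tau r Z E) 0.
  by rewrite mxcoord0 !addr0 rqN rq1 !scaleN1r => ->.
have [P0 P0E] := real_functional psi.
(* [tau] is Hermitian, so only the Hermitian part of P0 is seen; the factor 1/2 matches the 2 in
   [mu]. *)
pose P := rq 2^-1 *: (P0 + cjmx P0).
exists P; first by rewrite cjmxZ_real cjmxD cjmxK addrC.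
move=> z e; have := hpsi _ _ (ex_intro _ 1%N (ex_intro _ z (ex_intro _ e (conj erefl erefl)))).
rewrite P0E /tau mulmxDr rtrD.
have -> : rtr (P0 *m (cjmx (F 1 z e) *m z)) = rtr (cjmx P0 *m (cjmx z *m F 1 z e)).
  by rewrite -rtr_cjmx !cjmxM cjmxK rtrC.
rewrite -rtrD -mulmxDl rtrC -mulmxA rtrC -mulmxA /mu => h.
rewrite /dissipation /P -/(F 1 z e) scale_realC -!scalemxAl rtrZ.
rewrite -!mulmxA in h *.
lra.
Qed.

End Multiplier.

(** * From the multiplier to the matrix inequality and back *)

Section DualInequality.
Variables (R : realType) (H : qalg R) (n N : nat).
Variables (C : 'M[H]_(n, N)) (A : 'M[H]_N) (B : 'M[H]_(N, n)) (D : 'M[H]_n).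

Definition inverse_pair m (M G : 'M[H]_m) : Prop := M *m G = 1%:M /\ G *m M = 1%:M.
Definition psd m (M : 'M[H]_m) : Prop :=
  cjmx M = M /\ forall xi : 'cV[H]_m, 0 <= re ((cjmx xi *m M *m xi) 0 0).

(** The left kernel of P is A-invariant and annihilates B, hence is 0 by controllability. *)
Lemma dissipation_nonsingular P : cjmx P = P ->
  (forall z e, 0 <= dissipation C A B D P z e) ->
  (forall x : 'cV[H]_N, (forall t, cjmx B *m cjmx A ^+ t *m x = 0) -> x = 0) ->
  exists G, inverse_pair P G.
Proof.
move=> Ph P0 ctr.
have invt (x : 'rV[H]_N) : x *m P = 0 -> x *m A *m P = 0 /\ x *m B = 0.
  move=> xP; have Px : P *m cjmx x = 0 by rewrite -[P]Ph -cjmxM xP cjmx0.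
  (* Along z + t x the quadratic term disappears because P x^* = 0. An affine function of t that
     stays nonnegative has slope 0. *)
  have slope z e : rtr (x *m A *m P *m cjmx z) + rtr (x *m B *m cjmx e) = 0.
    set s := _ + _; apply/eqP/negPn/negP => s0.
    have key t : 0 <= dissipation C A B D P z e + t * s.
      have := P0 (z + rq t *: x) e; rewrite /dissipation.
      rewrite cjmxD cjmxZ_real mulmxDr scale_realC -(mulmxA _ P (cjmx x)) Px mulmx0 scaler0 addr0.
      rewrite !(mulmxDl z) -!scalemxAl.
      rewrite (addrAC _ _ (e *m C)) (addrA (e *m D)) !(mulmxDl _ (rq t *: _)) -!scalemxAl !rtrD !rtrZ.
      by rewrite (mulmxDl (_ *m P)) -scalemxAl rtrD rtrZ /s mulrDr addrACA.
    have := key (- (dissipation C A B D P z e + 1) / s).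
    by rewrite divfK // opprD addrA subrr add0r oppr_ge0 ler10.
  split.
    apply/eqP; rewrite -sqn_eq0 /sqn.
    by have := slope (x *m A *m P) 0; rewrite cjmx0 mulmx0 rtr0 addr0 => ->.
  apply/eqP; rewrite -sqn_eq0 /sqn.
  by have := slope 0 (x *m B); rewrite cjmx0 mulmx0 rtr0 add0r => ->.
have [x xP|L PL] := mx_right_inverse (M := P); last first.
  by exists L; split=> //; apply: sq_left_right.
have xt t : x *m A ^+ t *m P = 0.
  elim: t => [|t IH]; first by rewrite expr0 mulmx1.
  by rewrite exprSr -mulmxE mulmxA; have [] := invt _ IH.
apply/eqP; rewrite -cjmx_eq0; apply/eqP/ctr => t.
rewrite -cjmx_exp -!cjmxM mulmxA.
by have [_ ->] := invt _ (xt t); rewrite cjmx0.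
Qed.

(** Substituting z = x^* H and e = y^*, the form of the matrix at (x, y) becomes twice the
    dissipation; H is invertible, so all (z, e) arise. *)
Lemma lmi_dissipation (P Hm : 'M[H]_N) : cjmx Hm = Hm -> inverse_pair Hm P ->
  psd (block_mx Hm 0 0 1%:M *m block_mx A B C D +
    cjmx (block_mx A B C D) *m block_mx Hm 0 0 1%:M) <->
  (forall z e, 0 <= dissipation C A B D P z e).
Proof.
move=> Hh [HP PH]; set W := block_mx Hm 0 0 1%:M; set T := block_mx A B C D.
have Wh : cjmx W = W by rewrite cjmx_block Hh cjmx1 !cjmx0.
have E x y : re ((cjmx (col_mx x y) *m (W *m T + cjmx T *m W) *m col_mx x y) 0 0) =
    2 * dissipation C A B D P (cjmx x *m Hm) (cjmx y).
  rewrite -rtr11; set xi := col_mx x y.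
  rewrite mulmxDr mulmxDl rtrD.
  have -> : rtr (cjmx xi *m (cjmx T *m W) *m xi) = rtr (cjmx xi *m (W *m T) *m xi).
    by rewrite -rtr_cjmx !cjmxM !cjmxK Wh !mulmxA.
  rewrite -mulr2n [RHS]mulr_natl; congr (_ *+ 2).
  rewrite mulmxA -(mulmxA _ T) cjmx_col_mx mul_row_block mul_block_col.
  rewrite !mulmx0 addr0 add0r mulmx1 mul_row_col rtrD /dissipation.
  rewrite cjmxM cjmxK Hh -!mulmxA (mulmxA P) PH mul1mx.
  rewrite !mulmxDl !mulmxDr cjmxK !rtrD -!mulmxA.
  by rewrite addrACA (addrC (rtr (cjmx y *m (D *m y)))) -addrACA.
split=> [[_ M0] z e|P0].
  have := M0 (col_mx (P *m cjmx z) (cjmx e)); rewrite E pmulr_rge0 //.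
  have Ph : cjmx P = P.
    by rewrite -[LHS]mulmx1 -HP mulmxA -[Hm]Hh -cjmxM HP cjmx1 mul1mx.
  by rewrite cjmxM !cjmxK Ph -mulmxA PH mulmx1.
split; first by rewrite cjmxD !cjmxM cjmxK Wh addrC.
by move=> xi; rewrite -[xi]vsubmxK E mulr_ge0.
Qed.

(** The matrix K + Z P Z^* solves a Lyapunov equation whose right-hand side has, at c, twice the
    dissipation at (cZ, cE). So K is nonnegative on rows with cZ = 0, at most N conditions. *)
Lemma gram_psd (P : 'M[H]_N) m (p : 'rV[H]_m) (Z : 'M[H]_(m, N)) (E : 'M[H]_(m, n))
    (K : 'M[H]_m) :
  cjmx P = P -> (forall z e, 0 <= dissipation C A B D P z e) ->
  (forall i, 0 < re (p 0 i)) -> cjmx K = K ->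
  diag_mx p *m Z = Z *m A + E *m C ->
  diag_mx p *m K + K *m cjmx (diag_mx p) =
    (E *m D + Z *m B) *m cjmx E + E *m cjmx (E *m D + Z *m B) ->
  forall c : 'rV[H]_m, 0 <= rtr (c *m (K + Z *m P *m cjmx Z) *m cjmx c).
Proof.
move=> Ph P0 p0 Kh pZ pK; apply: (lyapunov p0 _ erefl).
  by rewrite cjmxD Kh !cjmxM cjmxK Ph mulmxA.
move=> c; rewrite (mulmxDr (diag_mx p)) (mulmxDl K) addrACA pK.
have -> : diag_mx p *m (Z *m P *m cjmx Z) + Z *m P *m cjmx Z *m cjmx (diag_mx p) =
    (Z *m A + E *m C) *m P *m cjmx Z + cjmx ((Z *m A + E *m C) *m P *m cjmx Z).
  by rewrite -pZ !cjmxM cjmxK Ph !mulmxA.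
have -> : E *m cjmx (E *m D + Z *m B) = cjmx ((E *m D + Z *m B) *m cjmx E).
  by rewrite cjmxM cjmxK.
set X := _ *m cjmx E; set Y := _ *m cjmx Z.
rewrite addrACA -cjmxD mulmxDr mulmxDl rtrD.
have -> : rtr (c *m cjmx (X + Y) *m cjmx c) = rtr (c *m (X + Y) *m cjmx c).
  by rewrite -rtr_cjmx !cjmxM !cjmxK mulmxA.
rewrite -mulr2n pmulrn_lge0 //.
have -> : rtr (c *m (X + Y) *m cjmx c) =
    dissipation C A B D P (c *m Z) (c *m E); last exact: P0.
rewrite /dissipation mulmxDr mulmxDl rtrD addrC; congr (_ + _).
  by rewrite /Y cjmxM -!mulmxA -!mulmxDr !mulmxA.
by rewrite /X cjmxM -!mulmxA -!mulmxDr !mulmxA.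
Qed.

End DualInequality.

(** * Kernels with finitely many negative squares *)

Lemma sum_enum_pair (V : nmodType) m n (F : 'I_m * 'I_n -> V) :
  \sum_(x < #|{: 'I_m * 'I_n}|) F (enum_val x) = \sum_k \sum_i F (k, i).
Proof.
rewrite -(big_enum_val (A := {: 'I_m * 'I_n}) (fun x => F x)) pair_big /=.
by apply: eq_big => -[].
Qed.

Section NegativeSquares.
Variables (R : realType) (H : qalg R).

(** Pairing the equation with X turns its left side into (re a + re b) |X|^2; Cauchy-Schwarz bounds
    the right side. *)
Lemma mx_sylvester_le m n (a b : H) (X Y : 'M[H]_(m, n)) :
  a *: X + X *m (cj b)%:M = Y -> (re a + re b) * mnorm X <= mnorm Y.
Proof.
move=> XY; have [->|X0] := eqVneq X 0; first by rewrite mnorm0 mulr0 mnorm_ge0.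
rewrite -(ler_pM2r (x := mnorm X)) ?mnorm_gt0 // -mulrA -expr2 sqr_mnorm.
have <- : rtr (Y *m cjmx X) = (re a + re b) * sqn X; last exact: CauchySchwarz_rtr.
rewrite -XY mulmxDl rtrD mulrDl; congr (_ + _).
  rewrite /rtr /mxtrace re_sum sqnE mulr_sumr; apply: eq_bigr => i _.
  rewrite mxE re_sum mulr_sumr; apply: eq_bigr => j _.
  by rewrite cjmxE mxE -mulrA mulcj rqC re_rqM mulrC.
rewrite rtrC /rtr /mxtrace re_sum sqnE exchange_big mulr_sumr; apply: eq_bigr => i _.
rewrite mxE re_sum mulr_sumr; apply: eq_bigr => j _.
rewrite cjmxE.
by rewrite mulmx_scalarE mulrA cjmul re_rqM re_cj mulrC.
Qed.

Lemma mx_sylvester_inj m n (a b : H) (X : 'M[H]_(m, n)) : 0 < re a -> 0 < re b ->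
  a *: X + X *m (cj b)%:M = 0 -> X = 0.
Proof.
move=> a0 b0 /mx_sylvester_le; rewrite mnorm0 pmulr_rle0 ?addr_gt0 // => h.
by apply/eqP; rewrite -mnorm_eq0 eq_le h mnorm_ge0.
Qed.

Definition gramian n (K : H -> H -> 'M[H]_n) m (u : 'I_m -> H)
    (xi : 'I_m -> 'cV[H]_n) : 'M[H]_m :=
  \matrix_(k, j) (cjmx (xi k) *m K (u k) (u j) *m xi j) 0 0.

Definition neg_squares n (Om : set H) (K : H -> H -> 'M[H]_n)
    (kappa : nat) : Prop :=
  [/\ forall u v, Om u -> Om v -> K u v = cjmx (K v u),
      forall m (u : 'I_m -> H) (xi : 'I_m -> 'cV[H]_n), (forall k, Om (u k)) ->
        neg_le (gramian K u xi) kappa &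
      exists m (u : 'I_m -> H) (xi : 'I_m -> 'cV[H]_n),
        [/\ forall k, Om (u k), neg_le (gramian K u xi) kappa &
            neg_ge (gramian K u xi) kappa]].

Lemma gram_herm n (Om : set H) (K : H -> H -> 'M[H]_n) m (u : 'I_m -> H) xi :
  (forall u v, Om u -> Om v -> K u v = cjmx (K v u)) -> (forall k, Om (u k)) ->
  cjmx (gramian K u xi) = gramian K u xi.
Proof.
move=> Kh Omu; apply/matrixP => i j.
by rewrite cjmxE [gramian _ _ _ _ _]mxE [RHS]mxE -cjmxE !cjmxM cjmxK -Kh // mulmxA.
Qed.

Definition near0 (P : R -> Prop) := exists2 d : R, 0 < d & forall e, 0 < e -> e < d -> P e.

Lemma near0_and P Q : near0 P -> near0 Q -> near0 (fun e => P e /\ Q e).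
Proof.
move=> [d d0 hP] [d' d'0 hQ]; exists (Num.min d d'); first by rewrite lt_min d0.
by move=> e e0; rewrite lt_min => /andP[ed ed']; split; [exact: hP|exact: hQ].
Qed.

Lemma near0_forall m (P : 'I_m -> R -> Prop) :
  (forall i, near0 (P i)) -> near0 (fun e => forall i, P i e).
Proof.
elim: m P => [|m IH] P hP; first by exists 1 => // e _ _ [].
have [d d0 hd] := near0_and (hP ord0) (IH _ (fun i => hP (lift ord0 i))).
exists d => // e e0 ed i; have [h0 h1] := hd e e0 ed.
by case: (unliftP ord0 i) => [j ->|->].
Qed.

Lemma near0_ex P : near0 P -> exists2 e, 0 < e & P e.
Proof. by case=> d d0 h; exists (d / 2); [lra|apply: h; lra]. Qed.

Variables (n N : nat).
Variables (C : 'M[H]_(n, N)) (A : 'M[H]_N) (B : 'M[H]_(N, n)) (D : 'M[H]_n).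
Variables (q : {poly R}) (Om : set H) (phi : H -> 'M[H]_n) (K : H -> H -> 'M[H]_n).
Hypothesis q0 : q != 0.
Hypothesis Om_re : forall p, Om p -> 0 < re p.
Hypothesis Om_generic : forall p, 0 < re p -> evalq q p != 0 -> Om p.
Hypothesis phiE : forall p, evalq q p != 0 ->
  exists Z : 'M[H]_(n, N), p *: Z - Z *m A = C /\ phi p = D + Z *m B.
Hypothesis row_uniq : forall a (z : 'rV[H]_N),
  evalq q a != 0 -> a *: z = z *m A -> z = 0.
Hypothesis phi_cont : forall p, Om p -> forall eta, 0 < eta ->
  near0 (fun e => Om (p + rq e) /\ mnorm (phi (p + rq e) - phi p) < eta).
Hypothesis K_eq : forall p r, Om p -> Om r ->
  p *: K p r + K p r *m (cj r)%:M = phi p + cjmx (phi r).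
Hypothesis obs : forall x : 'cV[H]_N, (forall t, C *m A ^+ t *m x = 0) -> x = 0.
Hypothesis ctr : forall x : 'cV[H]_N,
  (forall t, cjmx B *m cjmx A ^+ t *m x = 0) -> x = 0.

(** K u v and the adjoint of K v u solve the same Sylvester equation. *)
Lemma kernel_herm u v : Om u -> Om v -> K u v = cjmx (K v u).
Proof.
move=> Ou Ov; apply/eqP; rewrite -subr_eq0; apply/eqP.
apply: (mx_sylvester_inj (Om_re Ou) (Om_re Ov)).
have := congr1 (@cjmx _ _ _ _) (K_eq Ov Ou).
rewrite !cjmxD cjmxZ cjmxM cjmx_scalar !cjK cjmxK mul_scalar_mx => E.
rewrite scalerBr mulmxBl addrACA K_eq // -opprD [X in _ - X]addrC E.
by rewrite [X in _ - X]addrC subrr.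
Qed.

(* At a quaternionic row e, the row function e D + z B with a z - z A = e C is not
   e (phi a): each entry of e moves the point inside its sphere. *)
Lemma split_point a z (e : 'rV[H]_n) : 0 < re a -> evalq q a != 0 -> on_row C A a z e ->
  exists p : 'I_n -> H,
    (forall i, [/\ 0 < re (p i), evalq q (p i) != 0 & a * e 0 i = e 0 i * p i]) /\
    out_row B D z e = \sum_i e 0 i *: row i (phi (p i)).
Proof.
move=> a0 qa hz.
have /choice[p hp] : forall i : 'I_n, exists x,
    [/\ 0 < re x, evalq q x != 0 & a * e 0 i = e 0 i * x].
  move=> i; have [->|ei] := eqVneq (e 0 i) 0.
    by exists a; rewrite mulr0 mul0r.
  exists ((e 0 i)^-1 * a * e 0 i); rewrite re_conjg // evalq_conjg //; split=> //.
    rewrite !qmulf_eq0 !negb_or ei qa !andbT.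
    by apply/eqP => e0; have := qmulqV ei; rewrite e0 mulr0 => /esym/eqP; rewrite oner_eq0.
  by rewrite !mulrA qmulqV // mul1r.
exists p; split=> //.
have /choice[Z hZ] : forall i : 'I_n, exists Z : 'M[H]_(n, N),
    p i *: Z - Z *m A = C /\ phi (p i) = D + Z *m B.
  by move=> i; apply: phiE; have [] := hp i.
(* Both sides solve the row equation at a, since a e_i = e_i p_i for each i, and a is generic. *)
have zE : z = \sum_i e 0 i *: row i (Z i).
  apply/eqP; rewrite -subr_eq0; apply/eqP; apply: (row_uniq qa).
  apply/eqP; rewrite -subr_eq0 scalerBr mulmxBl opprD addrACA hz -opprD subr_eq0.
  rewrite scaler_sumr mulmx_suml -sumrB; apply/eqP.
  rewrite -[LHS]/(e *m C) mulmx_sum_row; apply: eq_bigr => i _.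
  have [ZC _] := hZ i; have [_ _ ae] := hp i.
  rewrite -{1}ZC !linearB /= scalerBr row_mul -scalemxAl; congr (_ - _).
  by rewrite linearZ /= !scalerA ae.
rewrite /out_row zE mulmx_suml (mulmx_sum_row e) -big_split.
apply: eq_bigr => i _ /=; have [_ ->] := hZ i.
by rewrite raddfD /= row_mul -scalemxAl scalerDr.
Qed.

(** Each row is split into n entries at n points. Q is a compression of the (kappa + 1) n Gram
    matrix at these points, so Q negative definite would force kappa + 1 negative eigenvalues
    there. *)
Lemma few_negative_rows kappa : neg_squares Om K kappa ->
  forall (a : 'I_kappa.+1 -> H) z e (Q : 'M[H]_kappa.+1),
  (forall j, 0 < re (a j)) -> (forall j, evalq q (a j) != 0) ->
  (forall j, on_row C A (a j) (z j) (e j)) ->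
  (forall j l, a j * Q j l + Q j l * cj (a l) = kernel_rhs B D (z j) (e j) (z l) (e l)) ->
  exists2 c : 'rV[H]_kappa.+1, c != 0 & 0 <= rtr (c *m Q *m cjmx c).
Proof.
move=> [_ Kle _] a z e Q a0 qa hz QE; apply: contrapT => nex.
have neg (c : 'rV[H]_kappa.+1) : c != 0 -> rtr (c *m Q *m cjmx c) < 0.
  by move=> c0; rewrite ltNge; apply/negP => h; apply: nex; exists c.
have /choice[p hp] := fun j => split_point (a0 j) (qa j) (hz j).
pose f := fun x : 'I_#|{: 'I_kappa.+1 * 'I_n}| => enum_val x.
pose u x := p (f x).1 (f x).2.
pose xi x : 'cV[H]_n := delta_mx (f x).2 0 *m (cj (e (f x).1 0 (f x).2))%:M.
have Ou x : Om (u x).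
  by have [h _] := hp (f x).1; have [r0 qr _] := h (f x).2; exact: Om_generic.
pose g (s t : 'I_kappa.+1 * 'I_n) :=
  e s.1 0 s.2 * K (p s.1 s.2) (p t.1 t.2) s.2 t.2 * cj (e t.1 0 t.2).
have GE x y : gramian K u xi x y = g (f x) (f y).
  rewrite mxE /xi cjmxM cjmx_scalar cjK.
  have -> : cjmx (delta_mx (f x).2 0) = delta_mx 0 (f x).2 :> 'rV[H]_n.
    apply/matrixP => i j; rewrite cjmxE !mxE andbC.
    by case: (_ && _); rewrite ?cj0 ?cj1.
  rewrite -!mulmxA (mulmxA (delta_mx 0 _)) -rowE mul_scalar_mx mulmxA -colE.
  rewrite mxE /g -mulrA; congr (_ * _).
  by rewrite mxE big_ord1 !mxE eqxx mulr1n.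
(* [Psi] adds up the n points of each row; the compression equals Q by uniqueness for the Sylvester
   equation, entry by entry. *)
pose Psi : 'M[H]_(kappa.+1, #|{: 'I_kappa.+1 * 'I_n}|) :=
  \matrix_(j, x) ((f x).1 == j)%:R.
have sumPsi (F : 'I_kappa.+1 * 'I_n -> H) j :
    \sum_x Psi j x * F (f x) = \sum_i F (j, i).
  under eq_bigr do rewrite mxE.
  rewrite (sum_enum_pair (fun s => (s.1 == j)%:R * F s)) /= (bigD1 j) //=.
  rewrite [X in _ + X]big1 => [|k kj]; last first.
    by rewrite big1 // => i _; rewrite (negbTE kj) mul0r.
  by rewrite addr0; apply: eq_bigr => i _; rewrite eqxx mul1r.
have PsiC j x : cj (Psi j x) = Psi j x.
  by rewrite mxE; case: (_ == _); rewrite ?cj1 ?cj0.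
have GQ : Psi *m gramian K u xi *m cjmx Psi = Q.
  apply/matrixP => j l.
  have -> : (Psi *m gramian K u xi *m cjmx Psi) j l = \sum_i' \sum_i g (j, i) (l, i').
    rewrite mxE; under eq_bigr => y _.
      rewrite mxE; under eq_bigr do rewrite GE.
      rewrite (sumPsi (fun s => g s (f y))) cjmxE PsiC.
      rewrite (_ : _ * _ = Psi l y * \sum_i g (j, i) (f y)); first over.
      by rewrite mxE; case: (_ == _); rewrite ?(mulr0, mul0r, mulr1, mul1r).
    exact: (sumPsi (fun t => \sum_i g (j, i) t)).
  apply/eqP; rewrite -subr_eq0; apply/eqP.
  apply: (sylvester_inj (a0 j) (a0 l)).
  rewrite mulrBr mulrBl addrACA -opprD QE; apply/eqP; rewrite subr_eq0; apply/eqP.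
  have [hpj vj] := hp j; have [hpl vl] := hp l.
  rewrite /kernel_rhs vj vl mxE.
  have -> : ((\sum_i e j 0 i *: row i (phi (p j i))) *m cjmx (e l)) 0 0 =
      \sum_i' \sum_i e j 0 i * phi (p j i) i i' * cj (e l 0 i').
    rewrite mxE; apply: eq_bigr => i' _; rewrite summxE mulr_suml.
    by apply: eq_bigr => i _; rewrite !mxE.
  have -> : (e j *m cjmx (\sum_i e l 0 i *: row i (phi (p l i)))) 0 0 =
      \sum_i' \sum_i e j 0 i * cj (phi (p l i') i' i) * cj (e l 0 i').
    rewrite mxE exchange_big; apply: eq_bigr => i _; rewrite cjmxE summxE cj_sum mulr_sumr.
    by apply: eq_bigr => i' _; rewrite !mxE cjM mulrA.
  rewrite mulr_sumr mulr_suml -!big_split; apply: eq_bigr => i' _ /=.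
  rewrite mulr_sumr mulr_suml -!big_split; apply: eq_bigr => i _ /=.
  have [r1 q1 ae1] := hpj i; have [r2 q2 ae2] := hpl i'.
  have := congr1 (fun M : 'M[H]_n => M i i')
    (K_eq (Om_generic r1 q1) (Om_generic r2 q2)).
  rewrite /g /= [LHS]mxE [X in X + _ = _]mxE [RHS]mxE cjmxE => E.
  rewrite mulmx_scalarE in E; rewrite !mulrA ae1 -mulrA -(mulrA _ (cj (e l 0 i'))) -cjM ae2 cjM.
  by rewrite -mulrDl -mulrDr -E mulrDr mulrDl !mulrA.
have Gh := gram_herm xi kernel_herm Ou.
have [|k rk] := neg_count_lower (Y := Psi) Gh; first by rewrite GQ.
by move/(Kle _ u xi Ou); rewrite leqNgt rk.
Qed.

End NegativeSquares.

(** * Counting negative squares from the multiplier *)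

Section FiniteNegativeSquares.
Variables (R : realType) (H : qalg R).
Variables (n N : nat).
Variables (C : 'M[H]_(n, N)) (A : 'M[H]_N) (B : 'M[H]_(N, n)) (D : 'M[H]_n).
Variables (q : {poly R}) (Om : set H) (phi : H -> 'M[H]_n) (K : H -> H -> 'M[H]_n).
Hypothesis q0 : q != 0.
Hypothesis Om_re : forall p, Om p -> 0 < re p.
Hypothesis Om_generic : forall p, 0 < re p -> evalq q p != 0 -> Om p.
Hypothesis phiE : forall p, evalq q p != 0 ->
  exists Z : 'M[H]_(n, N), p *: Z - Z *m A = C /\ phi p = D + Z *m B.
Hypothesis row_uniq : forall a (z : 'rV[H]_N),
  evalq q a != 0 -> a *: z = z *m A -> z = 0.
Hypothesis phi_cont : forall p, Om p -> forall eta, 0 < eta ->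
  near0 (fun e => Om (p + rq e) /\ mnorm (phi (p + rq e) - phi p) < eta).
Hypothesis K_eq : forall p r, Om p -> Om r ->
  p *: K p r + K p r *m (cj r)%:M = phi p + cjmx (phi r).
Hypothesis obs : forall x : 'cV[H]_N, (forall t, C *m A ^+ t *m x = 0) -> x = 0.
Hypothesis ctr : forall x : 'cV[H]_N,
  (forall t, cjmx B *m cjmx A ^+ t *m x = 0) -> x = 0.

Let Kherm := kernel_herm Om_re K_eq.

(** The increment of K solves the Sylvester equation with right-hand side the increments of phi
    minus 2e K(p, r), which is small. *)
Lemma kernel_cont p r : Om p -> Om r -> forall eta, 0 < eta ->
  near0 (fun e => [/\ Om (p + rq e), Om (r + rq e) &
    mnorm (K (p + rq e) (r + rq e) - K p r) < eta]).
Proof.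
move=> Op Or eta eta0; have a0 : 0 < re p + re r by rewrite addr_gt0 ?Om_re.
set a := re p + re r in a0; pose eta1 := eta * a / 4.
have eta10 : 0 < eta1 by rewrite divr_gt0 ?mulr_gt0.
have [d d0 hd] := near0_and (phi_cont Op eta10) (phi_cont Or eta10).
pose k := mnorm (K p r); have k0 : 0 <= k by exact: mnorm_ge0.
pose d' := eta1 / (k + 1).
have d'0 : 0 < d' by rewrite divr_gt0 // ltr_wpDl.
exists (Num.min d d'); first by rewrite lt_min d0.
move=> e e0; rewrite lt_min => /andP[ed ed'].
have [[Ope hp] [Ore hr]] := hd e e0 ed; split=> //.
set X := _ - K p r; set dp := phi _ - phi p in hp; set dr := phi _ - phi r in hr.
have XE : (p + rq e) *: X + X *m (cj (r + rq e))%:M =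
    dp + cjmx dr - (rq (2 * e) *: K p r).
  rewrite /X scalerBr mulmxBl addrACA K_eq // -opprD.
  have -> : (cj (r + rq e))%:M = (cj r)%:M + (rq e)%:M :> 'M[H]_n.
    by rewrite cjD cj_rq raddfD.
  rewrite scalerDl mulmxDr mul_mx_real addrACA K_eq // -scalerDl -rqD.
  have -> : 2 * e = e + e by ring.
  by rewrite /dp /dr cjmxB opprD addrA opprD [X in X - _ = _]addrACA.
have := mx_sylvester_le XE.
rewrite !reD !re_rq => h1.
have h2 := mnormB (dp + cjmx dr) (rq (2 * e) *: K p r).
have h3 := mnormD dp (cjmx dr).
rewrite mnormZ nq_rq ger0_norm ?mulr_ge0 ?(ltW e0) // -/k in h2; rewrite mnorm_cjmx in h3.
have h4 : e * (k + 1) < eta1 by rewrite -ltr_pdivlMr // ltr_wpDl.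
have h5 : a * mnorm X <= (re p + e + (re r + e)) * mnorm X.
  by rewrite ler_wpM2r ?mnorm_ge0 // /a; lra.
have h6 : a * mnorm X < a * eta.
  have -> : a * eta = eta1 + eta1 + 2 * eta1 by rewrite /eta1; field.
  by lra.
by rewrite ltr_pM2l in h6.
Qed.

Lemma gram_cont m (u : 'I_m -> H) (xi : 'I_m -> 'cV[H]_n) : (forall k, Om (u k)) ->
  forall eta, 0 < eta -> near0 (fun e => (forall k, Om (u k + rq e)) /\
    mnorm (gramian K (fun k => u k + rq e) xi - gramian K u xi) < eta).
Proof.
move=> Ou eta eta0; pose b := eta / (m%:R + 1).
have m1 : 0 < m%:R + 1 :> R by rewrite ltr_wpDl.
have b0 : 0 < b by rewrite divr_gt0.
pose x k j := mnorm (xi k) * mnorm (xi j) + 1.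
have x0 k j : 0 < x k j by rewrite ltr_wpDl ?mulr_ge0 ?mnorm_ge0.
have near_entry k j : near0 (fun e => [/\ Om (u k + rq e), Om (u j + rq e) &
    mnorm (K (u k + rq e) (u j + rq e) - K (u k) (u j)) < b / x k j]).
  by apply: kernel_cont => //; rewrite divr_gt0.
have [d d0 hd] := near0_forall (fun k => near0_forall (near_entry k)).
exists d => // e e0 ed; have h := hd e e0 ed; split.
  by move=> k; have [] := h k k.
apply: le_lt_trans (_ : m%:R * b < _); last first.
  rewrite /b mulrCA -[X in _ < X]mulr1 ltr_pM2l // ltr_pdivrMr // mul1r ltrDl //.
apply: mnorm_le_entries; first exact: ltW.
move=> k j; have [_ _] := h k j; set dK := _ - K (u k) (u j) => dKb.
have -> : (gramian K (fun k => u k + rq e) xi - gramian K u xi) k j =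
    (cjmx (xi k) *m dK *m xi j) 0 0.
  by rewrite mxE [X in _ + X]mxE !(mxE (matrix_key)) mulmxBr mulmxBl [RHS]mxE [X in _ = _ + X]mxE.
rewrite -mnorm11; apply: le_trans (mnormM _ _) _.
apply: le_trans (ler_wpM2r (mnorm_ge0 _) (mnormM _ _)) _.
rewrite mnorm_cjmx mulrAC; apply: le_trans (ler_wpM2l _ (ltW dKb)) _.
  by rewrite mulr_ge0 ?mnorm_ge0.
by rewrite mulrCA ler_piMr ?(ltW b0) // ler_pdivrMr // mul1r /x lerDl.
Qed.

Variable P : 'M[H]_N.
Hypothesis Ph : cjmx P = P.
Hypothesis P0 : forall z e, 0 <= dissipation C A B D P z e.

(** The Lyapunov argument needs a diagonal multiplier, so the kernel is expanded into the scalar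
    matrix [Kb] over pairs (point, coordinate), and the vectors xi are restored by the compression
    [Xi]. *)
Lemma gram_generic m (u : 'I_m -> H) (xi : 'I_m -> 'cV[H]_n) :
  (forall k, Om (u k)) -> (forall k, evalq q (u k) != 0) ->
  exists Z : 'M[H]_(m, N), forall c : 'rV[H]_m,
    c *m Z = 0 -> 0 <= rtr (c *m gramian K u xi *m cjmx c).
Proof.
move=> Ou qu; have /choice[Z hZ] := fun k => phiE (qu k).
pose f := fun x : 'I_#|{: 'I_m * 'I_n}| => enum_val x.
pose p : 'rV[H]_#|{: 'I_m * 'I_n}| := \row_x u (f x).1.
pose Zs : 'M[H]_(#|{: 'I_m * 'I_n}|, N) := \matrix_x row (f x).2 (Z (f x).1).
pose E : 'M[H]_(#|{: 'I_m * 'I_n}|, n) := \matrix_x delta_mx 0 (f x).2.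
pose Kb : 'M[H]_(#|{: 'I_m * 'I_n}|) :=
  \matrix_(x, y) K (u (f x).1) (u (f y).1) (f x).2 (f y).2.
have Kbh : cjmx Kb = Kb.
  apply/matrixP => x y; rewrite cjmxE [Kb _ _]mxE [RHS]mxE [in RHS]Kherm ?Ou //.
  by rewrite cjmxE.
have pZ : diag_mx p *m Zs = Zs *m A + E *m C.
  apply/row_matrixP => x; rewrite raddfD /= !row_mul !rowK -rowE.
  have -> : row x (diag_mx p) = p 0 x *: delta_mx 0 x by rewrite row_diag_mx.
  rewrite -scalemxAl -rowE rowK mxE.
  by have [<- _] := hZ (f x).1; rewrite raddfB /= row_mul addrC subrK linearZ.
have outE x : row x (E *m D + Zs *m B) = row (f x).2 (phi (u (f x).1)).
  rewrite raddfD /= !row_mul !rowK -rowE.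
  by have [_ ->] := hZ (f x).1; rewrite raddfD /= row_mul.
have pK : diag_mx p *m Kb + Kb *m cjmx (diag_mx p) =
    (E *m D + Zs *m B) *m cjmx E + E *m cjmx (E *m D + Zs *m B).
  have XE x y : ((E *m D + Zs *m B) *m cjmx E) x y = phi (u (f x).1) (f x).2 (f y).2.
    have -> : ((E *m D + Zs *m B) *m cjmx E) x y =
        (row x (E *m D + Zs *m B) *m cjmx (row y E)) 0 0.
      by rewrite mxE [RHS]mxE; apply: eq_bigr => k _; rewrite !cjmxE [X in _ = X * _]mxE [X in _ = _ * cj X]mxE.
    rewrite outE rowK.
    have -> : cjmx (delta_mx 0 (f y).2) = delta_mx (f y).2 0 :> 'cV[H]_n.
      apply/matrixP => i j; rewrite cjmxE !mxE andbC.
      by case: (_ && _); rewrite ?cj0 ?cj1.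
    by rewrite -colE !mxE.
  have -> : E *m cjmx (E *m D + Zs *m B) = cjmx ((E *m D + Zs *m B) *m cjmx E).
    by rewrite cjmxM cjmxK.
  apply/matrixP => x y; rewrite mxE mul_diag_mx [X in X + _]mxE [p _ _]mxE [RHS]mxE cjmxE !XE.
  have -> : (Kb *m cjmx (diag_mx p)) x y = Kb x y * cj (u (f y).1).
    rewrite mxE (bigD1 y) //= cjmxE [diag_mx _ _ _]mxE eqxx mulr1n big1 ?addr0 => [|k ky].
      by rewrite [p _ _]mxE.
    by rewrite cjmxE [diag_mx _ _ _]mxE eq_sym (negbTE ky) mulr0n cj0 mulr0.
  have := congr1 (fun M : 'M[H]_n => M (f x).2 (f y).2) (K_eq (Ou (f x).1) (Ou (f y).1)).
  rewrite [LHS]mxE [X in X + _ = _]mxE [RHS]mxE cjmxE => <-.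
  by rewrite [Kb x y]mxE mulmx_scalarE.
have psdK := gram_psd Ph P0 _ Kbh pZ pK.
pose Xi : 'M[H]_(m, #|{: 'I_m * 'I_n}|) :=
  \matrix_(k, x) (if (f x).1 == k then cj (xi k (f x).2 0) else 0).
have GE : gramian K u xi = Xi *m Kb *m cjmx Xi.
  apply/matrixP => k j.
  have sumXi (F : 'I_m * 'I_n -> H) l :
      \sum_x Xi l x * F (f x) = \sum_i cj (xi l i 0) * F (l, i).
    under eq_bigr do rewrite mxE.
    rewrite (sum_enum_pair (fun s => (if s.1 == l then cj (xi l s.2 0) else 0) * F s)).
    rewrite (bigD1 l) //= [X in _ + X]big1 => [|k' kj]; last first.
      by rewrite big1 // => i _; rewrite (negbTE kj) mul0r.
    by rewrite addr0; apply: eq_bigr => i _; rewrite eqxx.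
  have sumXiC (F : 'I_m * 'I_n -> H) l :
      \sum_x F (f x) * cj (Xi l x) = \sum_i F (l, i) * xi l i 0.
    apply: (can_inj (@cjK _ _)); rewrite !cj_sum.
    under eq_bigr do rewrite cjM cjK.
    rewrite (sumXi (fun s => cj (F s))); apply: eq_bigr => i _.
    by rewrite cjM.
  rewrite [RHS]mxE; under [RHS]eq_bigr => y _.
    rewrite mxE; under eq_bigr do rewrite [Kb _ _]mxE.
    rewrite (sumXi (fun s => K (u s.1) (u (f y).1) s.2 (f y).2)) cjmxE /=; over.
  rewrite (sumXiC (fun t => \sum_i cj (xi k i 0) * K (u k) (u t.1) i t.2)) /=.
  by rewrite mxE mxE; apply: eq_bigr => i' _; rewrite mxE; congr (_ * _);
     apply: eq_bigr => i _; rewrite cjmxE.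
exists (Xi *m Zs) => c cZ.
have -> : c *m gramian K u xi *m cjmx c =
    (c *m Xi) *m (Kb + Zs *m P *m cjmx Zs) *m cjmx (c *m Xi).
  rewrite GE mulmxDr mulmxDl !mulmxA -(mulmxA c Xi Zs) cZ !mul0mx addr0.
  by rewrite cjmxM !mulmxA.
by apply: psdK => x; rewrite mxE Om_re.
Qed.

Lemma finitely_many_negative_squares : exists kappa, neg_squares Om K kappa.
Proof.
have Kle m (u : 'I_m -> H) (xi : 'I_m -> 'cV[H]_n) : (forall k, Om (u k)) ->
    neg_le (gramian K u xi) N.
  move=> Ou; apply: (neg_count_upper (gram_herm xi Kherm Ou)) => eta eta0.
  (* Some u k may be a zero of [q]; one small real translation makes all points generic at once. *)
  have [d d0 hd] := near0_and (gram_cont xi Ou eta0)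
    (evalq_neq0_near_fin u q0 : near0 (fun e => forall i, evalq q (u i + rq e) != 0)).
  have [e e0 [[Oue Ge] qe]] := near0_ex (ex_intro2 _ _ d d0 hd).
  have [Z hZ] := gram_generic xi Oue qe.
  by exists (gramian K (fun k => u k + rq e) xi), Z.
pose good k := exists m (u : 'I_m -> H) (xi : 'I_m -> 'cV[H]_n),
  (forall k, Om (u k)) /\ neg_ge (gramian K u xi) k.
have good0 : exists k, `[< good k >].
  exists 0%N; apply/asboolP; exists 0%N, (fun=> 0), (fun=> 0); split; first by case.
  exists 0, 0; split=> [c _||]; first exact: flatmx0.
    by case.
  by rewrite !thinmx0.
have goodN k : `[< good k >] -> (k <= N)%N.
  by move=> /asboolP[m [u [xi [Ou /(Kle _ _ _ Ou)]]]].
(* kappa is the largest number of negative eigenvalues attained by a Gram matrix, which exists since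
   N bounds them all. *)
case: (ex_maxnP good0 goodN) => kappa /asboolP[m [u [xi [Ou Gk]]]] kmax.
exists kappa; split=> [|m' u' xi' Ou' k Gk'|]; first exact: Kherm.
  by apply: kmax; apply/asboolP; exists m', u', xi'.
exists m, u, xi; split=> // k Gk'.
by apply: kmax; apply/asboolP; exists m, u, xi.
Qed.

End FiniteNegativeSquares.

Section MainTheorem.
Variables (R : realType) (H : qalg R).
Variables (n N : nat).
Variables (C : 'M[H]_(n, N)) (A : 'M[H]_N) (B : 'M[H]_(N, n)) (D : 'M[H]_n).
Variables (q : {poly R}) (Om : set H) (phi : H -> 'M[H]_n) (K : H -> H -> 'M[H]_n).
Hypothesis q0 : q != 0.
Hypothesis Om_re : forall p, Om p -> 0 < re p.
Hypothesis Om_generic : forall p, 0 < re p -> evalq q p != 0 -> Om p.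
Hypothesis phiE : forall p, evalq q p != 0 ->
  exists Z : 'M[H]_(n, N), p *: Z - Z *m A = C /\ phi p = D + Z *m B.
Hypothesis row_uniq : forall a (z : 'rV[H]_N),
  evalq q a != 0 -> a *: z = z *m A -> z = 0.
Hypothesis phi_cont : forall p, Om p -> forall eta, 0 < eta ->
  near0 (fun e => Om (p + rq e) /\ mnorm (phi (p + rq e) - phi p) < eta).
Hypothesis K_eq : forall p r, Om p -> Om r ->
  p *: K p r + K p r *m (cj r)%:M = phi p + cjmx (phi r).
Hypothesis obs : forall x : 'cV[H]_N, (forall t, C *m A ^+ t *m x = 0) -> x = 0.
Hypothesis ctr : forall x : 'cV[H]_N,
  (forall t, cjmx B *m cjmx A ^+ t *m x = 0) -> x = 0.

Theorem negative_squares_iff_lmi :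
  (exists kappa, neg_squares Om K kappa) <->
  (exists Hm : 'M[H]_N, [/\ cjmx Hm = Hm, exists G, inverse_pair Hm G &
     psd (block_mx Hm 0 0 1%:M *m block_mx A B C D +
       cjmx (block_mx A B C D) *m block_mx Hm 0 0 1%:M)]).
Proof.
split=> [[kappa Kk]|[Hm [Hh [P HP] lmi]]].
  have few := few_negative_rows Om_re Om_generic phiE row_uniq K_eq Kk.
  have fc := frequency_condition obs q0 few.
  have fc_oo := frequency_condition_oo obs q0 few.
  have [P Ph P0] := dissipation_exists obs fc fc_oo.
  have [Hm [PH HP]] := dissipation_nonsingular Ph P0 ctr.
  have Hh : cjmx Hm = Hm.
    by rewrite -[LHS]mulmx1 -PH mulmxA -[P in cjmx Hm *m P]Ph -cjmxM PH cjmx1 mul1mx.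
  exists Hm; split=> //; first by exists P.
  by apply/(lmi_dissipation _ _ _ _ Hh (conj HP PH)).
have P0 := (lmi_dissipation C A B D Hh HP).1 lmi.
have Ph : cjmx P = P.
  by case: HP => HP PH; rewrite -[LHS]mulmx1 -HP mulmxA -[Hm]Hh -cjmxM HP cjmx1 mul1mx.
exact: (finitely_many_negative_squares q0 Om_re phiE phi_cont K_eq Ph P0).
Qed.

End MainTheorem.

(** * Slice hyperholomorphic kernels *)

Section Quaternions.
Variable R : realType.
Local Notation HH := (quat R).

Lemma realqD (x y : R) : (x + y)%:q = x%:q + y%:q :> HH.
Proof. by congr Quat => /=; rewrite addr0. Qed.
Lemma realqM (x y : R) : (x * y)%:q = x%:q * y%:q :> HH.
Proof. by congr Quat => /=; ring. Qed.
Lemma realqC (x : R) (p : HH) : p * x%:q = x%:q * p.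
Proof. by congr Quat => /=; ring. Qed.
Lemma qreD (p q : HH) : qre (p + q) = qre p + qre q. Proof. by []. Qed.
Lemma qreC (p q : HH) : qre (p * q) = qre (q * p).
Proof. by rewrite /=; ring. Qed.
Lemma qre_realM (x : R) (p : HH) : qre (x%:q * p) = x * qre p.
Proof. by rewrite /=; ring. Qed.
Lemma qconjK : involutive (@qconj R).
Proof. by case=> a b c d; rewrite /qconj /= !opprK. Qed.
Lemma qconjD : {morph @qconj R : p q / p + q}.
Proof. by move=> p q; congr Quat => /=; rewrite ?opprD. Qed.
Lemma qconjM (p q : HH) : qconj (p * q) = qconj q * qconj p.
Proof. by congr Quat => /=; ring. Qed.
Lemma addq_conj (p : HH) : p + qconj p = (2 * qre p)%:q.
Proof. by congr Quat => /=; ring. Qed.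
Lemma qre_mul_conj (p : HH) : qre (p * qconj p) = qnorm2 p.
Proof. by rewrite /qnorm2 /=; ring. Qed.
Lemma mulq_conj (p : HH) : p * qconj p = (qre (p * qconj p))%:q.
Proof. by congr Quat => /=; ring. Qed.
Lemma qnorm2_gt0 (p : HH) : p != 0 -> 0 < qre (p * qconj p).
Proof.
move=> p0; rewrite qre_mul_conj lt_def qnorm2_eq0 p0 /qnorm2.
by rewrite !addr_ge0 ?sqr_ge0.
Qed.

Definition quat_coord (p : HH) : 'rV[R]_4 :=
  \row_(i < 4) [:: qre p; qi p; qj p; qk p]`_i.
Definition quat_decoord (v : 'rV[R]_4) : HH :=
  Quat (v 0 0) (v 0 (inord 1)) (v 0 (inord 2)) (v 0 (inord 3)).
Lemma quat_coordK : cancel quat_coord quat_decoord.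
Proof. by case=> a b c d; rewrite /quat_decoord !mxE !inordK. Qed.
Lemma quat_decoordK : cancel quat_decoord quat_coord.
Proof.
move=> v; apply/rowP => -[[|[|[|[|//]]]] i4]; rewrite mxE /=; congr (v 0 _);
  by apply/val_inj; rewrite /= ?inordK.
Qed.
Lemma quat_coordD : {morph quat_coord : p q / p + q}.
Proof. by move=> p q; apply/rowP => -[[|[|[|[|//]]]] i4]; rewrite !mxE. Qed.
Lemma quat_coordZ (x : R) p : quat_coord (x%:q * p) = x *: quat_coord p.
Proof. by apply/rowP => -[[|[|[|[|//]]]] i4]; rewrite !mxE /=; ring. Qed.
Lemma quat_coord_le p i : quat_coord p 0 i ^+ 2 <= qre (p * qconj p).
Proof.
rewrite qre_mul_conj /qnorm2 mxE.
have h1 := sqr_ge0 (qre p); have h2 := sqr_ge0 (qi p).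
have h3 := sqr_ge0 (qj p); have h4 := sqr_ge0 (qk p).
by case: i => -[|[|[|[|//]]]] i4 /=; lra.
Qed.

Lemma imag_unit_sqr (I : HH) : imag_unit I -> I * I = -1.
Proof.
move=> [I0 I1]; have : qnorm2 I = 1.
  rewrite -[1](expr1n _ 2) -I1 sqr_sqrtr // /qnorm2 !addr_ge0 ?sqr_ge0 //.
case: I I0 {I1} => a b c d /= ->; rewrite /qnorm2 /= expr0n /= add0r => n1.
apply: (etrans (y := Quat (- (b ^+ 2 + c ^+ 2 + d ^+ 2)) 0 0 0)).
  by congr Quat => /=; ring.
by rewrite n1; congr Quat; rewrite oppr0.
Qed.

Lemma qdirP (p : HH) : imag_unit (qdir p) /\
  p = (qre p)%:q + qdir p * (qnorm (qim p))%:q.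
Proof.
rewrite /qdir; have [p0|p0] := eqVneq (qim p) 0.
  split; first exact: qi_unitP.
  rewrite p0 /qnorm /qnorm2 /= expr0n /= !addr0 sqrtr0 mulr0 addr0.
  by case: p p0 => a b c d [-> -> ->].
have n0 : qnorm (qim p) != 0.
  apply: contraNneq p0 => n0; rewrite -qnorm2_eq0.
  have := congr1 (fun t => t ^+ 2) n0; rewrite expr0n /= sqr_sqrtr => [->//|].
  by rewrite /qnorm2 !addr_ge0 ?sqr_ge0.
split; last first.
  by rewrite -mulrA -realqM mulVf // mulr1; case: p {p0 n0} => a b c d; congr Quat; rewrite /= ?addr0 ?add0r.
split; first by rewrite /=; ring.
rewrite {1}/qnorm.
have -> : qnorm2 (qim p * (qnorm (qim p))^-1%:q) = qnorm2 (qim p) / qnorm (qim p) ^+ 2.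
  by rewrite /qnorm2 /=; field; exact: n0.
rewrite sqr_sqrtr ?divff ?sqrtr1 ?qnorm2_eq0 // /qnorm2 !addr_ge0 ?sqr_ge0 //.
Qed.

Lemma quat_imag_polar (p : HH) : qre p = 0 -> exists (I : HH) (x : R),
  [/\ qre I = 0, I * I = - 1, 0 <= x & p = I * x%:q].
Proof.
move=> p0; have [Iu pE] := qdirP p; exists (qdir p), (qnorm (qim p)); split.
- by case: Iu.
- exact: imag_unit_sqr.
- exact: sqrtr_ge0.
- by rewrite {1}pE p0 add0r.
Qed.

Definition quat_alg : qalg R :=
  @QAlg R (quat R) (@qconj R) (@qre R) (fun x => x%:q) quat_coord quat_decoord
    (fun p p0 => p0) qconjK qconjD qconjM qreD qreC realqD realqM erefl
    (fun x => erefl) realqC qre_realM addq_conj mulq_conj qnorm2_gt0 quat_coordD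
    quat_coordZ quat_coordK quat_decoordK quat_coord_le quat_imag_polar.

End Quaternions.

(** As I commutes with p, p (S + I T) = (xS - yT) + I (xT + yS), so the claim splits into two
    equations free of I; the hypotheses on c and d solve them. *)
Lemma star_equation (R : realType) (H : qalg R) (p I a b c d s : H) (x y : R) :
  I * I = -1 -> p = rq x + I * rq y -> rq x * c - rq y * d + c * s = 1 -> rq x * d + rq y * c + d * s = 0 ->
  let k := (a * c - b * d) + I * (a * d + b * c) in
  p * k + k * s = a + I * b.
Proof.
move=> I2 -> hc hd /=; set S := a * c - b * d; set T := a * d + b * c.
have xC t (u v : H) : rq t * (u * v) = u * (rq t * v) by rewrite mulrA -rqC mulrA.
have e1 : rq x * S - rq y * T + S * s = a.
  rewrite -[RHS]mulr1 -hc -[RHS]subr0 -(mulr0 b) -hd /S /T.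
  rewrite !mulrDr !mulrDl !mulrN !mulNr !xC -!mulrA !opprD !addrA.
  by rewrite [LHS](ACl (1 * 3 * 5 * 2 * 4 * 6)).
have e2 : rq x * T + rq y * S + T * s = b.
  rewrite -[RHS]mulr1 -hc -[RHS]addr0 -[X in _ = _ + X](mulr0 a) -hd /S /T.
  rewrite !mulrDr !mulrDl !mulrN !xC -!mulrA !addrA.
  by rewrite [LHS](ACl (2 * 4 * 6 * 1 * 3 * 5)).
clearbody S T.
have Iy : I * rq y * (I * T) = - (rq y * T).
  by rewrite -mulrA xC mulrA I2 mulN1r.
rewrite -[in RHS]e1 -[in RHS]e2 !(mulrDl, mulrDr) Iy !xC -!mulrA !addrA.
by rewrite [LHS](ACl (1 * 4 * 5 * 2 * 3 * 6)).
Qed.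

(** The equation at the two points x + iy and x - iy is converted into equations for the components
    c and d that no longer mention i, hence serve every unit I. *)
Lemma half_sum_equations (R : realType) (H : qalg R) (i s sp sm : H) (x y : R) :
  i * i = -1 -> (rq x + i * rq y) * sp + sp * s = 1 ->
  (rq x + i * rq (- y)) * sm + sm * s = 1 ->
  let c := rq 2^-1 * (sp + sm) in let d := rq 2^-1 * i * (sm - sp) in
  rq x * c - rq y * d + c * s = 1 /\ rq x * d + rq y * c + d * s = 0.
Proof.
move=> i2 ep em c d; set h := rq 2^-1 : H.
have h2 : h * (1 + 1) = 1 by rewrite -(rq1 H) -rqD -rqM mulVf.
have hC t (u : H) : rq t * (h * u) = h * (rq t * u) by rewrite mulrA -rqC mulrA.
have iC t (u : H) : rq t * (i * u) = i * (rq t * u) by rewrite mulrA -rqC mulrA.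
have E1 : 1 = rq x * sp + i * (rq y * sp) + sp * s by rewrite -ep mulrDl -mulrA.
have E2 : 1 = rq x * sm - i * (rq y * sm) + sm * s.
  by rewrite -em mulrDl -mulrA rqN mulNr mulrN.
have dE : d = h * (i * sm) - h * (i * sp) by rewrite /d -mulrA mulrBr mulrBr.
have cE : c = h * sp + h * sm by rewrite /c mulrDr.
rewrite cE dE; clearbody h; split.
  rewrite -[RHS]h2 {1}E1 E2 !(mulrDl, mulrDr, mulrN, mulNr, opprD, opprK) -!mulrA !(hC, iC) !addrA.
  by rewrite [LHS](ACl (1 * 4 * 5 * 2 * 3 * 6)).
have <- : h * (i * 1 - i * 1) = 0 by rewrite subrr mulr0.
rewrite {1}E2 E1 !(mulrDl, mulrDr, mulrN, mulNr, opprD, opprK) -!mulrA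
  !(hC, iC) !(mulrA i i) i2 !mulN1r !mulrN !opprK !addrA.
by rewrite [LHS](ACl (1 * 4 * 5 * 2 * 3 * 6)).
Qed.

Lemma star_entrywise (T : pzRingType) n (a b E : 'M[T]_n) (p s c d I : T) :
  (forall i j, let k := ((a i j + E i j) * c - b i j * d) +
      I * ((a i j + E i j) * d + b i j * c) in
    p * k + k * s = a i j + E i j + I * b i j) ->
  let k := ((a + E) *m c%:M - b *m d%:M) + I *: ((a + E) *m d%:M + b *m c%:M) in
  p *: k + k *m s%:M = a + I *: b + E.
Proof.
move=> h k; apply/matrixP => i j; have {h} := h i j.
set l := _ + I * _ => /= hl.
have kE : k i j = l.
  rewrite /k mxE [X in X + _]mxE [X in _ + X + _]mxE [X in _ + X]mxE [X in _ * X]mxE.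
  by rewrite !mulmx_scalarE !mxE.
rewrite mxE [X in X + _]mxE mulmx_scalarE kE hl [RHS]mxE [X in _ = X + _]mxE.
by rewrite [X in _ = _ + X + _]mxE addrAC.
Qed.

Section KernelEquation.
Variable R : realType.
Local Notation HH := (quat R).

(** The denominator equals p (p + r) + (p + r) [qconj r], so it is nonzero by [sylvester_inj], and
    it commutes with p as a real polynomial in p. *)
Lemma star_inv_equation (p r : HH) : 0 < qre p -> 0 < qre r ->
  p * star_inv_add_conj r p + star_inv_add_conj r p * qconj r = 1.
Proof.
move=> p0 r0; rewrite /star_inv_add_conj.
set den := _ + p ^+ 2.
have denE : p * (p + r) + (p + r) * qconj r = den.
  have n2E : (qnorm r ^+ 2)%:q = r * qconj r.
    rewrite mulq_conj qre_mul_conj sqr_sqrtr // /qnorm2 !addr_ge0 ?sqr_ge0 //.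
  rewrite /den n2E.
  have -> : (2 * qre r)%:q * p = p * r + p * qconj r.
    by rewrite -mulrDr addq_conj realqC.
  rewrite mulrDr mulrDl (expr2 p) !addrA.
  by rewrite [LHS](ACl (4 * 2 * 3 * 1)).
have pden : p * den = den * p.
  by rewrite /den !mulrDr !mulrDl (expr2 p) realqC (mulrA p _ p) realqC !mulrA.
have den0 : den != 0.
  apply/eqP => d0; move: denE; rewrite d0.
  move/(@sylvester_inj R (quat_alg R) p r (p + r) p0 r0) => pr0.
  by have := addr_gt0 p0 r0; rewrite -qreD pr0 ltxx.
apply: (mulrI (x := den)); first exact: den0.
have denV : den * den^-1 = 1 by rewrite mulrV.
by rewrite mulr1 mulrDr !mulrA -pden -(mulrA p den) denV mulr1 mul1r.
Qed.

Lemma kernel_equation n (phi : HH -> 'M[HH]_n) (U : set HH) (p r : HH) :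
  slice_hyperholomorphic U phi -> U p -> 0 < qre p -> 0 < qre r ->
  p *: kernel_phi phi p r + kernel_phi phi p r *m (qconj r)%:M =
  phi p + ctmx (phi r).
Proof.
move=> [Usym _ [a [b hab]]] Up p0 r0.
have [Iu pE] := qdirP p; rewrite /kernel_phi /star.
set E := ctmx (phi r); set x := qre p in pE *; set y := qnorm (qim p) in pE *.
set I := qdir p in Iu pE *.
have UI : U (x%:q + I * y%:q) by rewrite -pE.
have Ui : U (x%:q + @qi_unit R * y%:q) by apply: Usym UI => //; exact: qi_unitP.
(* The values at x - iy entering [slice_alpha] and [slice_beta] are taken at the unit -i of the same
   sphere, hence inside U. *)
have Ni : imag_unit (- @qi_unit R).
  have [h1 h2] := qi_unitP R; split; first by rewrite /= oppr0.
  by rewrite -h2 /qnorm /qnorm2 /= !sqrrN.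
have iN : @qi_unit R * (- y)%:q = (- @qi_unit R) * y%:q.
  by congr Quat => /=; ring.
have Uni : U (x%:q + @qi_unit R * (- y)%:q).
  by rewrite iN; apply: Usym Ui => //; exact: qi_unitP.
have [phiI _ _ _ [ay by_]] := hab _ _ _ Iu UI.
have [phii _ _ _ _] := hab _ _ _ (qi_unitP R) Ui.
have [phini _ _ _ _] := hab _ _ _ (qi_unitP R) Uni.
have [||||-> ->] := @sliceE R n n (fun p' => phi p' + E) (fun s => a (x, s) + E)
  (fun s => b (x, s)) x y.
- exact: (etrans (congr1 (fun M => M + E) phii) (addrAC _ _ _)).
- exact: (etrans (congr1 (fun M => M + E) phini) (addrAC _ _ _)).
- exact: (congr1 (fun M => M + E) ay).
- exact: by_.
pose sp := star_inv_add_conj r (x%:q + @qi_unit R * y%:q).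
pose sm := star_inv_add_conj r (x%:q + @qi_unit R * (- y)%:q).
pose c := (2^-1)%:q * (sp + sm); pose d := (2^-1)%:q * @qi_unit R * (sm - sp).
have -> : slice_alpha (fun p' => (star_inv_add_conj r p')%:M : 'M[HH]_n) x y = c%:M.
  by rewrite /slice_alpha -raddfD -scale_scalar_mx.
have -> : slice_beta (fun p' => (star_inv_add_conj r p')%:M : 'M[HH]_n) x y = d%:M.
  by rewrite /slice_beta -raddfB -scale_scalar_mx.
have xp s : 0 < qre (x%:q + @qi_unit R * s%:q) by rewrite /= /x; lra.
have ep := star_inv_equation (xp y) r0; rewrite -/sp in ep.
have em := star_inv_equation (xp (- y)) r0; rewrite -/sm in em.
have [hc hd] := @half_sum_equations R (quat_alg R) (@qi_unit R) (qconj r) sp sm x y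
  (imag_unit_sqr (qi_unitP R)) ep em.
have phipE : phi p = a (x, y) + I *: b (x, y) := etrans (congr1 phi pE) phiI.
refine (etrans _ (congr1 (fun M => M + E) (esym phipE))).
apply: star_entrywise => i j.
exact: (@star_equation R (quat_alg R) p I (a (x, y) i j + E i j) (b (x, y) i j) c d
  (qconj r) x y (imag_unit_sqr Iu) pE hc hd).
Qed.

End KernelEquation.

Section Continuity.
Variable R : realType.
Local Notation HH := (quat R).

Lemma differentiable_near0 (f : R * R -> R) x y : differentiable f (x, y) ->
  forall eta, 0 < eta -> near0 (fun e => `|f (x + e, y) - f (x, y)| < eta).
Proof.
move=> /differentiable_continuous cf eta eta0.
have : \forall t \near (x, y), `|f (x, y) - f t| < eta.
  by move/cvgrPdist_lt : cf; apply.
case/nbhs_ballP => d /= d0 hd; exists d => // e e0 ed.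
rewrite distrC; apply: hd; split => /=; rewrite /ball /= ?subrr ?normr0 //.
by rewrite opprD addrA subrr add0r normrN gtr0_norm.
Qed.

Lemma qdifferentiable_near0 (f : R * R -> HH) x y : qdifferentiable f (x, y) ->
  forall eta, 0 < eta ->
  near0 (fun e => nq (f (x + e, y) - f (x, y) : quat_alg R) < eta).
Proof.
move=> [f1 f2 f3 f4] eta eta0; have e4 : 0 < eta / 4 by rewrite divr_gt0.
have [d d0 hd] := near0_and
  (near0_and (differentiable_near0 f1 e4) (differentiable_near0 f2 e4))
  (near0_and (differentiable_near0 f3 e4) (differentiable_near0 f4 e4)).
exists d => // e e0 ed; have [[h1 h2] [h3 h4]] := hd e e0 ed.
rewrite /nq /n2 -[X in _ < X](ger0_norm (ltW eta0)) -sqrtr_sqr ltr_sqrt ?exprn_gt0 //.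
rewrite [X in X < _]qre_mul_conj /qnorm2.
have sq (t : R) : `|t| < eta / 4 -> t ^+ 2 <= (eta / 4) ^+ 2.
  by move=> h; rewrite -real_normK ?num_real // ler_pXn2r ?nnegrE ?(ltW e4) // ltW.
have := sq _ h1; have := sq _ h2; have := sq _ h3; have := sq _ h4.
have : 0 < eta ^+ 2 by rewrite exprn_gt0.
have -> : (eta / 4) ^+ 2 = eta ^+ 2 / 16 by field.
rewrite /=; lra.
Qed.

Lemma mxdifferentiable_near0 n (f : R * R -> 'M[HH]_n) x y : mxdifferentiable f (x, y) ->
  forall eta, 0 < eta ->
  near0 (fun e => @mnorm R (quat_alg R) n n (f (x + e, y) - f (x, y)) < eta).
Proof.
move=> fd eta eta0; pose b := eta / (n%:R + 1).
have n1 : 0 < n%:R + 1 :> R by rewrite ltr_wpDl.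
have b0 : 0 < b by rewrite divr_gt0.
have [d d0 hd] := near0_forall (fun i => near0_forall (fun j => qdifferentiable_near0 (fd i j) b0)).
exists d => // e e0 ed; apply: le_lt_trans (_ : n%:R * b < _); last first.
  by rewrite /b mulrCA -[X in _ < X]mulr1 ltr_pM2l // ltr_pdivrMr // mul1r ltrDl.
apply: mnorm_le_entries; first exact: ltW.
move=> i j.
have -> : (f (x + e, y) - f (x, y)) i j = f (x + e, y) i j - f (x, y) i j.
  by rewrite mxE [X in _ + X]mxE.
exact: ltW (hd e e0 ed i j).
Qed.

(** A real translation keeps the unit I and the coordinate y, so only continuity of the two slice
    components in x is involved. *)
Lemma slice_continuous n (phi : HH -> 'M[HH]_n) (p : HH) : @right_half_space R p ->
  regular_set phi p -> forall eta, 0 < eta ->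
  near0 (fun e => (@right_half_space R `&` regular_set phi) (p + e%:q) /\
    @mnorm R (quat_alg R) n n (phi (p + e%:q) - phi p) < eta).
Proof.
move=> p0 [U [Up Uphi]] eta eta0; have [_ Uopen [a [b hab]]] := Uphi.
have [Iu pE] := qdirP p; set x := qre p in pE; set y := qnorm (qim p) in pE.
set I := qdir p in Iu pE.
have UI : U (x%:q + I * y%:q) by rewrite -pE.
have [phiI [da db] _ _ _] := hab _ _ _ Iu UI.
have e2 : 0 < eta / 2 by rewrite divr_gt0.
have [d d0 hd] := near0_and (mxdifferentiable_near0 da e2) (mxdifferentiable_near0 db e2).
have [d' d'0 hU] := Uopen _ Up.
exists (Num.min d d'); first by rewrite lt_min d0.
move=> e e0; rewrite lt_min => /andP[ed ed'].
have Upe : U (p + e%:q).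
  by apply: hU; rewrite addrAC subrr add0r /qnorm /qnorm2 /= expr0n /= !addr0 sqrtr_sqr gtr0_norm.
have pe : p + e%:q = (x + e)%:q + I * y%:q by rewrite {1}pE realqD addrAC.
split.
  split; last by exists U.
  by move: p0; rewrite /right_half_space /=; lra.
have [phie _ _ _ _] := hab _ _ _ Iu (eq_ind _ U Upe _ pe).
have -> : phi (p + e%:q) - phi p =
    (a (x + e, y) - a (x, y)) + I *: (b (x + e, y) - b (x, y)).
  rewrite (etrans (congr1 phi pe) phie) (etrans (congr1 phi pE) phiI).
  by rewrite scalerBr opprD addrACA.
have [h1 h2] := hd e e0 ed.
apply: le_lt_trans (mnormD _ _) _.
have nI : nq (I : quat_alg R) = 1.
  by case: Iu => _; rewrite /nq /n2 [X in Num.sqrt X]qre_mul_conj.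
have IE (M : 'M[HH]_n) :
    @mnorm R (quat_alg R) n n (I *: M) = @mnorm R (quat_alg R) n n M.
  apply: etrans (@mnormZ R (quat_alg R) n n I M) _.
  exact: etrans (congr1 (fun t => t * _) nI) (mul1r _).
rewrite [ltRHS]splitr; apply: ltrD; first exact: h1.
exact: (eq_ind_r (fun t => t < eta / 2) h2 (IE _)).
Qed.

End Continuity.

Theorem theorem6p1 (R : realType) (n N : nat) (phi : quat R -> 'M[quat R]_n)
    (C : 'M[quat R]_(n, N)) (A : 'M[quat R]_N) (B : 'M[quat R]_(N, n))
    (D : 'M[quat R]_n)
    (phi_rational : rational_slice_hyperholomorphic phi)
    (phi_infinity : slice_hyperholomorphic_at_infinity phi)
    (phi_realization : is_realization phi D C A B)
    (CAB_minimal : minimal_realization C A B) :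
  (exists kappa : nat,
     has_negative_squares (@right_half_space R `&` regular_set phi)
       (kernel_phi phi) kappa)
  <->
  (exists H : 'M[quat R]_N,
     [/\ qhermitian H, nonsingular H &
         positive_semidefinite
           (block_mx H 0 0 1%:M *m block_mx A B C D +
            ctmx (block_mx A B C D) *m block_mx H 0 0 1%:M)]).
Proof.
have [den [num [den0 den_slice phiE]]] := phi_rational.
have [F [[_ Freal] phiF]] := phi_realization.
have [obs ctr] := CAB_minimal.
have [chi chi0 chiA] := @annihilating_poly R (quat_alg R) N A.
have reg p : @evalq R (quat_alg R) den p != 0 -> regular_set phi p.
  by move=> dp; exists [set p | (map_poly (fun x : R => x%:q) den).[p] != 0].
have transfer :=
  @transfer_function R (quat_alg R) n N phi C A B D den chi num den0 chi0 chiA phiE.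
have row_uniq (a : quat_alg R) (z : 'rV[quat_alg R]_N) :
    evalq (den * chi) a != 0 -> a *: z = z *m A -> z = 0.
  rewrite evalqM qmulf_eq0 negb_or => /andP[_ ca] az.
  have := evalq_intertwine chi az; rewrite chiA mulmx0 => cz.
  by rewrite -[z]scale1r -(qmulVq ca) -scalerA cz scaler0.
have Om_re p : (@right_half_space R `&` regular_set phi) p -> 0 < qre p by case.
have Om_generic p : 0 < qre p -> @evalq R (quat_alg R) (den * chi) p != 0 ->
    (@right_half_space R `&` regular_set phi) p.
  move=> p0; rewrite evalqM qmulf_eq0 negb_or => /andP[dp _].
  split; [exact: p0|exact: reg].
have phi_generic := transfer (fun x G dx xG Gx =>
  etrans (phiF _ (reg _ dx)) (congr1 (+%R D) (Freal x G (reg _ dx) (conj xG Gx)))).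
have phi_cont p (hp : (@right_half_space R `&` regular_set phi) p) :=
  slice_continuous hp.1 hp.2.
have K_eq p r : (@right_half_space R `&` regular_set phi) p ->
    (@right_half_space R `&` regular_set phi) r ->
    p *: kernel_phi phi p r + kernel_phi phi p r *m (qconj r)%:M = phi p + ctmx (phi r).
  by move=> [p0 [U [Up Uphi]]] [r0 _]; exact: (kernel_equation Uphi).
have main := @negative_squares_iff_lmi R (quat_alg R) n N C A B D (den * chi)
  (@right_half_space R `&` regular_set phi) phi (kernel_phi phi)
  (mulf_neq0 den0 chi0) Om_re Om_generic phi_generic row_uniq phi_cont K_eq obs ctr.
exact: main.
Qed.
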